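(* Let $L\subset\mathbb R^2$ be the closed unit ball and let $\Lambda\subset\mathbb T\times(-1,1)$ be an open set with $S(\Lambda)=\Lambda$ and $(\mathbb T\times(-1,1))\setminus\overline\Lambda$ nonempty. If there exists a modulus of continuity $\omega$ such that for some $s_1,s_2\in\mathbb R$ and $\delta>0$ one has the stability estimate $$\|f\|_{H^{s_1}(\mathbb R^2)}\le\omega(\|Rf\|_{H^{s_2}(\Lambda)})\quad\text{whenever }\ \|f\|_{H^{s_1+\delta}_L(\mathbb R^2)}\le1,$$ then for any $\mu>1$ there exists a constant $C_\mu>0$ such that $$\omega(t)\ge C_\mu|\log(t)|^{-\frac{\delta(2\mu+1)}2}\quad\text{for all sufficiently small }t>0.$$
   Context: $\mathbb T=[0,2\pi]$ with $0$ and $2\pi$ identified. For $\varphi\in\mathbb T$ put $\theta=(\cos\varphi,\sin\varphi)$, $\theta^\perp=(-\sin\varphi,\cos\varphi)$. The Radon transform of $f\in C_c^\infty(\mathbb R^2)$ is $Rf(\varphi,s)=\int_{-\infty}^\infty f(s\theta+t\theta^\perp)\,dt$, $(\varphi,s)\in\mathbb T\times\mathbb R$; it extends by duality to compactly supported distributions. $S$ is the symmetry $S(\varphi,s)=(\varphi+\pi,-s)$. $H^s_L(\mathbb R^2)$ is the space of $f\in H^s(\mathbb R^2)$ with $\mathrm{supp}(f)\subset L$, with the $H^s(\mathbb R^2)$ norm, and $H^{s_2}(\Lambda)$ is the Sobolev space of restrictions to $\Lambda$. A modulus of continuity is an increasing function $\omega:[0,\infty]\to[0,\infty]$ that is continuous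 at $0$ with $\omega(0)=0$. *)

(* Defs.v *)
From mathcomp Require Import all_boot all_order all_algebra.
From mathcomp Require Export complex.
From mathcomp Require Import all_classical all_reals all_analysis.
Import Order.TTheory GRing.Theory Num.Theory.
Import numFieldNormedType.Exports.

Set Implicit Arguments.
Unset Strict Implicit.
Unset Printing Implicit Defensive.

Local Open Scope classical_set_scope.
Local Open Scope ring_scope.
Local Open Scope complex_scope.

(* Functions and distributions are complex-valued.  A function on the cylinder
   T x R, with T = R / 2 pi Z, is a function (phi, s) |-> psi (phi, s) on R x R
   that is 2 pi-periodic in phi; a subset of T x R is likewise given by its
   2 pi-periodic preimage in R x R, so that openness and closure are the usual
   ones of the plane. *)

Section Analysis.
Context {R : realType}.
Local Notation plane := (R * R)%type.
Local Notation mu := (@lebesgue_measure R).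
Local Notation mu2 := ((@lebesgue_measure R) \x (@lebesgue_measure R))%E.

Definition cabs (z : R[i]) : R := complex.ComplexField.Normc.normc z.

Definition expi (t : R) : R[i] := cos t +i* sin t.

Definition cintegral d (T : measurableType d) (m : {measure set T -> \bar R})
    (D : set T) (f : T -> R[i]) : R[i] :=
  (Rintegral m D (fun x => complex.Re (f x)))
  +i* (Rintegral m D (fun x => complex.Im (f x))).

Definition cmeasurable d (T : measurableType d) (f : T -> R[i]) : Prop :=
  measurable_fun setT (fun x => complex.Re (f x)) /\
  measurable_fun setT (fun x => complex.Im (f x)).

Definition axis (b : bool) : plane := if b then (0, 1) else (1, 0).

Definition cpartial (b : bool) (f : plane -> R[i]) : plane -> R[i] :=
  fun p => ('D_(axis b) (fun q => complex.Re (f q)) p)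
           +i* ('D_(axis b) (fun q => complex.Im (f q)) p).

(* A multi-index is a word in the two axes. *)
Definition cpartials (a : seq bool) (f : plane -> R[i]) : plane -> R[i] :=
  foldr cpartial f a.

Definition smooth (f : plane -> R[i]) : Prop :=
  forall a : seq bool,
    [/\ continuous (fun p => complex.Re (cpartials a f p)),
        continuous (fun p => complex.Im (cpartials a f p)) &
        forall (b : bool) (p : plane),
          derivable (fun q => complex.Re (cpartials a f q)) p (axis b) /\
          derivable (fun q => complex.Im (cpartials a f q)) p (axis b)].

Definition fsupport (f : plane -> R[i]) : set plane :=
  closure [set p | f p != 0].

Definition linear_on (E : set (plane -> R[i])) (u : (plane -> R[i]) -> R[i]) :=
  forall (a : R[i]) (f g : plane -> R[i]), E f -> E g ->
    u (fun p => a * f p + g p) = a * u f + u g.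

(* [B] bounds the [N]-th seminorm of [f]; stating upper bounds in place of a
   supremum keeps the seminorms free of any finiteness convention. *)
Definition seminorm_le (w : plane -> R) (N : nat) (f : plane -> R[i]) (B : R) :=
  forall (a : seq bool) (p : plane), (size a <= N)%N ->
    w p ^+ N * cabs (cpartials a f p) <= B.

Definition rapidly_decreasing (w : plane -> R) (f : plane -> R[i]) : Prop :=
  forall N : nat, exists B : R, seminorm_le w N f B.

(* Distributions are functionals on functions; only their values on the
   relevant space of test functions are meaningful. *)

Definition test_function (U : set plane) (f : plane -> R[i]) : Prop :=
  [/\ smooth f, compact (fsupport f) & fsupport f `<=` U].

(* E'(R^2), the continuous dual of C^oo(R^2). *)
Definition compactly_supported_distribution (u : (plane -> R[i]) -> R[i]) :=
  linear_on smooth u /\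
  exists (r M : R) (N : nat), forall (f : plane -> R[i]) (B : R), smooth f ->
    (forall (a : seq bool) (p : plane), (size a <= N)%N -> `|p| <= r ->
       cabs (cpartials a f p) <= B) ->
    cabs (u f) <= M * B.

Definition dsupport (u : (plane -> R[i]) -> R[i]) : set plane :=
  [set x | forall U : set plane, open U -> U x ->
     exists2 f : plane -> R[i], test_function U f & u f != 0].

Definition schwartz (f : plane -> R[i]) : Prop :=
  smooth f /\ rapidly_decreasing (fun p => 1 + `|p|) f.

Definition fourier2 (f : plane -> R[i]) (xi : plane) : R[i] :=
  cintegral mu2 setT (fun x => f x * expi (- (x.1 * xi.1 + x.2 * xi.2))).

(* The Fourier transform of the distribution [u], defined by duality, is the
   function [g]. *)
Definition has_fourier2 (u : (plane -> R[i]) -> R[i]) (g : plane -> R[i]) :=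
  cmeasurable g /\
  forall f : plane -> R[i], schwartz f ->
    u (fourier2 f) = cintegral mu2 setT (fun xi => g xi * f xi).

(* The H^s(R^2) norm, equal to +oo outside H^s(R^2): [g] is unique up to a null
   set when it exists, and the infimum of the empty set is +oo. *)
Definition sobolev2 (s : R) (u : (plane -> R[i]) -> R[i]) : \bar R :=
  ereal_inf [set N : \bar R | exists2 g : plane -> R[i], has_fourier2 u g &
    N = ((\int[mu2]_(xi in setT)
           ((1 + xi.1 ^+ 2 + xi.2 ^+ 2) `^ s * cabs (g xi) ^+ 2)%:E)
         `^ 2^-1)%E].

Definition cderive1 (h : R -> R[i]) : R -> R[i] :=
  fun x => (derive1 (fun y => complex.Re (h y)) x)
           +i* (derive1 (fun y => complex.Im (h y)) x).

Definition schwartz1 (h : R -> R[i]) : Prop :=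
  (forall (n : nat) (x : R),
     derivable (fun y => complex.Re (iter n cderive1 h y)) x 1 /\
     derivable (fun y => complex.Im (iter n cderive1 h y)) x 1) /\
  (forall n N : nat, exists B : R, forall x : R,
     (1 + `|x|) ^+ N * cabs (iter n cderive1 h x) <= B).

Definition fourier1 (h : R -> R[i]) (sigma : R) : R[i] :=
  cintegral mu setT (fun s => h s * expi (- (s * sigma))).

Definition periodic_fun (f : plane -> R[i]) : Prop :=
  forall phi s : R, f (phi + 2 * pi, s) = f (phi, s).

Definition periodic_set (A : set plane) : Prop :=
  forall phi s : R, A (phi + 2 * pi, s) <-> A (phi, s).

Definition cylinder_weight (p : plane) : R := 1 + `|p.2|.

Definition cylinder_schwartz (f : plane -> R[i]) : Prop :=
  [/\ smooth f, periodic_fun f & rapidly_decreasing cylinder_weight f].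

Definition cylinder_tempered (v : (plane -> R[i]) -> R[i]) : Prop :=
  linear_on cylinder_schwartz v /\
  exists (M : R) (N : nat), forall (f : plane -> R[i]) (B : R),
    cylinder_schwartz f -> seminorm_le cylinder_weight N f B ->
    cabs (v f) <= M * B.

(* The Fourier transform of [v], a tempered distribution on Z x R, is the
   function [g]: tested against delta_k (x) h, whose transform is
   (phi, s) |-> e^(- i k phi) * fourier1 h s. *)
Definition cylinder_has_fourier (v : (plane -> R[i]) -> R[i])
    (g : int -> R -> R[i]) : Prop :=
  forall k : int, cmeasurable (g k) /\
    forall h : R -> R[i], schwartz1 h ->
      v (fun p => expi (- (k%:~R * p.1)) * fourier1 h p.2) =
      cintegral mu setT (fun sigma => g k sigma * h sigma).

(* The H^s(T x R) norm. *)
Definition cylinder_sobolev (s : R) (v : (plane -> R[i]) -> R[i]) : \bar R :=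
  ereal_inf [set N : \bar R | exists2 g : int -> R -> R[i],
    cylinder_has_fourier v g &
    N = ((\esum_(k in [set: int])
           \int[mu]_(sigma in setT)
             ((1 + k%:~R ^+ 2 + sigma ^+ 2) `^ s * cabs (g k sigma) ^+ 2)%:E)
         `^ 2^-1)%E].

(* The support of [f] is compact in T x R and contained in [Lam]. *)
Definition cylinder_test_function (Lam : set plane) (f : plane -> R[i]) : Prop :=
  [/\ smooth f, periodic_fun f, fsupport f `<=` Lam &
      exists r : R, forall p : plane, fsupport f p -> `|p.2| <= r].

(* The H^s(Lam) norm of the restriction of [w] to [Lam], for the space of
   restrictions to [Lam] of elements of H^s(T x R): the quotient norm. *)
Definition restriction_sobolev (s : R) (Lam : set plane)
    (w : (plane -> R[i]) -> R[i]) : \bar R :=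
  ereal_inf [set cylinder_sobolev s v | v in
    [set v : (plane -> R[i]) -> R[i] | cylinder_tempered v /\
       forall f : plane -> R[i], cylinder_test_function Lam f -> v f = w f]].

(* theta = (cos phi, sin phi), theta^perp = (- sin phi, cos phi). *)
Definition radon (f : plane -> R[i]) (p : plane) : R[i] :=
  cintegral mu setT (fun t =>
    f (p.2 * cos p.1 - t * sin p.1, p.2 * sin p.1 + t * cos p.1)).

(* The formal transpose of [radon]:
   int_T int_R radon f (phi, s) psi (phi, s) ds dphi
     = int_(R^2) f x * radon_transpose psi x dx. *)
Definition radon_transpose (psi : plane -> R[i]) (x : plane) : R[i] :=
  cintegral mu `[0, 2 * pi]%classic (fun phi =>
    psi (phi, x.1 * cos phi + x.2 * sin phi)).

(* The extension of [radon] by duality to compactly supported distributions. *)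
Definition radon_distribution (u : (plane -> R[i]) -> R[i]) :
    (plane -> R[i]) -> R[i] :=
  fun psi => u (radon_transpose psi).

Definition unit_ball : set plane := [set x | x.1 ^+ 2 + x.2 ^+ 2 <= 1].

Definition strip : set plane := [set p | -1 < p.2 < 1].

Definition antipode (p : plane) : plane := (p.1 + pi, - p.2).

Definition modulus_of_continuity (omega : \bar R -> \bar R) : Prop :=
  [/\ forall t : \bar R, (0 <= t)%E -> (0 <= omega t)%E,
      forall t t' : \bar R, (0 <= t)%E -> (t <= t')%E -> (omega t <= omega t')%E,
      omega 0%E = 0%E &
      omega @ within [set t : \bar R | (0 <= t)%E] (nbhs 0%E) --> 0%E].

End Analysis.

(* Main.v *)
Require Import Defs.
From HB Require Import structures.
From mathcomp Require Import all_boot all_order all_algebra.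
From mathcomp Require Import all_classical all_reals all_analysis.
From mathcomp Require Import measurable_realfun.
From mathcomp Require Import ring lra.
Import Order.TTheory GRing.Theory Num.Theory.
Import numFieldNormedType.Exports.
Local Open Scope classical_set_scope.
Local Open Scope ring_scope.
Set Implicit Arguments.
Unset Strict Implicit.
Unset Printing Implicit Defensive.

(* Let (phi0, s0) lie in the strip outside the closure of Lam, and put
   theta0 = (cos phi0, sin phi0).  For N = K n consider the wave packet
   u(x) = lam e^(i N x.theta0) b(x - s0 theta0), where b is a tensor product of
   B-splines, each a convolution of a fixed number of boxes of fixed width and
   of 2n boxes of width of order 1/n.  The support of u stays in a fixed small
   box, while its Fourier transform is concentrated at N theta0 and is O(e^(-2n))
   at all sigma theta(phi) with phi away from phi0 modulo pi.

   By the symmetry of Lam, on Lam the Radon transform of u only involves such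
   angles phi, so it is not changed there by a cutoff kap(phi) that vanishes near
   phi0 modulo pi.  By the Fourier slice theorem the transform of kap R u is
     g_k(sigma) = int kap(phi) e^(-i k phi) u^(sigma theta(phi)) dphi,
   which is O(lam e^(-2n)) with decay in sigma; integrating by parts in phi gives
   decay in k at the price of powers of sigma.  The geometric mean of the two
   bounds shows that the norm of R u on Lam is O(lam e^(-n)).

   Choosing lam so that u has H^(s1 + delta) norm at most 1 leaves an H^s1 norm
   of order at least n^(-delta), so omega(e^(-n/2)) >= c n^(-delta) for n large.
   This gives omega(t) >= c |ln t|^(-delta), and delta <= delta (2 m + 1) / 2. *)

(** * Complex-valued integrals *)

(** The obstacle is that a nonzero compactly supported function never has an exponentially decaying
    transform, so no fixed window can serve: [b] changes with n, and exponential smallness is asked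
    only at the scale n. At an offset y with a |y| / n >= e, each of the n pairs of narrow boxes
    contributes at most e^(-2). The fixed boxes give polynomial decay with constants free of n,
    which keeps every Sobolev norm of u comparable to lam times a power of N. The factor K = 4 e /
    (a r) brings all frequencies sigma theta(phi) with |sin (phi - phi0)| >= r into the range of
    exponential smallness. The norm on Lam is a quotient norm, so an upper bound needs an extension
    to the whole cylinder, and kap R u is one. Smallness alone is not summable in k, and decay in k
    alone is not small; their geometric mean is both, at the cost of halving the rate e^(-2n).
    Finite orders of smoothness and decay suffice because a single integer S bounds all Sobolev
    exponents involved. Since lam grows at most polynomially in n, half of the remaining rate
    absorbs it, whence e^(-n/2). *)

Section ComplexModulus.
Context {R : realType}.
Implicit Types (z w : R[i]) (x y : R).

Lemma cabs_ge0 z : 0 <= cabs z.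
Proof. by case: z => a b; exact: sqrtr_ge0. Qed.

Lemma cabsM z w : cabs (z * w) = cabs z * cabs w.
Proof. exact: complex.ComplexField.Normc.normcM. Qed.

Lemma cabsD z w : cabs (z + w) <= cabs z + cabs w.
Proof. exact: le_normcD. Qed.

Lemma cabs0 : cabs (0 : R[i]) = 0.
Proof. exact: complex.ComplexField.Normc.normc0. Qed.

Lemma Re_le_cabs z : `|complex.Re z| <= cabs z.
Proof.
by case: z => a b /=; rewrite -sqrtr_sqr ler_wsqrtr// lerDl sqr_ge0.
Qed.

Lemma Im_le_cabs z : `|complex.Im z| <= cabs z.
Proof.
by case: z => a b /=; rewrite -sqrtr_sqr ler_wsqrtr// lerDr sqr_ge0.
Qed.

Lemma cabs_le_ReIm z : cabs z <= `|complex.Re z| + `|complex.Im z|.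
Proof.
case: z => a b /=; rewrite -(@ger0_norm _ (`|a| + `|b|)) ?addr_ge0//.
rewrite -sqrtr_sqr ler_wsqrtr// sqrrD !real_normK ?num_real//.
by rewrite addrAC lerDl mulrn_wge0// mulr_ge0.
Qed.

Lemma cabs_real x : cabs x%:C%C = `|x|.
Proof. by rewrite /= expr0n/= addr0 sqrtr_sqr. Qed.

Lemma cabs_expi x : cabs (expi x) = 1.
Proof. by rewrite /= cos2Dsin2 sqrtr1. Qed.

Lemma expiD x y : expi (x + y) = expi x * expi y.
Proof.
rewrite /expi cosD sinD; simpc; congr (_ +i* _)%C; ring.
Qed.

Lemma expi0 : expi 0 = 1 :> R[i].
Proof. by rewrite /expi cos0 sin0. Qed.

Lemma complex_ReM z w : complex.Re (z * w)
  = complex.Re z * complex.Re w - complex.Im z * complex.Im w.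
Proof. by case: z; case: w. Qed.

Lemma complex_ImM z w : complex.Im (z * w)
  = complex.Re z * complex.Im w + complex.Im z * complex.Re w.
Proof. by case: z; case: w => a b c d /=. Qed.

Lemma complex_ReD z w : complex.Re (z + w) = complex.Re z + complex.Re w.
Proof. by case: z; case: w. Qed.

Lemma complex_ImD z w : complex.Im (z + w) = complex.Im z + complex.Im w.
Proof. by case: z; case: w. Qed.

End ComplexModulus.

Section ComplexMeasurability.
Context {R : realType} d (T : measurableType d).
Implicit Types f g : T -> R[i].

Lemma cmeasurable_real (f : T -> R) : measurable_fun setT f ->
  cmeasurable (fun x => (f x)%:C%C).
Proof. by move=> mf; split => //=; exact: measurable_cst. Qed.

Lemma cmeasurable_cst (z : R[i]) : cmeasurable (fun _ : T => z).
Proof. by split; exact: measurable_cst. Qed.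

Lemma cmeasurable_expi (f : T -> R) : measurable_fun setT f ->
  cmeasurable (fun x => expi (f x)).
Proof.
move=> mf; split => /=; apply: measurableT_comp => //.
  by apply: continuous_measurable_fun; exact: continuous_cos.
by apply: continuous_measurable_fun; exact: continuous_sin.
Qed.

Lemma cmeasurableM f g : cmeasurable f -> cmeasurable g ->
  cmeasurable (fun x => f x * g x).
Proof.
move=> [rf jf] [rg jg]; split.
  under eq_fun do rewrite complex_ReM.
  by apply: measurable_funB; exact: measurable_funM.
under eq_fun do rewrite complex_ImM.
by apply: measurable_funD; exact: measurable_funM.
Qed.

Lemma cmeasurableD f g : cmeasurable f -> cmeasurable g ->
  cmeasurable (fun x => f x + g x).
Proof.
move=> [rf jf] [rg jg]; split.
  by under eq_fun do rewrite complex_ReD; exact: measurable_funD.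
by under eq_fun do rewrite complex_ImD; exact: measurable_funD.
Qed.

Lemma measurable_cabs f : cmeasurable f -> measurable_fun setT (fun x => cabs (f x)).
Proof.
move=> [rf jf].
under eq_fun => x.
  rewrite (_ : cabs (f x) = Num.sqrt (complex.Re (f x) ^+ 2 + complex.Im (f x) ^+ 2));
    last by case: (f x).
  over.
apply: (@measurableT_comp _ _ _ _ _ _ (@Num.sqrt R)).
  by apply: continuous_measurable_fun; exact: sqrt_continuous.
by apply: measurable_funD; exact: measurable_funX.
Qed.

End ComplexMeasurability.

Lemma cmeasurable_comp {R : realType} d d' (T : measurableType d)
    (U : measurableType d') (h : T -> U) (f : U -> R[i]) :
  measurable_fun setT h -> cmeasurable f -> cmeasurable (f \o h).
Proof. by move=> mh [rf jf]; split; [exact: (measurableT_comp rf)|exact: (measurableT_comp jf)]. Qed.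

Definition cintegrable {R : realType} d (T : measurableType d)
    (m : {measure set T -> \bar R}) (f : T -> R[i]) : Prop :=
  m.-integrable setT (EFin \o (fun x => complex.Re (f x))) /\
  m.-integrable setT (EFin \o (fun x => complex.Im (f x))).

Section ComplexIntegral.
Context {R : realType} d (T : measurableType d) (m : {measure set T -> \bar R}).
Implicit Types f g : T -> R[i].

Lemma cintegrable_cmeasurable f : cintegrable m f -> cmeasurable f.
Proof.
by move=> [/measurable_int/measurable_EFinP ? /measurable_int/measurable_EFinP ?].
Qed.

Lemma le_cintegrable f (g : T -> R) : cmeasurable f ->
  m.-integrable setT (EFin \o g) -> (forall x, cabs (f x) <= g x) ->
  cintegrable m f.
Proof.
move=> [rf jf] ig fg; split; apply: (le_integrable _ _ _ ig) => //=.
- exact/measurable_EFinP.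
- move=> x _; rewrite lee_fin (le_trans (Re_le_cabs _))// (le_trans (fg x))//.
  exact: ler_norm.
- exact/measurable_EFinP.
- move=> x _; rewrite lee_fin (le_trans (Im_le_cabs _))// (le_trans (fg x))//.
  exact: ler_norm.
Qed.

Lemma integrable_cabs f : cintegrable m f ->
  m.-integrable setT (EFin \o (fun x => cabs (f x))).
Proof.
move=> fi; have mf := cintegrable_cmeasurable fi; case: fi => ri ji.
apply: (@le_integrable _ _ _ _ _ _ _
  (EFin \o (fun x => `|complex.Re (f x)| + `|complex.Im (f x)|))) => //.
- by apply/measurable_EFinP; exact: measurable_cabs.
- move=> x _ /=; rewrite lee_fin ger0_norm ?cabs_ge0//.
  by rewrite (le_trans (cabs_le_ReIm _))// ler_norm.
- have := integrableD measurableT (integrable_norm ri) (integrable_norm ji).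
  by apply: eq_integrable.
Qed.

Lemma cintegralD f g : cintegrable m f -> cintegrable m g ->
  cintegral m setT (fun x => f x + g x) = cintegral m setT f + cintegral m setT g.
Proof.
move=> [rf jf] [rg jg]; rewrite /cintegral; simpc; congr (_ +i* _)%C.
  by rewrite -RintegralD//; apply: eq_Rintegral => x _; rewrite complex_ReD.
by rewrite -RintegralD//; apply: eq_Rintegral => x _; rewrite complex_ImD.
Qed.

Lemma cintegralZl (z : R[i]) f : cintegrable m f ->
  cintegral m setT (fun x => z * f x) = z * cintegral m setT f.
Proof.
case: z => a b [rf jf]; rewrite /cintegral; simpc; congr (_ +i* _)%C.
  rewrite -!RintegralZl// -RintegralB//.
  - by apply: eq_Rintegral => x _; rewrite complex_ReM.
  - by have := integrableZl measurableT a rf; apply: eq_integrable.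
  - by have := integrableZl measurableT b jf; apply: eq_integrable.
rewrite -!RintegralZl// -RintegralD//.
- by apply: eq_Rintegral => x _; rewrite complex_ImM.
- by have := integrableZl measurableT a jf; apply: eq_integrable.
- by have := integrableZl measurableT b rf; apply: eq_integrable.
Qed.

Lemma eq_cintegral (D : set T) f g : (forall x, D x -> f x = g x) ->
  cintegral m D f = cintegral m D g.
Proof.
by move=> fg; rewrite /cintegral; congr (_ +i* _)%C;
  apply: eq_Rintegral => x /set_mem Dx; rewrite fg.
Qed.

Lemma Rintegral_zero (D : set T) : Rintegral m D (fun=> 0) = 0.
Proof. by rewrite /Rintegral integral0. Qed.

Lemma cintegral_zero (D : set T) : cintegral m D (fun=> 0) = 0.
Proof. by rewrite /cintegral /= !Rintegral_zero. Qed.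

Lemma cintegral_real (D : set T) (f : T -> R) :
  cintegral m D (fun x => (f x)%:C%C) = (Rintegral m D f)%:C%C.
Proof. by rewrite /cintegral /= Rintegral_zero. Qed.

Lemma cintegral_mkcond (D : set T) f : cintegral m D f =
  cintegral m setT (fun x => (\1_D x)%:C%C * f x).
Proof.
rewrite /cintegral; congr (_ +i* _)%C; rewrite Rintegral_mkcond;
  apply: eq_Rintegral => x _; rewrite patchE indicE;
  by case: ifPn => _; case: (f x) => a b /=; simpc.
Qed.

Lemma cabs_cintegral_le f (g : T -> R) : cintegrable m f ->
  m.-integrable setT (EFin \o g) -> (forall x, cabs (f x) <= g x) ->
  cabs (cintegral m setT f) <= 2 * Rintegral m setT g.
Proof.
move=> [rf jf] ig fg; rewrite (le_trans (cabs_le_ReIm _))//= mulr_natl mulr2n.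
apply: lerD; apply: (le_trans (le_normr_Rintegral _ _)) => //;
  apply: le_Rintegral => //; do ?exact: integrable_norm; move=> x _.
  by rewrite (le_trans (Re_le_cabs _)).
by rewrite (le_trans (Im_le_cabs _)).
Qed.

Lemma cintegrableZl (z : R[i]) f : cintegrable m f -> cintegrable m (fun x => z * f x).
Proof.
move=> fi; apply: (@le_cintegrable _ (fun x => cabs z * cabs (f x))).
- by apply: cmeasurableM; [exact: cmeasurable_cst|exact: cintegrable_cmeasurable].
- have := integrableZl measurableT (cabs z) (integrable_cabs fi).
  by apply: eq_integrable.
- by move=> x; rewrite cabsM.
Qed.

Lemma cintegrableMr f g (B : R) : cintegrable m f -> cmeasurable g ->
  (forall x, cabs (g x) <= B) -> cintegrable m (fun x => f x * g x).
Proof.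
move=> fi mg gB; apply: (@le_cintegrable _ (fun x => B * cabs (f x))).
- by apply: cmeasurableM => //; exact: cintegrable_cmeasurable.
- have := integrableZl measurableT B (integrable_cabs fi).
  by apply: eq_integrable.
- by move=> x; rewrite cabsM mulrC ler_wpM2r// cabs_ge0.
Qed.

Lemma cintegrable_real (f : T -> R) : m.-integrable setT (EFin \o f) ->
  cintegrable m (fun x => (f x)%:C%C).
Proof.
move=> fi; split => //=.
by rewrite (_ : _ \o _ = cst 0%E)//; exact: integrable0.
Qed.

End ComplexIntegral.

(* The product [m1 \x m2] has no sigma-finite instance in the library; this alias
   carries one, so that products can be iterated. *)
Definition prod_measure {R : realType} d1 d2 (T1 : measurableType d1)
    (T2 : measurableType d2) (m1 : {sigma_finite_measure set T1 -> \bar R})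
    (m2 : {sigma_finite_measure set T2 -> \bar R}) :
  set (T1 * T2) -> \bar R := (m1 \x m2)%E.

Section ProductSigmaFinite.
Context {R : realType} d1 d2 (T1 : measurableType d1) (T2 : measurableType d2).
Variables (m1 : {sigma_finite_measure set T1 -> \bar R}).
Variables (m2 : {sigma_finite_measure set T2 -> \bar R}).

HB.instance Definition _ :=
  Measure.copy (prod_measure m1 m2) (m1 \x m2)%E.

Lemma sigma_finite_prod_measure : sigma_finite setT (prod_measure m1 m2).
Proof.
have /sigma_finiteP[F [TF ndF Foo]] := sigma_finiteT m1.
have /sigma_finiteP[G [TG ndG Goo]] := sigma_finiteT m2.
exists (fun n => F n `*` G n).
  rewrite -setXTT TF TG predeqE => -[x y]; split.
    move=> [/= [n _ Fnx] [k _ Gky]]; exists (maxn n k) => //; split.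
    - by move: x Fnx; exact/subsetPset/ndF/leq_maxl.
    - by move: y Gky; exact/subsetPset/ndG/leq_maxr.
  by move=> [n _ []/= ? ?]; split; exists n.
move=> k; have [? ?] := Foo k; have [? ?] := Goo k.
split; first exact: measurableX.
by rewrite [X in (X < _)%E]product_measure1E// lte_mul_pinfty// ge0_fin_numE.
Qed.

HB.instance Definition _ := Measure_isSigmaFinite.Build _ _ _
  (prod_measure m1 m2) sigma_finite_prod_measure.

End ProductSigmaFinite.

(** * Fubini's theorem for real and complex integrals *)

Section ComplexFubini.
Context {R : realType} d1 d2 (T1 : measurableType d1) (T2 : measurableType d2).
Variables (m1 : {sigma_finite_measure set T1 -> \bar R}).
Variables (m2 : {sigma_finite_measure set T2 -> \bar R}).

Lemma Rintegral_fubini (f : T1 * T2 -> R) :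
  (m1 \x m2)%E.-integrable setT (EFin \o f) ->
  Rintegral m1 setT (fun x => Rintegral m2 setT (fun y => f (x, y))) =
  Rintegral (m1 \x m2)%E setT f.
Proof.
move=> fi; rewrite [RHS]/Rintegral -(integral12_prod_meas1 fi); congr fine.
have Fi := integrable_fubini_F fi.
have mF := measurable_int _ Fi.
(* The inner integral is finite only almost everywhere and [fine] sends infinite values to 0, so the
   two integrands agree off a null set. *)
apply: ae_eq_integral => //.
- by apply/measurable_EFinP; exact: (measurableT_comp (@fine_measurable _ _ measurableT) mF).
- have [N [mN N0 NF]] := integrable_ae measurableT Fi.
  exists N; split=> //; apply: subset_trans NF => x /=; apply: contra_not => Fx _.
  by rewrite fineK//; exact: Fx.
Qed.

Lemma Rintegral_fubini_swap (f : T1 * T2 -> R) :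
  (m1 \x m2)%E.-integrable setT (EFin \o f) ->
  Rintegral m1 setT (fun x => Rintegral m2 setT (fun y => f (x, y))) =
  Rintegral m2 setT (fun y => Rintegral m1 setT (fun x => f (x, y))).
Proof.
move=> fi; rewrite Rintegral_fubini// [LHS]/Rintegral -(integral21_prod_meas1 fi).
have mf := measurable_int _ fi.
have Fi : m2.-integrable setT (fubini_G m1 (EFin \o f)).
  apply/integrableP; split; first exact: (measurable_fubini_G fi).
  apply: le_lt_trans ((integrable21ltyP m1 m2 mf).1 fi).
  apply: ge0_le_integral => //.
  - by apply: measurableT_comp => //; exact: (measurable_fubini_G fi).
  - apply: (@measurable_fun_fubini_tonelli_G _ _ _ _ _ m1 (fun z => `|(f z)%:E|%E)) => //.
    exact: measurableT_comp.
  - move=> y _; apply: le_abse_integral => //.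
    exact: (measurableT_comp mf (measurable_pair2 y)).
have mF := measurable_int _ Fi.
congr fine; apply: ae_eq_integral => //.
- by apply/measurable_EFinP; exact: (measurableT_comp (@fine_measurable _ _ measurableT) mF).
- have [N [mN N0 NF]] := integrable_ae measurableT Fi.
  exists N; split=> //; apply: subset_trans NF => x /=; apply: contra_not => Fx _.
  by rewrite fineK//; exact: Fx.
Qed.

Lemma cintegral_fubini (f : T1 * T2 -> R[i]) : cintegrable (m1 \x m2)%E f ->
  cintegral m1 setT (fun x => cintegral m2 setT (fun y => f (x, y))) =
  cintegral (m1 \x m2)%E setT f.
Proof.
by move=> [rf jf]; rewrite /cintegral; congr (_ +i* _)%C; [exact: (Rintegral_fubini rf)|exact: (Rintegral_fubini jf)].
Qed.

Lemma cintegral_fubini_swap (f : T1 * T2 -> R[i]) : cintegrable (m1 \x m2)%E f ->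
  cintegral m1 setT (fun x => cintegral m2 setT (fun y => f (x, y))) =
  cintegral m2 setT (fun y => cintegral m1 setT (fun x => f (x, y))).
Proof.
by move=> [rf jf]; rewrite /cintegral; congr (_ +i* _)%C; [exact: (Rintegral_fubini_swap rf)|exact: (Rintegral_fubini_swap jf)].
Qed.

Lemma integrable_tensor (a : T1 -> R) (b : T2 -> R) :
  m1.-integrable setT (EFin \o a) -> m2.-integrable setT (EFin \o b) ->
  (m1 \x m2)%E.-integrable setT (EFin \o (fun z => a z.1 * b z.2)).
Proof.
move=> ia ib.
have ma : measurable_fun setT a by exact/measurable_EFinP/(measurable_int m1).
have mb : measurable_fun setT b by exact/measurable_EFinP/(measurable_int m2).
have mab : measurable_fun setT (fun z : T1 * T2 => a z.1 * b z.2).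
  apply: measurable_funM.
    exact: (measurableT_comp ma measurable_fst).
  exact: (measurableT_comp mb measurable_snd).
apply/integrable12ltyP => /=; first exact/measurable_EFinP.
under eq_integral do under eq_integral do rewrite normrM EFinM.
have /integrableP[_ bfin] := ib; have /integrableP[_ afin] := ia.
under eq_integral => x _.
  rewrite ge0_integralZl_EFin//; last first.
    by apply/measurable_EFinP; exact: measurableT_comp.
  over.
rewrite ge0_integralZr//=; last 2 first.
- by apply/measurable_EFinP; exact: measurableT_comp.
- exact: integral_ge0.
rewrite lte_mul_pinfty//; first exact: integral_ge0.
by rewrite ge0_fin_numE//; exact: integral_ge0.
Qed.

Variables (a : T1 -> R[i]) (b : T2 -> R[i]).
Hypotheses (ia : cintegrable m1 a) (ib : cintegrable m2 b).

(** The exchanges of integrals below have this shape: integrable densities in separate variables,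
    coupled by a bounded kernel such as an exponential. Integrability on the product then follows
    from the tensor product alone. *)
Lemma cintegrable_kernel (K : T1 * T2 -> R[i]) (B : R) : cmeasurable K ->
  (forall z, cabs (K z) <= B) ->
  cintegrable (m1 \x m2)%E (fun z => a z.1 * b z.2 * K z).
Proof.
move=> mK KB; apply: cintegrableMr KB => //.
apply: (@le_cintegrable _ _ _ _ _ (fun z => cabs (a z.1) * cabs (b z.2))).
- apply: cmeasurableM.
    by apply: (cmeasurable_comp measurable_fst); exact: cintegrable_cmeasurable ia.
  by apply: (cmeasurable_comp measurable_snd); exact: cintegrable_cmeasurable ib.
- by apply: (@integrable_tensor (cabs \o a) (cabs \o b)); exact: integrable_cabs.
- by move=> z; rewrite cabsM.
Qed.

Lemma cintegral_kernel_swap (K : T1 * T2 -> R[i]) (B : R) : cmeasurable K ->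
  (forall z, cabs (K z) <= B) ->
  cintegral m1 setT (fun x => a x * cintegral m2 setT (fun y => b y * K (x, y))) =
  cintegral m2 setT (fun y => b y * cintegral m1 setT (fun x => a x * K (x, y))).
Proof.
move=> mK KB.
transitivity (cintegral m1 setT (fun x => cintegral m2 setT (fun y => a x * b y * K (x, y)))).
  apply: eq_cintegral => x _; rewrite -cintegralZl.
    by apply: eq_cintegral => y _; rewrite mulrA.
  apply: (@cintegrableMr _ _ _ _ b (fun y => K (x, y)) B ib) => [|y]; last exact: KB.
  by apply: (cmeasurable_comp (h := fun y => (x, y))) => //; exact: measurable_pair1.
rewrite (cintegral_fubini_swap (f := fun z => a z.1 * b z.2 * K z)); last first.
  exact: cintegrable_kernel KB.
apply: eq_cintegral => y _; rewrite -cintegralZl.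
  by apply: eq_cintegral => x _ /=; rewrite mulrA [b y * _]mulrC.
apply: (@cintegrableMr _ _ _ _ a (fun x => K (x, y)) B ia) => [|x]; last exact: KB.
by apply: (cmeasurable_comp (h := fun x => (x, y))) => //; exact: measurable_pair2.
Qed.

Lemma cintegral_tensor :
  cintegral (m1 \x m2)%E setT (fun z => a z.1 * b z.2) =
  cintegral m1 setT a * cintegral m2 setT b.
Proof.
rewrite -cintegral_fubini/=; last first.
  have := @cintegrable_kernel (fun=> 1) 1 (cmeasurable_cst _ _).
  under eq_fun do rewrite mulr1; apply => z.
  by rewrite cabs_real normr1.
under eq_cintegral do rewrite cintegralZl//.
rewrite mulrC -cintegralZl//.
by apply: eq_cintegral => x _; rewrite mulrC.
Qed.

End ComplexFubini.

(** The plane carries the product sigma-algebra, so an open set is exhibited as a countable union of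
    boxes with rational centres and radii [n.+1^-1]. *)
Lemma open_measurable_plane {R : realType} (A : set (R * R)) : open A -> measurable A.
Proof.
move=> oA.
pose box (n : nat) (q1 q2 : rat) : set (R * R) :=
  ball (ratr q1 : R) n.+1%:R^-1 `*` ball (ratr q2 : R) n.+1%:R^-1.
have -> : A = \bigcup_n \bigcup_q1 \bigcup_q2
    (if `[< box n q1 q2 `<=` A >] then box n q1 q2 else set0).
  apply/seteqP; split=> [p Ap|p [n _ [q1 _ [q2 _]]]]; last first.
    by case: asboolP => // H /H.
  have /nbhs_ballP[e /= e0 pA] : nbhs p A by exact: open_nbhs_nbhs.
  have [n ne] : exists n : nat, n.+1%:R^-1 < e / 2.
    have [n _ /(_ _ (leqnn _)) ne] := near_infty_natSinv_lt (PosNum (divr_gt0 e0 (ltr0n _ 2))).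
    by exists n.
  have n0 : (0 : R) < n.+1%:R^-1 by rewrite invr_gt0.
  have [r rE] : exists r : R, r = n.+1%:R^-1 by exists n.+1%:R^-1.
  move: ne n0; rewrite -rE => ne r0.
  have lt1 : p.1 - r < p.1 + r by lra.
  have [q1 /itvP Hq1] := rat_in_itvoo lt1.
  have lt2 : p.2 - r < p.2 + r by lra.
  have [q2 /itvP Hq2] := rat_in_itvoo lt2.
  have h1 : `|ratr q1 - p.1| < r by rewrite ltr_distl !Hq1.
  have h2 : `|ratr q2 - p.2| < r by rewrite ltr_distl !Hq2.
  exists n => //; exists q1 => //; exists q2 => //; case: asboolP => [_|[]].
    by split; rewrite /ball /= -rE.
  move=> z [/= z1 z2]; apply: pA; split.
    move: z1; rewrite /ball /= -?rE => z1; move: h1; rewrite distrC => h1.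
    by rewrite (le_lt_trans (ler_distD (ratr q1) _ _))//; lra.
  move: z2; rewrite /ball /= -?rE => z2; move: h2; rewrite distrC => h2.
  by rewrite (le_lt_trans (ler_distD (ratr q2) _ _))//; lra.
apply: bigcupT_measurable => n; apply: bigcupT_measurable_rat => q1.
apply: bigcupT_measurable_rat => q2; case: asboolP => _ //.
by apply: measurableX; exact: measurable_ball.
Qed.

Lemma continuous_measurable_plane {R : realType} (f : R * R -> R) :
  continuous f -> measurable_fun setT f.
Proof.
move=> cf; apply: (measurability _ (RGenOpens.measurableE R)) => _ [_ [a [b ->] <-]].
rewrite setTI; apply: open_measurable_plane.
by apply: open_comp; [move=> ? _; exact: cf|exact: interval_open].
Qed.

Lemma smooth_cmeasurable {R : realType} (f : R * R -> R[i]) : smooth f -> cmeasurable f.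
Proof.
by move=> /(_ [::])[cr ci _]; split; exact: continuous_measurable_plane.
Qed.

(** * Splines and their Fourier transforms *)

Section TrigonometricBounds.
Context {R : realType}.
Implicit Types x y xi : R.

Lemma is_derive_continuous (f df : R -> R) : (forall x, is_derive x 1 f (df x)) ->
  continuous f.
Proof.
move=> fd x; apply: differentiable_continuous; apply/derivable1_diffP.
exact: (@ex_derive _ _ _ _ _ _ _ (fd x)).
Qed.

Lemma MVT_global (f df : R -> R) a b : a < b -> (forall x, is_derive x 1 f (df x)) ->
  exists2 c, a < c < b & f b - f a = df c * (b - a).
Proof.
move=> ab fd; have [|c] := @MVT _ f df a b ab (fun x _ => fd x).
  by apply: continuous_subspaceT; exact: is_derive_continuous fd.
by rewrite in_itv /=; exists c.
Qed.

Lemma ler_norm_sin x : `|sin x| <= `|x|.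
Proof.
have pos y : 0 < y -> `|sin y| <= y.
  move=> y0; have [c _] := MVT_global y0 (@is_derive_sin R).
  rewrite sin0 !subr0 => ->.
  by rewrite normrM (gtr0_norm y0) ler_piMl ?cos_max// ltW.
have [x0|x0|->] := ltrgt0P x; last by rewrite sin0 normr0.
- exact: pos.
- by rewrite -normrN -sinN pos// oppr_gt0.
Qed.

Lemma cos_ge_sqr x : 1 - x ^+ 2 / 2 <= cos x.
Proof.
have -> : cos x = 1 - 2 * sin (x / 2) ^+ 2.
  by rewrite {1}(_ : x = (x / 2) *+ 2) ?cos_mulr2n ?cos2sin2 ?mulr2n; [ring|field].
have : sin (x / 2) ^+ 2 <= (x / 2) ^+ 2.
  rewrite -real_normK ?num_real// -[leRHS]real_normK ?num_real//.
  by rewrite lerXn2r ?nnegrE// ler_norm_sin.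
by move=> ?; lra.
Qed.

Definition sinc x : R := if x == 0 then 1 else sin x / x.

Lemma mul_sinc x : x * sinc x = sin x.
Proof.
rewrite /sinc; case: eqP => [->|/eqP x0]; first by rewrite mul0r sin0.
by rewrite mulrC divfK.
Qed.

Lemma norm_sinc_le1 x : `|sinc x| <= 1.
Proof.
rewrite /sinc; case: eqP => [_|/eqP x0]; first by rewrite normr1.
by rewrite normf_div ler_pdivrMr ?normr_gt0// mul1r ler_norm_sin.
Qed.

Lemma sinc_ge x : 0 <= x -> 1 - x ^+ 2 / 2 <= sinc x.
Proof.
move=> x0; rewrite /sinc; case: eqP => [->|/eqP xn0]; first by lra.
have {x0 xn0}x0 : 0 < x by rewrite lt_neqAle eq_sym xn0.
have [c /andP[c0 cx]] := MVT_global x0 (@is_derive_sin R).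
rewrite sin0 !subr0 => ->; rewrite mulfK ?gt_eqF//.
rewrite (le_trans _ (cos_ge_sqr c))// lerB// ler_pM2r ?invr_gt0//.
by rewrite lerXn2r ?nnegrE// ltW// (lt_trans c0).
Qed.

Lemma measurable_sinc : measurable_fun setT sinc.
Proof.
apply: measurable_fun_ifT => //.
- apply: (measurable_fun_bool true) => //.
  rewrite setTI (_ : _ @^-1` _ = [set 0]); first exact: measurable_set1.
  by apply/seteqP; split => z /=; [move=> /eqP|move=> ->; rewrite eqxx].
- apply: measurable_funM.
    by apply: continuous_measurable_fun; exact: continuous_sin.
  (* This identity also holds at 0, where both sides are 0, and reduces inversion to a real power,
     which is measurable. *)
  rewrite (_ : GRing.inv = fun x => x * ((x ^+ 2) `^ (-1))).
    apply: measurable_funM => //.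
    apply: (measurableT_comp (measurable_powR _)).
    exact: measurable_funX.
  apply/funext => x; rewrite powR_inv1 ?sqr_ge0//.
  by have [->|x0] := eqVneq x 0; [rewrite invr0 mul0r|field].
Qed.

Lemma Rintegral_cosM a b xi : a < b -> xi != 0 ->
  Rintegral (@lebesgue_measure R) `[a, b] (fun x => cos (x * xi)) = (sin (b * xi) - sin (a * xi)) / xi.
Proof.
move=> ab xi0; have D x : is_derive x (1 : R) (fun x => sin (x * xi) / xi) (cos (x * xi)).
  by apply: is_derive_eq; rewrite /GRing.scale/=; field.
have cF := is_derive_continuous D.
rewrite /Rintegral (@continuous_FTC2 _ _ (fun x => sin (x * xi) / xi))//=.
- by rewrite -mulrBl.
- apply: continuous_subspaceT => x.
  apply: continuous_comp; last exact: continuous_cos.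
  exact: mulrr_continuous.
- split.
  + by move=> x _; apply: ex_derive.
  + by apply: cvg_at_right_filter; exact: cF.
  + by apply: cvg_at_left_filter; exact: cF.
- by move=> x _; rewrite derive1E; apply: derive_val.
Qed.

Lemma Rintegral_sinM a b xi : a < b -> xi != 0 ->
  Rintegral (@lebesgue_measure R) `[a, b] (fun x => sin (x * xi)) =
  (cos (a * xi) - cos (b * xi)) / xi.
Proof.
move=> ab xi0; have D x : is_derive x (1 : R) (fun x => - cos (x * xi) / xi) (sin (x * xi)).
  by apply: is_derive_eq; rewrite /GRing.scale/=; field.
have cF := is_derive_continuous D.
rewrite /Rintegral (@continuous_FTC2 _ _ (fun x => - cos (x * xi) / xi))//=.
- by field.
- apply: continuous_subspaceT => x.
  apply: continuous_comp; last exact: continuous_sin.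
  exact: mulrr_continuous.
- split.
  + by move=> x _; apply: ex_derive.
  + by apply: cvg_at_right_filter; exact: cF.
  + by apply: cvg_at_left_filter; exact: cF.
- by move=> x _; rewrite derive1E; apply: derive_val.
Qed.

Lemma cintegral_expi_itv (c a xi : R) : 0 < a ->
  cintegral (@lebesgue_measure R) `[c - a, c + a] (fun x => expi (- (x * xi))) =
  (2 * a * sinc (a * xi))%:C%C * expi (- (c * xi)).
Proof.
move=> a0; have ab : c - a < c + a by lra.
have [->|xi0] := eqVneq xi 0.
  rewrite !mulr0 oppr0 /sinc eqxx mulr1 expi0 mulr1 /cintegral.
  have e0 x : expi (- (x * 0)) = 1 :> R[i] by rewrite mulr0 oppr0 expi0.
  under eq_Rintegral do rewrite e0; under [X in (_ +i* X)%C]eq_Rintegral do rewrite e0.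
  rewrite !Rintegral_cst//= lebesgue_measure_itv/= lte_fin ab/= mul1r mul0r.
  by congr (_ +i* _)%C; ring.
have ax : a * xi != 0 by rewrite mulf_neq0// gt_eqF.
rewrite /cintegral /expi /=; simpc.
under eq_Rintegral do rewrite cosN.
rewrite Rintegral_cosM//.
under eq_Rintegral do rewrite -mulrN.
rewrite Rintegral_sinM ?oppr_eq0//.
rewrite /sinc (negPf ax) cosN sinN.
rewrite !mulrN !cosN !mulrDl !mulNr.
by congr (_ +i* _)%C; rewrite ?sinB ?sinD ?cosB ?cosD; field; rewrite xi0 gt_eqF.
Qed.

End TrigonometricBounds.

Lemma measurable_Rintegral_param {R : realType} d1 d2 (T1 : measurableType d1)
    (T2 : measurableType d2) (m2 : {sigma_finite_measure set T2 -> \bar R})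
    (f : T1 * T2 -> R) : measurable_fun setT f ->
  measurable_fun setT (fun x => Rintegral m2 setT (fun y => f (x, y))).
Proof.
move=> /measurable_EFinP mf.
apply: (measurableT_comp (@fine_measurable _ _ measurableT)).
rewrite (_ : (fun x => _) = (fun x => \int[m2]_y (EFin \o f)^\+ (x, y) -
   \int[m2]_y (EFin \o f)^\- (x, y))%E).
  apply: emeasurable_funB; apply: measurable_fun_fubini_tonelli_F => //.
    exact: measurable_funepos.
  exact: measurable_funeneg.
by apply/funext => x; rewrite [LHS]integralE; congr (_ - _)%E; apply: eq_integral => y _;
  rewrite ?funeposE ?funenegE.
Qed.

Lemma cmeasurable_cintegral_param {R : realType} d1 d2 (T1 : measurableType d1)
    (T2 : measurableType d2) (m2 : {sigma_finite_measure set T2 -> \bar R})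
    (f : T1 * T2 -> R[i]) : cmeasurable f ->
  cmeasurable (fun x => cintegral m2 setT (fun y => f (x, y))).
Proof.
move=> [rf jf]; split => /=.
  exact: (measurable_Rintegral_param m2 rf).
exact: (measurable_Rintegral_param m2 jf).
Qed.

Lemma cintegral_kernel_swap_real {R : realType} d1 d2 (T1 : measurableType d1)
    (T2 : measurableType d2) (m1 : {sigma_finite_measure set T1 -> \bar R})
    (m2 : {sigma_finite_measure set T2 -> \bar R}) (A : T1 -> R[i]) (b : T2 -> R)
    (k : T1 * T2 -> R) (B : R) : cintegrable m1 A ->
  m2.-integrable setT (EFin \o b) -> measurable_fun setT k -> (forall z, `|k z| <= B) ->
  cintegral m1 setT (fun x => A x * (Rintegral m2 setT (fun y => b y * k (x, y)))%:C%C) =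
  cintegral m2 setT (fun y => (b y)%:C%C * cintegral m1 setT (fun x => A x * (k (x, y))%:C%C)).
Proof.
move=> iA ib mk kB.
have KB z : cabs ((k z)%:C%C : R[i]) <= B by rewrite cabs_real.
rewrite -(cintegral_kernel_swap iA (cintegrable_real ib) (cmeasurable_real mk) KB).
apply: eq_cintegral => x _; rewrite -cintegral_real; congr (_ * _).
by apply: eq_cintegral => y _; rewrite -rmorphM.
Qed.

Lemma cintegrable_expi {R : realType} d (T : measurableType d)
    (m : {measure set T -> \bar R}) (f : T -> R[i]) (h : T -> R) :
  cintegrable m f -> measurable_fun setT h -> cintegrable m (fun x => f x * expi (h x)).
Proof.
move=> fi mh; apply: (@cintegrableMr _ _ _ _ f (fun x => expi (h x)) 1) => //.
  exact: cmeasurable_expi.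
by move=> x; rewrite cabs_expi.
Qed.

(** * Compactly supported splines with prescribed transforms *)

Section Splines.
Context {R : realType}.
Notation mu := (@lebesgue_measure R).

(** [beta] is the transform of the spline recentred at 0: the centre [c] enters only through a
    phase. Thus [beta] stays real and is simply multiplied under convolution with centred boxes. *)
Definition spline (c w : R) (beta b : R -> R) : Prop :=
  [/\ measurable_fun setT b, exists B, forall x, 0 <= b x <= B,
      forall x, w < `|x - c| -> b x = 0 &
      forall xi, cintegral mu setT (fun x => (b x)%:C%C * expi (- (x * xi))) =
                 (beta xi)%:C%C * expi (- (c * xi))].

Lemma integrable_indic_cc (a b B : R) :
  mu.-integrable setT (EFin \o (fun x => B * \1_`[a, b]%classic x)).
Proof.
have := integrableZl measurableT B (integrable_indic_itv a b true false).
by apply: eq_integrable.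
Qed.

Lemma spline_integrable c w beta b : spline c w beta b -> mu.-integrable setT (EFin \o b).
Proof.
move=> [mb [B bB] b0 _]; apply: (le_integrable _ _ _ (integrable_indic_cc (c - w) (c + w) B)) => //.
  exact/measurable_EFinP.
move=> x _ /=; rewrite lee_fin; have /andP[b_ge0 bxB] := bB x.
have B0 : 0 <= B by exact: le_trans bxB.
have [xw|/b0 ->] := leP `|x - c| w; last by rewrite normr0.
rewrite indicE mem_set ?mulr1; first by rewrite !ger0_norm.
by rewrite /= in_itv/= -ler_distl.
Qed.

Lemma indic_cc_in (c r x : R) : `|x - c| <= r -> \1_`[c - r, c + r]%classic x = 1 :> R.
Proof. by move=> xr; rewrite indicE mem_set//= in_itv/= -ler_distl. Qed.

Lemma measurable_mulN (xi : R) : measurable_fun setT (fun x : R => - (x * xi)).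
Proof. by apply: measurableT_comp => //; exact: measurable_funM. Qed.

Definition box (a x : R) : R := (2 * a)^-1 * \1_`[- a, a]%classic x.

Lemma measurable_box a : measurable_fun setT (box a).
Proof. by apply: measurable_funM => //; exact: measurable_indic. Qed.

Lemma box_ge0 a x : 0 < a -> 0 <= box a x.
Proof. by move=> a0; rewrite mulr_ge0// invr_ge0 mulr_ge0// ltW. Qed.

Lemma box_le a x : 0 < a -> box a x <= (2 * a)^-1.
Proof.
move=> a0; rewrite ler_piMr// ?indicE ?lern1 ?leq_b1//.
by rewrite invr_ge0 mulr_ge0// ltW.
Qed.

Lemma box_out a x : a < `|x| -> box a x = 0.
Proof.
move=> ax; rewrite /box indicE memNset ?mulr0//= in_itv/= -ler_norml.
by apply/negP; rewrite -ltNge.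
Qed.

Lemma cintegral_box (a y xi : R) : 0 < a ->
  cintegral mu setT (fun x => (box a (x - y))%:C%C * expi (- (x * xi))) =
  (sinc (a * xi))%:C%C * expi (- (y * xi)).
Proof.
move=> a0; transitivity ((2 * a)^-1%:C%C *
   cintegral mu `[y - a, y + a] (fun x => expi (- (x * xi)))).
  rewrite [in RHS]cintegral_mkcond -cintegralZl; last first.
    apply: (le_cintegrable _ (integrable_indic_cc (y - a) (y + a) 1)).
      apply: cmeasurableM.
        by apply: cmeasurable_real; exact: measurable_indic.
      apply: cmeasurable_expi; exact: measurable_mulN.
    by move=> x; rewrite cabsM cabs_expi cabs_real mulr1 mul1r ger0_norm.
  apply: eq_cintegral => x _; rewrite mulrA; congr (_ * _).
  rewrite -rmorphM/=; congr (_%:C)%C; rewrite /box; congr (_ * _).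
  rewrite !indicE; congr (nat_of_bool _)%:R; apply/idP/idP => /set_mem/=; rewrite in_itv/= => H;
    by rewrite inE/= in_itv/=; lra.
rewrite cintegral_expi_itv// mulrA -rmorphM/=; congr (_%:C%C * _).
by rewrite mulrA mulVf ?mul1r// mulf_neq0// gt_eqF.
Qed.

Lemma spline_box c a : 0 < a -> spline c a (fun xi => sinc (a * xi)) (fun x => box a (x - c)).
Proof.
move=> a0; split.
- by apply: (measurableT_comp (measurable_box a)); exact: measurable_funB.
- by exists (2 * a)^-1 => x; rewrite box_ge0//= box_le.
- by move=> x; exact: box_out.
- by move=> xi; exact: cintegral_box.
Qed.

Lemma spline_convolve_box c w beta b (a : R) : 0 < a -> spline c w beta b ->
  exists b', spline c (w + a) (fun xi => sinc (a * xi) * beta xi) b'.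
Proof.
move=> a0 sb; have ib := spline_integrable sb; case: sb => mb [B bB] b0 FTb.
pose f (z : R * R) : R := b z.2 * box a (z.1 - z.2).
have mbox : measurable_fun setT (fun z : R * R => box a (z.1 - z.2)).
  by apply: (measurableT_comp (measurable_box a)); exact: measurable_funB.
have mf : measurable_fun setT f.
  by apply: measurable_funM => //; exact: (measurableT_comp mb measurable_snd).
have [b' b'E] : exists b' : R -> R,
    forall x, b' x = Rintegral mu setT (fun y => f (x, y)) by eexists.
exists b'.
have f0 z : 0 <= f z by rewrite mulr_ge0 ?box_ge0//; case/andP: (bB z.2).
have mfx x : measurable_fun setT (fun y => f (x, y)).
  exact: (measurableT_comp mf (measurable_pair1 x)).
have fle x y : f (x, y) <= (2 * a)^-1 * b y.
  by rewrite /f mulrC ler_wpM2r ?box_le//=; case/andP: (bB y).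
have ifx x : mu.-integrable setT (EFin \o (fun y => f (x, y))).
  apply: (le_integrable _ _ _ (integrableZl measurableT (2 * a)^-1 ib)) => //.
    by apply/measurable_EFinP; exact: (mfx x).
  move=> y _; rewrite lee_fin ger0_norm// (le_trans (fle x y))//; exact: ler_norm.
have fout x : w + a < `|x - c| -> forall y, f (x, y) = 0.
  move=> wx y; have [yw|/b0 by0] := leP `|y - c| w; last by rewrite /f by0 mul0r.
  rewrite /f box_out ?mulr0//=.
  have -> : x - y = (x - c) - (y - c) by ring.
  by rewrite (lt_le_trans _ (lerB_dist _ _))//; lra.
have b'0 x : w + a < `|x - c| -> b' x = 0.
  by move=> wx; rewrite b'E; under eq_Rintegral do rewrite fout//; exact: Rintegral_zero.
have bD (y : R) : b y = 0 \/ b y != 0.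
  by case: (eqVneq (b y) 0) => [->|H]; [left|right].
have dich (x : R) : `|x - c| <= w + a \/ w + a < `|x - c| by case: leP => _; [left|right].
split.
- by move/funext: (b'E) => ->; exact: (measurable_Rintegral_param mu mf).
- exists ((2 * a)^-1 * Rintegral mu setT b) => x; rewrite b'E; apply/andP; split.
    exact: Rintegral_ge0.
  rewrite -RintegralZl//; apply: le_Rintegral => //.
  by have := integrableZl measurableT (2 * a)^-1 ib; apply: eq_integrable.
- exact: b'0.
(* The exponential by itself is not integrable. Cut off to the interval that carries [b'], it
   becomes an admissible density for the exchange of integrals. *)
- move=> xi; pose A x : R[i] := (\1_`[c - (w + a), c + (w + a)]%classic x)%:C%C * expi (- (x * xi)).
  have A_in x : `|x - c| <= w + a -> A x = expi (- (x * xi)).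
    by move=> xw; rewrite /A indic_cc_in// rmorph1 mul1r.
  have iA : cintegrable mu A.
    apply: (le_cintegrable _ (integrable_indic_cc (c - (w + a)) (c + (w + a)) 1)).
      apply: cmeasurableM.
        by apply: cmeasurable_real; exact: measurable_indic.
      apply: cmeasurable_expi; exact: measurable_mulN.
    by move=> x; rewrite cabsM cabs_expi cabs_real mulr1 mul1r ger0_norm.
  have kB (z : R * R) : `|box a (z.1 - z.2)| <= (2 * a)^-1.
    by rewrite ger0_norm ?box_le// box_ge0.
  have E := cintegral_kernel_swap_real iA ib mbox kB.
  have P (x : R) : (b' x)%:C%C * expi (- (x * xi)) = A x * (b' x)%:C%C.
    case: (dich x) => xw; first by rewrite (A_in _ xw) mulrC.
    by rewrite (b'0 _ xw) mulr0 mul0r.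
  transitivity (cintegral mu setT (fun x => A x * (b' x)%:C%C)).
    by apply: eq_cintegral => x _; exact: P.
  under eq_cintegral do rewrite b'E.
  rewrite [LHS]E.
  rewrite rmorphM/= -mulrA -FTb -cintegralZl; last first.
    exact: (cintegrable_expi (cintegrable_real ib) (measurable_mulN xi)).
  (* Where [b y != 0], the box around [y] lies inside the cut-off interval, so the truncation is
     invisible. *)
  have Q (x y : R) : b y != 0 ->
      A x * (box a (x - y))%:C%C = (box a (x - y))%:C%C * expi (- (x * xi)).
    move=> by0; case: (dich x) => xw; first by rewrite (A_in _ xw) mulrC.
    have := fout _ xw y; rewrite /f /= => /eqP.
    by rewrite mulf_eq0 (negPf by0)/= => /eqP ->; rewrite mulr0 mul0r.
  have P' (y : R) : (b y)%:C%C * cintegral mu setT (fun x => A x * (box a (x - y))%:C%C) =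
      (sinc (a * xi))%:C%C * ((b y)%:C%C * expi (- (y * xi))).
    case: (bD y) => by0.
      by rewrite by0 !mul0r mulr0.
    rewrite [RHS]mulrCA -(cintegral_box _ _ a0); congr (_ * _).
    by apply: eq_cintegral => x _; exact: Q.
  by apply: eq_cintegral => y _; exact: P'.
Qed.

Lemma spline_convolve_boxes n c w beta b (a : R) : 0 < a -> spline c w beta b ->
  exists b', spline c (w + a *+ n) (fun xi => sinc (a * xi) ^+ n * beta xi) b'.
Proof.
move=> a0 sb; elim: n => [|n [b' IH]].
  by exists b; rewrite mulr0n addr0; under eq_fun do rewrite expr0 mul1r.
have [b'' Hb] := spline_convolve_box a0 IH.
exists b''; rewrite mulrSr addrA.
by under eq_fun do rewrite exprS -mulrA.
Qed.

End Splines.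

(** * Weighted integrals *)

Section CauchyIntegrals.
Context {R : realType}.
Notation mu := (@lebesgue_measure R).

Lemma integral_shift (G : R -> R) (c : R) : continuous G -> (forall x, 0 <= G x) ->
  (\int[mu]_x (G (x - c))%:E = \int[mu]_x (G x)%:E)%E.
Proof.
move=> cG G0.
have D x : is_derive x (1 : R) (fun x => x - c) 1.
  by apply: is_derive_eq; rewrite subr0.
have dE : (fun x : R => x - c)^`()%classic = cst 1.
  by apply/funext => x; rewrite derive1E; apply: derive_val.
rewrite (@increasing_ge0_integration_by_substitutionT _ (fun x => x - c) G) ?dE//.
- by apply: eq_integral => x _; rewrite /= mulr1.
- by move=> x y; rewrite ltrD2r.
- by move=> x; exact: cst_continuous.
- exact: is_cvg_cst.
- exact: is_cvg_cst.
- apply/cvgrNyPle => A; near=> x; rewrite lerBlDr.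
  by near: x; apply: nbhs_ninfty_le; rewrite num_real.
- apply/cvgryPge => A; near=> x; rewrite lerBrDr.
  by near: x; apply: nbhs_pinfty_ge; rewrite num_real.
Unshelve. all: end_near. Qed.

Lemma integral_cauchy (c : R) : (\int[mu]_x ((1 + (x - c) ^+ 2)^-1)%:E = pi%:E)%E.
Proof.
rewrite (@integral_shift (fun x => (1 + x ^+ 2)^-1)); first last.
- by move=> x; rewrite invr_ge0 addr_ge0// sqr_ge0.
- exact: continuous_oneDsqrV.
rewrite ge0_symfun_integralT//.
- rewrite -set_itvcy integral0y_oneDsqr -EFinM; congr EFin.
  by rewrite mulrC divfK.
- by move=> x; rewrite invr_ge0 addr_ge0// sqr_ge0.
- exact: continuous_oneDsqrV.
- by move=> x; rewrite /= sqrrN.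
Qed.

Lemma measurable_cauchy (c : R) : measurable_fun setT (fun x : R => (1 + (x - c) ^+ 2)^-1).
Proof.
apply: (measurableT_comp (f := fun x : R => (1 + x ^+ 2)^-1)).
  by apply: continuous_measurable_fun; exact: continuous_oneDsqrV.
exact: measurable_funB.
Qed.

Lemma integrable_cauchy (c : R) :
  mu.-integrable setT (EFin \o (fun x : R => (1 + (x - c) ^+ 2)^-1)).
Proof.
apply/integrableP; split; first by apply/measurable_EFinP; exact: measurable_cauchy.
have E (x : R) : `|((1 + (x - c) ^+ 2)^-1)%:E|%E = ((1 + (x - c) ^+ 2)^-1)%:E.
  by rewrite /= ger0_norm// invr_ge0 addr_ge0// sqr_ge0.
by under eq_integral do rewrite E; rewrite integral_cauchy ltry.
Qed.

Lemma integral_cauchy_plane (c d : R) :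
  (\int[mu \x mu]_z ((1 + (z.1 - c) ^+ 2)^-1 * (1 + (z.2 - d) ^+ 2)^-1)%:E = (pi ^+ 2)%:E)%E.
Proof.
have c0 (x e : R) : 0 <= (1 + (x - e) ^+ 2)^-1 by rewrite invr_ge0 addr_ge0// sqr_ge0.
rewrite fubini_tonelli1/=; last 2 first.
- apply/measurable_EFinP; apply: measurable_funM.
    exact: (measurableT_comp (measurable_cauchy c) measurable_fst).
  exact: (measurableT_comp (measurable_cauchy d) measurable_snd).
- by move=> z; rewrite lee_fin mulr_ge0.
rewrite /fubini_F/=.
have E (x : R) : (\int[mu]_y ((1 + (x - c) ^+ 2)^-1 * (1 + (y - d) ^+ 2)^-1)%:E =
   (pi * (1 + (x - c) ^+ 2)^-1)%:E)%E.
  under eq_integral do rewrite EFinM.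
  rewrite ge0_integralZl_EFin//.
  - by rewrite integral_cauchy -EFinM mulrC.
  - by move=> y _; rewrite lee_fin.
  - by apply/measurable_EFinP; exact: measurable_cauchy.
under eq_integral do rewrite E EFinM.
rewrite ge0_integralZl_EFin ?pi_ge0//.
- by rewrite integral_cauchy -EFinM expr2.
- by move=> y _; rewrite lee_fin.
- by apply/measurable_EFinP; exact: measurable_cauchy.
Qed.

(** The sum over i < n is at most the telescoping quantity 4 (1 - 1 / (n + 1)). Its increment 4 /
    ((n + 1) (n + 2)) dominates 1 / (1 + n^2) because 3 n^2 - 3 n + 2 has negative discriminant. *)
Lemma esum_cauchy_nat (a : nat -> \bar R) :
  (forall i, 0 <= a i <= ((1 + i%:R ^+ 2)^-1)%:E)%E -> (\esum_(i in [set: nat]) a i <= 4%:E)%E.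
Proof.
move=> aP; have a0 i : (0 <= a i)%E by case/andP: (aP i).
rewrite -nneseries_esumT//.
apply: lime_le; first exact: is_cvg_nneseries.
apply: nearW => n; rewrite (@le_trans _ _ (4 * (1 - n.+1%:R^-1))%:E)//; last first.
  by rewrite lee_fin ger_pMr// gerBl invr_ge0.
elim: n => [|n IH]; first by rewrite big_geq// invr1 subrr mulr0.
rewrite big_nat_recr//= (le_trans (leeD IH (andP (aP n)).2))//.
rewrite -EFinD lee_fin.
have n0 : (0 : R) <= n%:R by [].
rewrite -(natr1 n.+1) -(natr1 n); move: (n%:R : R) n0 => x x0.
have -> : 4 * (1 - (x + 1 + 1)^-1) =
  4 * (1 - (x + 1)^-1) + (1 + x ^+ 2)^-1 + (3 * x ^+ 2 - 3 * x + 2) / ((x + 1) * (x + 1 + 1) * (1 + x ^+ 2)).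
  field; rewrite !gt_eqF//; try lra.
  by rewrite ltr_pwDl// sqr_ge0.
rewrite lerDl divr_ge0//; first by nra.
by rewrite !mulr_ge0//; [lra|lra|rewrite addr_ge0// sqr_ge0].
Qed.

(** Each half of the integers contributes at most 4; [Negz i] is -(i + 1), whose square exceeds i^2,
    so the bound over the naturals applies to it as well. *)
Lemma esum_cauchy_int (a : int -> \bar R) :
  (forall k, 0 <= a k <= ((1 + k%:~R ^+ 2)^-1)%:E)%E -> (\esum_(k in [set: int]) a k <= 8%:E)%E.
Proof.
move=> aP; have a0 i : (0 <= a i)%E by case/andP: (aP i).
rewrite (esumID (range Posz))// !setTI.
have -> : ~` range Posz = range Negz.
  apply/seteqP; split=> [[n|n]|_ [n _ <-]] /=.
  - by case; exists n.
  - by move=> _; exists n.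
  - by case.
rewrite (_ : 8%:E = 4%:E + 4%:E)%E; last by rewrite -EFinD; congr EFin; lra.
rewrite (reindex_esum setT (range Posz) Posz); last first.
  by split=> [x _|x y _ _ []|x]//; exists x.
rewrite (reindex_esum setT (range Negz) Negz); last first.
  by split=> [x _|x y _ _ []|x]//; exists x.
apply: leeD; apply: esum_cauchy_nat => i; rewrite a0/=.
  exact: (andP (aP (Posz i))).2.
rewrite (le_trans (andP (aP (Negz i))).2)// lee_fin NegzE mulrNz sqrrN lef_pV2 ?posrE.
- by rewrite lerD2l lerXn2r ?nnegrE ?ler_nat.
- by rewrite ltr_pwDl// sqr_ge0.
- by rewrite ltr_pwDl// sqr_ge0.
Qed.

End CauchyIntegrals.

Section Peetre.
Context {R : realType}.

(** Comparability in both directions covers both signs of [s]: for negative [s] the roles of [A] and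
    [B] are exchanged and the result is inverted. *)
Lemma ler_powR_ratio (A B E s : R) (S : nat) : 0 < A -> 0 < B -> 1 <= E ->
  A <= E * B -> B <= E * A -> `|s| <= S%:R -> A `^ s <= E ^+ S * B `^ s.
Proof.
move=> A0 B0 E1 AB BA sS; have E0 : 0 < E by exact: lt_le_trans E1.
have pos (X Y u : R) : 0 < X -> 0 < Y -> X <= E * Y -> 0 <= u -> u <= S%:R ->
    X `^ u <= E ^+ S * Y `^ u.
  move=> X0 Y0 XY u0 uS; rewrite (@le_trans _ _ ((E * Y) `^ u))//.
    by apply: ge0_ler_powR => //; rewrite nnegrE ?mulr_ge0// ltW.
  rewrite powRM; [|exact: ltW|exact: ltW].
  apply: ler_wpM2r; first exact: powR_ge0.
  by rewrite -powR_mulrn; [exact: ler_powR|exact: ltW].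
have [s0|s0] := leP 0 s; first by apply: pos => //; rewrite (le_trans (ler_norm _) sS).
have sS' : - s <= S%:R by rewrite (le_trans _ sS)// -normrN ler_norm.
have := pos B A (- s) B0 A0 BA; rewrite oppr_ge0 (ltW s0) => /(_ erefl sS').
rewrite !powRN => H; have a0 : 0 < A `^ s by exact: powR_gt0.
have b0 : 0 < B `^ s by exact: powR_gt0.
by move: H; rewrite ler_pdivlMr// mulrC ler_pdivrMr.
Qed.

(** Peetre's inequality, which moves a Sobolev weight to the centre of a packet. The weight of the
    offset is split into one-variable factors so that a tensor-product transform can absorb it
    coordinate by coordinate. *)
Lemma peetre (s : R) (S : nat) (x1 x2 c1 c2 : R) : `|s| <= S%:R ->
  (1 + x1 ^+ 2 + x2 ^+ 2) `^ s <=
  (2 * ((1 + (x1 - c1) ^+ 2) * (1 + (x2 - c2) ^+ 2))) ^+ S * (1 + c1 ^+ 2 + c2 ^+ 2) `^ s.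
Proof.
move=> sS; have sqD (u v : R) : (u + v) ^+ 2 <= 2 * u ^+ 2 + 2 * v ^+ 2.
  by rewrite -subr_ge0 (_ : _ - _ = (u - v) ^+ 2) ?sqr_ge0//; ring.
have gen (u1 u2 v1 v2 : R) : 1 + (u1 + v1) ^+ 2 + (u2 + v2) ^+ 2 <=
    2 * ((1 + v1 ^+ 2) * (1 + v2 ^+ 2)) * (1 + u1 ^+ 2 + u2 ^+ 2).
  have := sqD u1 v1; have := sqD u2 v2.
  move: ((u1 + v1) ^+ 2) ((u2 + v2) ^+ 2) => p q.
  have := sqr_ge0 u1; have := sqr_ge0 u2; have := sqr_ge0 v1; have := sqr_ge0 v2.
  move: (u1 ^+ 2) (u2 ^+ 2) (v1 ^+ 2) (v2 ^+ 2) => a b c d.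
  move=> d0 c0 b0 a0 qb pa.
  have -> : 2 * ((1 + c) * (1 + d)) * (1 + a + b) =
      2 + 2 * a + 2 * b + 2 * c + 2 * d + 2 * (c * d + (c + d + c * d) * (a + b)) by ring.
  have : 0 <= c * d + (c + d + c * d) * (a + b) by rewrite !(addr_ge0, mulr_ge0).
  by move=> ?; lra.
have pos (u v : R) : 0 < 1 + u ^+ 2 + v ^+ 2.
  by rewrite -addrA ltr_pwDl// addr_ge0// sqr_ge0.
apply: ler_powR_ratio => //.
- have := sqr_ge0 (x1 - c1); have := sqr_ge0 (x2 - c2).
  by move: ((x1 - c1) ^+ 2) ((x2 - c2) ^+ 2) => *; nra.
- by have := gen c1 c2 (x1 - c1) (x2 - c2); rewrite !subrKC.
- have := gen x1 x2 (c1 - x1) (c2 - x2); rewrite !subrKC.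
  by rewrite -(sqrrN (x1 - c1)) -(sqrrN (x2 - c2)) !opprB.
Qed.

End Peetre.

(** * The transform of the splines: decay, smallness, lower bound *)

Section Multiplier.
Context {R : realType}.
Implicit Types (a y E : R) (P n : nat).

(* The first factor gives polynomial decay with constants independent of [n]; the
   second one, of fixed half-width [2 * a], gives smallness of order
   [expR (- 2 n)] at frequencies of order [n]. *)
Definition multiplier a P n y : R :=
  sinc (a * y) ^+ (2 * P) * sinc (a / n%:R * y) ^+ (2 * n).

(** The half-widths add up to 2 P a from the fixed boxes and 2 n (a / n) = 2 a from the narrow ones,
    so the support does not grow with [n]. *)
Lemma exists_multiplier_spline c a P n : 0 < a -> (0 < P)%N -> (0 < n)%N ->
  exists b, spline c (a *+ (2 * P + 2)) (multiplier a P n) b.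
Proof.
move=> a0 P0 n0; have n0' : (0 : R) < n%:R by rewrite ltr0n.
have an0 : 0 < a / n%:R by rewrite divr_gt0.
have [b1 H1] := spline_convolve_boxes (2 * P).-1 a0 (spline_box c a0).
have [b2 H2] := spline_convolve_boxes (2 * n) an0 H1.
exists b2; move: H2; congr spline.
  have -> : a / n%:R *+ (2 * n) = a *+ 2.
    by rewrite -mulr_natr natrM -[RHS]mulr_natr; field; rewrite gt_eqF.
  by rewrite -mulrS prednK ?muln_gt0// -mulrnDr.
apply/funext => y; rewrite /multiplier mulrC; congr (_ * _).
by rewrite -exprSr prednK// muln_gt0.
Qed.

Lemma sincX_ge0 P y : 0 <= sinc y ^+ (2 * P).
Proof. by rewrite exprM exprn_ge0// sqr_ge0. Qed.

(** The boxes are taken in even numbers for this: the transform is its own modulus, and its pairing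
    with a positive function has no cancellation. *)
Lemma multiplier_ge0 a P n y : 0 <= multiplier a P n y.
Proof. by rewrite mulr_ge0 ?sincX_ge0. Qed.

Lemma sqr_sinc_le1 y : sinc y ^+ 2 <= 1.
Proof. by rewrite -real_normK ?num_real// exprn_ile1// norm_sinc_le1. Qed.

Lemma sqr_sinc_decay y : y ^+ 2 * sinc y ^+ 2 <= 1.
Proof.
by rewrite -exprMn mul_sinc -real_normK ?num_real// exprn_ile1// sin_max.
Qed.

Lemma sincX_le1 P y : sinc y ^+ (2 * P) <= 1.
Proof. by rewrite exprM exprn_ile1 ?sqr_ge0 ?sqr_sinc_le1. Qed.

Lemma multiplier_le1 a P n y : multiplier a P n y <= 1.
Proof. by rewrite mulr_ile1 ?sincX_ge0 ?sincX_le1. Qed.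

Lemma multiplier0 a P n : multiplier a P n 0 = 1.
Proof. by rewrite /multiplier !mulr0 /sinc eqxx !expr1n mulr1. Qed.

Lemma measurable_multiplier a P n : measurable_fun setT (multiplier a P n).
Proof.
by apply: measurable_funM; apply: measurable_funX;
  apply: (measurableT_comp measurable_sinc); exact: measurable_funM.
Qed.

(** Only the fixed boxes are used, through sinc^2 (a y) <= 1 and (a y)^2 sinc^2 (a y) <= 1, hence a
    constant free of [n]; the narrow factor is bounded by 1. *)
Lemma multiplier_decay a P n y : 0 < a ->
  multiplier a P n y * (1 + y ^+ 2) ^+ P <= (1 + a ^- 2) ^+ P.
Proof.
move=> a0; rewrite /multiplier mulrAC [_ ^+ (2 * P)]exprM -exprMn.
have s0 := sqr_ge0 (sinc (a * y)); have y0 := sqr_ge0 y.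
rewrite (@le_trans _ _ ((sinc (a * y) ^+ 2 * (1 + y ^+ 2)) ^+ P))//.
  by rewrite ler_piMr ?sincX_le1// exprn_ge0// mulr_ge0// addr_ge0.
apply: lerXn2r; rewrite ?nnegrE.
- by rewrite mulr_ge0// addr_ge0.
- by rewrite addr_ge0// invr_ge0 sqr_ge0.
rewrite mulrDr mulr1; apply: lerD; first exact: sqr_sinc_le1.
rewrite -(ler_pM2l (exprn_gt0 2 a0)) mulfV ?expf_neq0 ?gt_eqF//.
by rewrite [_ * y ^+ 2]mulrC mulrA -exprMn sqr_sinc_decay.
Qed.

(** The last hypothesis says a E / n >= e, so each of the [n] squared narrow factors is at most
    e^(-2). The fixed factors keep a power of [a * E], needed later to absorb a weight in the radial
    frequency. *)
Lemma multiplier_small a P n y E : 0 < a -> (0 < n)%N -> 0 < E -> E <= `|y| ->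
  expR 1 * n%:R <= a * E ->
  multiplier a P n y <= (a * E) ^- (2 * P) * expR (- n%:R) ^+ 2.
Proof.
move=> a0 n0 E0 Ey nE; have n0' : (0 : R) < n%:R by rewrite ltr0n.
have aux (c : R) : 0 < c -> sinc (c * y) ^+ 2 <= (c * E) ^- 2.
  move=> c0; have cE : 0 < c * E by rewrite mulr_gt0.
  rewrite -(ler_pM2l (exprn_gt0 2 cE)) mulfV ?expf_neq0 ?gt_eqF//.
  rewrite (le_trans _ (sqr_sinc_decay (c * y)))// ler_wpM2r ?sqr_ge0//.
  rewrite -[leRHS]real_normK ?num_real// lerXn2r ?nnegrE ?(ltW cE)//.
  by rewrite normrM (gtr0_norm c0) ler_pM2l.
have auxX (c B : R) k : 0 < c -> (c * E) ^- 2 <= B -> sinc (c * y) ^+ (2 * k) <= B ^+ k.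
  move=> c0 cB; rewrite exprM; apply: lerXn2r; rewrite ?nnegrE ?sqr_ge0//.
    by rewrite (le_trans _ cB)// invr_ge0 sqr_ge0.
  by rewrite (le_trans (aux _ c0)).
rewrite /multiplier; apply: ler_pM; rewrite ?sincX_ge0//.
  by rewrite (le_trans (auxX _ _ _ a0 (lexx _)))// exprVn -exprM.
have -> : expR (- n%:R) ^+ 2 = (expR 1 ^- 2) ^+ n :> R.
  by rewrite -mulrN1 expRM_natl expRN exprVn exprAC -!exprVn -exprM mulnC exprM.
apply: auxX; first exact: divr_gt0.
rewrite lef_pV2 ?posrE ?exprn_gt0 ?expR_gt0 ?mulr_gt0 ?invr_gt0//.
apply: lerXn2r; rewrite ?nnegrE ?expR_ge0//.
  by rewrite ltW// mulr_gt0// divr_gt0.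
by rewrite mulrAC ler_pdivlMr.
Qed.

Lemma bernoulli_sub (x : R) (k : nat) : 0 <= x <= 1 -> 1 - k%:R * x <= (1 - x) ^+ k.
Proof.
move=> /andP[x0 x1]; elim: k => [|k IH]; first by rewrite mul0r subr0 expr0.
rewrite exprS (@le_trans _ _ ((1 - x) * (1 - k%:R * x)))//.
  rewrite -natr1; have : 0 <= (k%:R : R) by [].
  by move: (k%:R : R) => t t0; nra.
by rewrite ler_wpM2l// subr_ge0.
Qed.

(** Each fixed factor is at least 7/8 = 1 - (1/2)^2 / 2. For the narrow ones, with z = a y / n and n
    z <= 1/2, Bernoulli gives (1 - z^2 / 2)^(2n) >= 1 - n z^2 >= 1/2, so the growing number of
    factors costs nothing. *)
Lemma multiplier_lower a P n y : 0 < a <= 2^-1 -> (0 < n)%N -> 0 <= y <= 1 ->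
  (7 / 8) ^+ (2 * P) / 2 <= multiplier a P n y.
Proof.
move=> /andP[a0 a1] n0 /andP[y0 y1]; have n1 : (1 : R) <= n%:R by rewrite ler1n.
have ay0 : 0 <= a * y by rewrite mulr_ge0// ltW.
have ay1 : a * y <= 2^-1 by rewrite (le_trans _ a1)// ler_piMr// ltW.
apply: ler_pM; rewrite ?exprn_ge0 ?invr_ge0 ?divr_ge0//.
  have H : 7 / 8 <= sinc (a * y) by rewrite (le_trans _ (sinc_ge ay0))//; nra.
  by apply: lerXn2r; rewrite ?nnegrE ?divr_ge0// (le_trans _ H)// divr_ge0.
have n0' : (0 : R) < n%:R by rewrite ltr0n.
set z := a / n%:R * y; have z0 : 0 <= z by rewrite !mulr_ge0 ?invr_ge0// ltW.
have nz : n%:R * z <= 2^-1 by rewrite /z mulrA mulrCA divff ?gt_eqF ?mulr1.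
have z1 : z <= 2^-1 by rewrite (le_trans _ nz)// ler_peMl.
have H : 1 - z ^+ 2 / 2 <= sinc z by exact: sinc_ge.
rewrite (@le_trans _ _ ((1 - z ^+ 2 / 2) ^+ (2 * n)))//.
  rewrite (le_trans _ (bernoulli_sub _ _))//; last by apply/andP; split; nra.
  by rewrite natrM; nra.
by apply: lerXn2r => //; rewrite nnegrE ?(le_trans _ H)//; nra.
Qed.

End Multiplier.

(** * Gaussian test functions *)

Section GaussianSchwartz.
Context {R : realType}.
Variables (c w : R).

(** Polynomials times a Gaussian modulated at frequency [w], presented as a class closed under
    differentiation, so that smoothness and decay follow by induction on membership. *)
Inductive gauss_class : (R -> R) -> Prop :=
| gauss_cos : gauss_class (fun x => expR (- (x - c) ^+ 2) * cos (w * (x - c)))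
| gauss_sin : gauss_class (fun x => expR (- (x - c) ^+ 2) * sin (w * (x - c)))
| gauss_mulX f : gauss_class f -> gauss_class (fun x => x * f x)
| gauss_scale k f : gauss_class f -> gauss_class (fun x => k * f x)
| gauss_add f g : gauss_class f -> gauss_class g -> gauss_class (fun x => f x + g x).

Lemma gauss_class_derive f : gauss_class f ->
  exists2 df, gauss_class df & forall x : R, is_derive x (1 : R) f (df x).
Proof.
have C := gauss_cos; have S := gauss_sin.
elim=> [||g Hg' [dg Hg Dg]|k g _ [dg Hg Dg]|g1 g2 _ [d1 H1 D1] _ [d2 H2 D2]].
- have H := gauss_add (gauss_add (gauss_scale (- 2) (gauss_mulX C)) (gauss_scale (2 * c) C))
              (gauss_scale (- w) S).
  eexists; first exact: H.
  by move=> x; apply: is_derive_eq; rewrite /GRing.scale/=; ring.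
- have H := gauss_add (gauss_add (gauss_scale (- 2) (gauss_mulX S)) (gauss_scale (2 * c) S))
              (gauss_scale w C).
  eexists; first exact: H.
  by move=> x; apply: is_derive_eq; rewrite /GRing.scale/=; ring.
- exists (fun x => g x + x * dg x); first by apply: gauss_add => //; exact: gauss_mulX.
  by move=> x; have := Dg x => ?; apply: is_derive_eq; rewrite /GRing.scale/= mulr1; ring.
- exists (fun x => k * dg x); first exact: gauss_scale.
  by move=> x; have := Dg x => ?; apply: is_derive_eq; rewrite /GRing.scale/=; ring.
- exists (fun x => d1 x + d2 x); first exact: gauss_add.
  by move=> x; have := D1 x => ?; have := D2 x => ?; apply: is_derive_eq.
Qed.

(** From 1 + |x| <= (1 + |c|) e^|x - c| it remains to bound N t - t^2 by N^2 with t = |x - c|. *)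
Lemma gauss_decay (N : nat) (x : R) :
  (1 + `|x|) ^+ N * expR (- (x - c) ^+ 2) <= (1 + `|c|) ^+ N * expR (N%:R ^+ 2).
Proof.
have H : 1 + `|x| <= (1 + `|c|) * expR `|x - c|.
  rewrite (@le_trans _ _ ((1 + `|c|) * (1 + `|x - c|)))//; last first.
    by rewrite ler_wpM2l ?expR_ge1Dx// addr_ge0.
  have : `|x| <= `|c| + `|x - c| by rewrite -{1}(subrKC c x) ler_normD.
  have := normr_ge0 c; have := normr_ge0 (x - c).
  by move: `|x| `|c| `|x - c| => *; nra.
rewrite (@le_trans _ _ (((1 + `|c|) * expR `|x - c|) ^+ N * expR (- (x - c) ^+ 2)))//.
  by rewrite ler_wpM2r ?expR_ge0// lerXn2r ?nnegrE ?mulr_ge0 ?expR_ge0 ?addr_ge0.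
rewrite exprMn -mulrA ler_wpM2l ?exprn_ge0 ?addr_ge0//.
rewrite -expRM_natl -expRD ler_expR.
rewrite -(real_normK (num_real (x - c))).
by move: `|x - c| (N%:R : R) => t u; have := sqr_ge0 (t - u); have := sqr_ge0 t; have := sqr_ge0 u; nra.
Qed.

Lemma gauss_class_bounded f : gauss_class f ->
  forall N, exists B, forall x, (1 + `|x|) ^+ N * `|f x| <= B.
Proof.
elim=> [||g _ IH|k g _ IH|g1 g2 _ IH1 _ IH2] N.
- exists ((1 + `|c|) ^+ N * expR (N%:R ^+ 2)) => x; rewrite normrM (ger0_norm (expR_ge0 _)) mulrA.
  by rewrite (le_trans _ (gauss_decay N x))// ler_piMr ?cos_max//.
- exists ((1 + `|c|) ^+ N * expR (N%:R ^+ 2)) => x; rewrite normrM (ger0_norm (expR_ge0 _)) mulrA.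
  by rewrite (le_trans _ (gauss_decay N x))// ler_piMr ?sin_max//.
- have [B HB] := IH N.+1; exists B => x.
  rewrite (le_trans _ (HB x))// normrM mulrA ler_wpM2r// exprS mulrC.
  by rewrite ler_wpM2r ?lerDr// exprn_ge0// addr_ge0.
- have [B HB] := IH N; exists (`|k| * B) => x.
  by rewrite normrM mulrCA ler_wpM2l.
- have [B1 HB1] := IH1 N; have [B2 HB2] := IH2 N; exists (B1 + B2) => x.
  rewrite (le_trans _ (lerD (HB1 x) (HB2 x)))// -mulrDr ler_wpM2l ?ler_normD//.
Qed.

End GaussianSchwartz.

Section PlanarGaussianSchwartz.
Context {R : realType}.
Variables (c1 c2 w1 w2 : R).

Inductive gauss_class2 : (R * R -> R) -> Prop :=
| gauss_tensor f g : gauss_class c1 w1 f -> gauss_class c2 w2 g ->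
    gauss_class2 (fun p => f p.1 * g p.2)
| gauss_add2 f g : gauss_class2 f -> gauss_class2 g -> gauss_class2 (fun p => f p + g p).

(** Along an axis the difference quotient is a one-variable quotient times a constant. Working from
    the definition asks nothing of [g]. *)
Lemma is_derive_fst (f g : R -> R) df (p : R * R) : is_derive p.1 1 f df ->
  is_derive p (1, 0) (fun q => f q.1 * g q.2) (df * g p.2).
Proof.
move=> fd.
have E : (fun h : R => h^-1 *: (((fun q : R * R => f q.1 * g q.2) \o shift p) (h *: (1, 0)) - f p.1 * g p.2))
   = (fun h => (h^-1 *: ((f \o shift p.1) (h *: 1) - f p.1)) * g p.2).
  apply/funext => h; rewrite /= /shift/= /GRing.scale/= mulr0 add0r.
  by ring.
have C : (fun h : R => h^-1 *: (((fun q : R * R => f q.1 * g q.2) \o shift p) (h *: (1, 0)) - f p.1 * g p.2))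
    @ (0 : R)^' --> df * g p.2.
  rewrite E; apply: cvgM; last exact: cvg_cst.
  have [fdv <-] := fd; exact: fdv.
by split; [apply/cvg_ex; exists (df * g p.2)|exact/cvg_lim].
Qed.

Lemma is_derive_snd (f g : R -> R) dg (p : R * R) : is_derive p.2 1 g dg ->
  is_derive p (0, 1) (fun q => f q.1 * g q.2) (f p.1 * dg).
Proof.
move=> gd.
have E : (fun h : R => h^-1 *: (((fun q : R * R => f q.1 * g q.2) \o shift p) (h *: (0, 1)) - f p.1 * g p.2))
   = (fun h => f p.1 * (h^-1 *: ((g \o shift p.2) (h *: 1) - g p.2))).
  apply/funext => h; rewrite /= /shift/= /GRing.scale/= mulr0 add0r.
  by ring.
have C : (fun h : R => h^-1 *: (((fun q : R * R => f q.1 * g q.2) \o shift p) (h *: (0, 1)) - f p.1 * g p.2))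
    @ (0 : R)^' --> f p.1 * dg.
  rewrite E; apply: cvgM; first exact: cvg_cst.
  have [gdv <-] := gd; exact: gdv.
by split; [apply/cvg_ex; exists (f p.1 * dg)|exact/cvg_lim].
Qed.

Lemma gauss_class2_derive f (b : bool) : gauss_class2 f ->
  exists2 df, gauss_class2 df & forall p, is_derive p (axis b) f (df p).
Proof.
elim=> [g1 g2 H1 H2|g1 g2 _ [d1 H1 D1] _ [d2 H2 D2]].
  case: b.
    have [d2 Hd2 D2] := gauss_class_derive H2.
    exists (fun p => g1 p.1 * d2 p.2); first exact: gauss_tensor.
    by move=> p; exact: is_derive_snd.
  have [d1 Hd1 D1] := gauss_class_derive H1.
  exists (fun p => d1 p.1 * g2 p.2); first exact: gauss_tensor.
  by move=> p; exact: is_derive_fst.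
exists (fun p => d1 p + d2 p); first exact: gauss_add2.
by move=> p; have := D1 p => ?; have := D2 p => ?; apply: is_derive_eq.
Qed.

Lemma continuous_tensor (f g : R -> R) : continuous f -> continuous g ->
  continuous (fun p : R * R => f p.1 * g p.2).
Proof.
move=> cf cg p; apply: continuousM.
  by apply: continuous_comp; [exact: cvg_fst|exact: cf].
by apply: continuous_comp; [exact: cvg_snd|exact: cg].
Qed.

Lemma gauss_class_continuous c w f : gauss_class c w f -> continuous (f : R -> R).
Proof. by move=> /gauss_class_derive[df _ D]; exact: is_derive_continuous D. Qed.

Lemma gauss_class2_continuous f : gauss_class2 f -> continuous f.
Proof.
elim=> [g1 g2 /gauss_class_continuous H1 /gauss_class_continuous H2|g1 g2 _ C1 _ C2].
  exact: continuous_tensor.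
by move=> p; apply: continuousD; [exact: C1|exact: C2].
Qed.

Lemma gauss_class2_bounded f : gauss_class2 f -> forall N, exists B, forall p,
  (1 + `|p|) ^+ N * `|f p| <= B.
Proof.
elim=> [g1 g2 H1 H2|g1 g2 _ IH1 _ IH2] N.
  have [B1 HB1] := gauss_class_bounded H1 N; have [B2 HB2] := gauss_class_bounded H2 N.
  exists (B1 * B2) => p; rewrite normrM.
  rewrite (@le_trans _ _ (((1 + `|p.1|) ^+ N * `|g1 p.1|) * ((1 + `|p.2|) ^+ N * `|g2 p.2|)))//.
    rewrite mulrACA -exprMn ler_wpM2r ?mulr_ge0//.
    rewrite lerXn2r ?nnegrE ?mulr_ge0 ?addr_ge0//.
    rewrite prod_normE/=; have := normr_ge0 p.1; have := normr_ge0 p.2.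
    rewrite /Num.max; case: ifPn => _; move: `|p.1| `|p.2| => *; nra.
  by rewrite ler_pM// mulr_ge0// exprn_ge0// addr_ge0.
have [B1 HB1] := IH1 N; have [B2 HB2] := IH2 N; exists (B1 + B2) => x.
rewrite (le_trans _ (lerD (HB1 x) (HB2 x)))// -mulrDr ler_wpM2l ?ler_normD//.
Qed.

Definition gauss_complex (h : R * R -> R[i]) : Prop :=
  gauss_class2 (fun p => complex.Re (h p)) /\ gauss_class2 (fun p => complex.Im (h p)).

Lemma gauss_complex_cpartial b h : gauss_complex h -> gauss_complex (cpartial b h).
Proof.
move=> [/(gauss_class2_derive b)[dr Hr Dr] /(gauss_class2_derive b)[di Hi Di]]; split.
  rewrite (_ : (fun p => _) = dr)//; apply/funext => p /=.
  by have := Dr p => ?; exact: derive_val.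
rewrite (_ : (fun p => _) = di)//; apply/funext => p /=.
by have := Di p => ?; exact: derive_val.
Qed.

Lemma gauss_complex_cpartials a h : gauss_complex h -> gauss_complex (cpartials a h).
Proof. by move=> Hh; elim: a => //= b a; exact: gauss_complex_cpartial. Qed.

Lemma gauss_complex_schwartz h : gauss_complex h -> schwartz h.
Proof.
move=> Hh; split=> [a|N].
  have [Hr Hi] := gauss_complex_cpartials a Hh; split.
  - exact: gauss_class2_continuous Hr.
  - exact: gauss_class2_continuous Hi.
  - move=> b p; have [dr _ Dr] := gauss_class2_derive b Hr.
    by have [di _ Di] := gauss_class2_derive b Hi; split; [exact: (@ex_derive _ _ _ _ _ _ _ (Dr p))|exact: (@ex_derive _ _ _ _ _ _ _ (Di p))].
suff H n : forall h, gauss_complex h -> exists B, forall a p, (size a <= n)%N ->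
    (1 + `|p|) ^+ N * cabs (cpartials a h p) <= B.
  exact: H.
elim: n => {h Hh} [|n IH] h Hh.
  have [[B1 HB1] [B2 HB2]] := (gauss_class2_bounded Hh.1 N, gauss_class2_bounded Hh.2 N).
  exists (B1 + B2) => -[|//] p _ /=.
  rewrite (le_trans _ (lerD (HB1 p) (HB2 p)))// -mulrDr ler_wpM2l ?cabs_le_ReIm//.
have [B0 H0] := IH _ Hh.
have [B1 H1] := IH _ (gauss_complex_cpartial true Hh).
have [B2 H2] := IH _ (gauss_complex_cpartial false Hh).
have pos B a h' p : (1 + `|p|) ^+ N * cabs (cpartials a h' p : R[i]) <= B -> 0 <= B.
  by apply: le_trans; rewrite mulr_ge0 ?cabs_ge0// exprn_ge0// addr_ge0.
have B00 : 0 <= B0 by apply: (pos _ [::] h (0, 0)); exact: H0.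
have B10 : 0 <= B1 by apply: (pos _ [::] _ (0, 0)); exact: H1.
have B20 : 0 <= B2 by apply: (pos _ [::] _ (0, 0)); exact: H2.
(* The innermost derivative is the one peeled off: it replaces [h] by another member of the class,
   to which the induction hypothesis applies. *)
exists (B0 + B1 + B2) => a p; case/lastP: a => [_|a b].
  by rewrite (le_trans (H0 [::] p _))//; lra.
rewrite size_rcons ltnS => an; rewrite /cpartials foldr_rcons.
case: b.
  by rewrite (le_trans (H1 a p an))//; lra.
by rewrite (le_trans (H2 a p an))//; lra.
Qed.

End PlanarGaussianSchwartz.

(** * Angular cutoffs *)

Section PeriodicSmoothness.
Context {R : realType}.
Implicit Types (q p : R -> R) (M : R).

(** Periodic functions of class C^j with one common bound [M] on all derivatives up to order [j].
    Carrying the bound explicitly is what later yields estimates uniform in both frequencies. *)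
Fixpoint periodicC (j : nat) (M : R) (q : R -> R) : Prop :=
  [/\ continuous q, forall x, q (x + 2 * pi) = q x & forall x, `|q x| <= M] /\
  match j with
  | 0%N => True
  | j'.+1 => exists2 dq, periodicC j' M dq & forall x : R, is_derive x (1 : R) q (dq x)
  end.

Lemma periodicC_base j M q : periodicC j M q ->
  [/\ continuous q, forall x, q (x + 2 * pi) = q x & forall x, `|q x| <= M].
Proof. by case: j => [[]|j []]. Qed.

Lemma periodicC_ge0 j M q : periodicC j M q -> 0 <= M.
Proof. by move=> /periodicC_base[_ _ /(_ 0)]; apply: le_trans. Qed.

Lemma periodicC_le j M M' q : M <= M' -> periodicC j M q -> periodicC j M' q.
Proof.
move=> MM; elim: j q => [|j IH] q [[cq pq qM] H]; split => //.
- by split=> // x; exact: le_trans (qM x) MM.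
- by split=> // x; exact: le_trans (qM x) MM.
- by case: H => dq /IH ? ?; exists dq.
Qed.

Lemma periodicC_weaken j M q : periodicC j.+1 M q -> periodicC j M q.
Proof.
elim: j q => [|j IH] q [H1 [dq H2 H3]]; split => //.
by exists dq => //; exact: IH.
Qed.

Lemma periodicC_add j M M' q p : periodicC j M q -> periodicC j M' p ->
  periodicC j (M + M') (fun x => q x + p x).
Proof.
elim: j q p => [|j IH] q p [[cq pq qM] H] [[cp pp pM] H'].
  split=> //; split=> [x|x|x]; [by apply: continuousD; [exact: cq|exact: cp]|by rewrite pq pp|].
  by rewrite (le_trans (ler_normD _ _))// lerD.
split.
  split=> [x|x|x]; [by apply: continuousD; [exact: cq|exact: cp]|by rewrite pq pp|].
  by rewrite (le_trans (ler_normD _ _))// lerD.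
case: H H' => dq Hq Dq [dp Hp Dp]; exists (fun x => dq x + dp x); first exact: IH.
by move=> x; have := Dq x => ?; have := Dp x => ?; apply: is_derive_eq.
Qed.

(** Each application of Leibniz' rule doubles the number of terms, whence the factor 2^j. *)
Lemma periodicC_mul j M M' q p : periodicC j M q -> periodicC j M' p ->
  periodicC j (2 ^+ j * (M * M')) (fun x => q x * p x).
Proof.
elim: j q p => [|j IH] q p Hq0 Hp0.
  have [[cq pq qM] _] := Hq0; have [[cp pp pM] _] := Hp0.
  split=> //; split=> [x|x|x]; [by apply: continuousM; [exact: cq|exact: cp]|by rewrite pq pp|].
  by rewrite expr0 mul1r normrM ler_pM.
have M0 := periodicC_ge0 Hq0; have M0' := periodicC_ge0 Hp0.
have [[cq pq qM] [dq Hq Dq]] := Hq0; have [[cp pp pM] [dp Hp Dp]] := Hp0.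
split.
  split=> [x|x|x]; [by apply: continuousM; [exact: cq|exact: cp]|by rewrite pq pp|].
  rewrite normrM; apply: (@le_trans _ _ (M * M')); first exact: ler_pM.
  by rewrite ler_peMl ?mulr_ge0// exprn_ege1// ler1n.
exists (fun x => dq x * p x + q x * dp x).
  rewrite exprS -mulrA (_ : 2 * _ = 2 ^+ j * (M * M') + 2 ^+ j * (M * M')); last by ring.
  apply: periodicC_add; apply: IH => //; exact: periodicC_weaken.
move=> x; have := Dq x => ?; have := Dp x => ?; apply: is_derive_eq.
by rewrite /GRing.scale/=; ring.
Qed.

Lemma periodicC_cst j (c : R) : periodicC j `|c| (fun=> c).
Proof.
suff H : forall j M (d : R), `|d| <= M -> periodicC j M (fun=> d) by exact: H.
elim=> [|{}j IH] M d dM.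
  by split=> //; split => // x; exact: cst_continuous.
split; first by split => // x; exact: cst_continuous.
exists (fun=> 0); first by apply: IH; rewrite normr0 (le_trans _ dM).
by move=> x; exact: is_derive_cst.
Qed.

Lemma periodicC_scale j M (c : R) q : periodicC j M q ->
  periodicC j (2 ^+ j * (`|c| * M)) (fun x => c * q x).
Proof. by move=> Hq; apply: periodicC_mul => //; exact: periodicC_cst. Qed.

(** The four functions form a cycle under differentiation, so the induction on [j] has to carry all
    of them together. *)
Lemma periodicC_cos_sin j (c : R) : periodicC j 1 (fun x => cos (x - c)) /\
  periodicC j 1 (fun x => sin (x - c)) /\ periodicC j 1 (fun x => - sin (x - c)) /\
  periodicC j 1 (fun x => - cos (x - c)).
Proof.
have cc : continuous (fun x : R => cos (x - c)).
  move=> x; apply: continuous_comp; last exact: continuous_cos.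
  by apply: continuousB; [exact: cvg_id|exact: cst_continuous].
have cs : continuous (fun x : R => sin (x - c)).
  move=> x; apply: continuous_comp; last exact: continuous_sin.
  by apply: continuousB; [exact: cvg_id|exact: cst_continuous].
have pc x : cos (x + 2 * pi - c) = cos (x - c).
  by rewrite addrAC mulr_natl cosD2pi.
have ps x : sin (x + 2 * pi - c) = sin (x - c).
  by rewrite addrAC mulr_natl sinD2pi.
have base : [/\ [/\ continuous (fun x : R => cos (x - c)),
    forall x, cos (x + 2 * pi - c) = cos (x - c) & forall x, `|cos (x - c)| <= 1],
    [/\ continuous (fun x : R => sin (x - c)),
    forall x, sin (x + 2 * pi - c) = sin (x - c) & forall x, `|sin (x - c)| <= 1],
    [/\ continuous (fun x : R => - sin (x - c)),
    forall x, - sin (x + 2 * pi - c) = - sin (x - c) & forall x, `|- sin (x - c)| <= 1] &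
    [/\ continuous (fun x : R => - cos (x - c)),
    forall x, - cos (x + 2 * pi - c) = - cos (x - c) & forall x, `|- cos (x - c)| <= 1]].
  split; split=> // x; rewrite ?normrN ?pc ?ps ?cos_max ?sin_max//.
  - by apply: continuousN; exact: cs.
  - by apply: continuousN; exact: cc.
case: base => B1 B2 B3 B4.
elim: j => [|j [I1 [I2 [I3 I4]]]]; first exact: (conj (conj B1 Logic.I) (conj (conj B2 Logic.I) (conj (conj B3 Logic.I) (conj B4 Logic.I)))).
split; [|split; [|split]]; split => //.
- by exists (fun x => - sin (x - c)) => // x; apply: is_derive_eq; rewrite /GRing.scale/=; ring.
- by exists (fun x => cos (x - c)) => // x; apply: is_derive_eq; rewrite /GRing.scale/=; ring.
- by exists (fun x => - cos (x - c)) => // x; apply: is_derive_eq; rewrite /GRing.scale/=; ring.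
- by exists (fun x => sin (x - c)) => // x; apply: is_derive_eq; rewrite /GRing.scale/=; ring.
Qed.

Lemma periodicC_inv j M (d : R) q : 0 < d -> (forall x, d <= q x) -> periodicC j M q ->
  exists M', periodicC j M' (fun x => (q x)^-1).
Proof.
move=> d0 qd; have q0 x : 0 < q x by rewrite (lt_le_trans d0).
have qn0 x : q x != 0 by rewrite gt_eqF.
have base M0 : periodicC 0 M0 q ->
    [/\ continuous (fun x => (q x)^-1), forall x, (q (x + 2 * pi))^-1 = (q x)^-1 &
        forall x, `|(q x)^-1| <= d^-1].
  move=> [[cq pq _] _]; split=> [x|x|x]; last 2 first.
  - by rewrite pq.
  - by rewrite gtr0_norm ?invr_gt0// lef_pV2 ?posrE.
  - by apply: continuousV => //; exact: cq.
elim: j => [|j IH] Hq; first by exists d^-1; split=> //; exact: base Hq.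
have [M' HM'] := IH (periodicC_weaken Hq).
have [H [dq Hdq Dq]] := Hq.
have := periodicC_mul (periodicC_scale (- 1) (periodicC_mul HM' HM')) Hdq.
set M2 := 2 ^+ j * _ => H2.
exists (Num.max d^-1 M2); split.
  have [c1 c2 c3] := base M (conj H Logic.I); split=> // x.
  by rewrite (le_trans (c3 x))// le_max lexx.
exists (fun x => -1 * ((q x)^-1 * (q x)^-1) * dq x).
  by apply: periodicC_le H2; rewrite le_max lexx orbT.
move=> x; have Dx := Dq x; have := is_deriveV (qn0 x) Dx.
move=> ?; apply: is_derive_eq; rewrite /GRing.scale/=.
by rewrite mulN1r -invfM expr2.
Qed.

Definition pospart (x : R) : R := Num.max 0 x.

Lemma pospart_ge0 x : 0 <= pospart x.
Proof. by rewrite le_max lexx. Qed.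

Lemma pospart_le x : pospart x <= `|x|.
Proof. by rewrite ge_max normr_ge0 ler_norm. Qed.

Lemma pospart_eq x : 0 <= x -> pospart x = x.
Proof. by move=> x0; apply/max_idPr. Qed.

Lemma pospart_eq0 x : x <= 0 -> pospart x = 0.
Proof. by move=> x0; apply/max_idPl. Qed.

Lemma continuous_pospart : continuous pospart.
Proof.
by move=> x; apply: (@continuous_max _ _ (cst 0) id); [exact: cst_continuous|exact: cvg_id].
Qed.

Lemma is_derive_pospartX m (x : R) :
  is_derive x (1 : R) (fun x => pospart x ^+ m.+2) (m.+2%:R * pospart x ^+ m.+1).
Proof.
have [x0|x0|->] := ltgtP x 0.
- rewrite pospart_eq0 ?(ltW x0)// expr0n mulr0.
  apply: (@near_eq_is_derive _ _ _ (cst 0)).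
  near=> y; rewrite pospart_eq0 ?expr0n//.
  by apply: ltW; near: y; exact: (lt_nbhsl x0).
- rewrite pospart_eq ?(ltW x0)//.
  have D : is_derive x (1 : R) (fun x : R => x ^+ m.+2) (m.+2%:R * x ^+ m.+1).
    by have := is_deriveX m.+2 (is_derive_id x (1 : R)); rewrite exprfctE /GRing.scale/= mulr1.
  apply: near_eq_is_derive D; near=> y; rewrite pospart_eq//.
  by apply: ltW; near: y; exact: (lt_nbhsr x0).
rewrite pospart_eq0// expr0n mulr0.
have N0 : (fun h : R => `|h|) @ (0 : R)^' --> (0 : R).
  have := @norm_continuous R R 0; rewrite /continuous_at normr0; exact: cvg_within_filter.
(* At the kink, the difference quotient is at most |h|^(m+1) in modulus, hence at most |h| once |h|
   <= 1. *)
have C : (fun h : R => h^-1 *: (((fun x : R => pospart x ^+ m.+2) \o shift 0) (h *: 1) - pospart 0 ^+ m.+2))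
    @ (0 : R)^' --> (0 : R).
  apply: (@squeeze_cvgr _ _ _ _ (fun h => - `|h|) (fun h => `|h|)).
  - near=> h; rewrite -ler_norml /= /GRing.scale/= mulr1 addr0 (pospart_eq0 (lexx 0)) expr0n subr0.
    rewrite normrM normfV (ger0_norm (exprn_ge0 _ (pospart_ge0 _))).
    have h0 : h != 0 by near: h; exact: nbhs_dnbhs_neq.
    have h1 : `|h| <= 1.
      by near: h; exact: dnbhs0_le.
    rewrite ler_pdivrMl ?normr_gt0// -expr2.
    rewrite (@le_trans _ _ (`|h| ^+ m.+2))//.
      by rewrite lerXn2r ?nnegrE ?pospart_ge0 ?pospart_le.
    by rewrite -addn2 exprD ler_piMl ?exprn_ge0// exprn_ile1.
  - rewrite -[X in _ --> X](oppr0 R); exact: (cvgN N0).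
  - exact: N0.
by split; [apply/cvg_ex; exists 0|exact/cvg_lim].
Unshelve. all: end_near. Qed.

(** Truncated powers of exponent at least j + 1 are of class C^j. This suffices for cutoffs here,
    since only finitely many derivatives are ever taken. *)
Lemma periodicC_pospartX j m M q : periodicC j M q ->
  exists M', periodicC j M' (fun x => pospart (q x) ^+ (m + j).+1).
Proof.
have base i M0 : periodicC 0 M0 q ->
    [/\ continuous (fun x => pospart (q x) ^+ i), forall x, pospart (q (x + 2 * pi)) ^+ i = pospart (q x) ^+ i &
        forall x, `|pospart (q x) ^+ i| <= M0 ^+ i].
  move=> [[cq pq qM] _]; split=> [x|x|x]; last 2 first.
  - by rewrite pq.
  - rewrite ger0_norm ?exprn_ge0 ?pospart_ge0// lerXn2r ?nnegrE ?pospart_ge0//.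
      exact: le_trans (qM x).
    exact: le_trans (pospart_le _) (qM x).
  - apply: (@continuous_comp _ _ _ (fun x => pospart (q x)) (fun y => y ^+ i)).
      by apply: continuous_comp; [exact: cq|exact: continuous_pospart].
    exact: exprn_continuous.
elim: j => [|j IH] Hq; first by eexists; split=> //; exact: base Hq.
have [M' HM'] := IH (periodicC_weaken Hq).
have [H [dq Hdq Dq]] := Hq.
have := periodicC_mul (periodicC_scale (m + j).+2%:R HM') Hdq.
set M2 := 2 ^+ j * _ => H2.
exists (Num.max (M ^+ (m + j).+2) M2); rewrite addnS; split.
  have [c1 c2 c3] := base (m + j).+2 M (conj H Logic.I); split=> // x.
  by rewrite (le_trans (c3 x))// le_max lexx.
exists (fun x => (m + j).+2%:R * pospart (q x) ^+ (m + j).+1 * dq x).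
  by apply: periodicC_le H2; rewrite le_max lexx orbT.
move=> x; have Dx := Dq x; have D := is_derive_pospartX (m + j) (q x).
exact: (is_derive1_comp D Dx).
Qed.

(** The cutoff is f / (f + g) with f and g the (j+1)-st powers of the positive parts of sin^2 - r1
    and r2 - sin^2. As a function of sin^2 (x - c) it removes [c] and [c + pi] at once, that is, a
    direction together with its antipode. *)
Lemma exists_cutoff j (r1 r2 c : R) : 0 < r1 < r2 -> exists k M, [/\ periodicC j M k,
  forall x, 0 <= k x <= 1, forall x, sin (x - c) ^+ 2 <= r1 -> k x = 0 &
  forall x, r2 <= sin (x - c) ^+ 2 -> k x = 1].
Proof.
move=> /andP[r10 r12].
have [_ [Hs _]] := periodicC_cos_sin j c.
have := periodicC_mul Hs Hs; set Ms := 2 ^+ j * _ => Hs2.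
pose u x := sin (x - c) * sin (x - c).
have H1 := periodicC_add Hs2 (periodicC_cst j (- r1)).
have H2 := periodicC_add (periodicC_scale (-1) Hs2) (periodicC_cst j r2).
have [M1 P1] := periodicC_pospartX 0 H1.
have [M2 P2] := periodicC_pospartX 0 H2.
have PD := periodicC_add P1 P2.
pose d : R := ((r2 - r1) / 2) ^+ (0 + j).+1.
have d0 : 0 < d by rewrite exprn_gt0// divr_gt0// subr_gt0.
(* On either side of the midpoint of [r1] and [r2], one of the two positive parts is at least half
   the gap, so the denominator stays away from 0. *)
have Dd x : d <= pospart (u x - r1) ^+ (0 + j).+1 + pospart (-1 * u x + r2) ^+ (0 + j).+1.
  have r0 : 0 <= (r2 - r1) / 2 by rewrite divr_ge0// subr_ge0 ltW.
  have X1 := exprn_ge0 (0 + j).+1 (pospart_ge0 (u x - r1)).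
  have X2 := exprn_ge0 (0 + j).+1 (pospart_ge0 (-1 * u x + r2)).
  have [ux|ux] := leP ((r2 + r1) / 2) (u x).
    rewrite (@le_trans _ _ (pospart (u x - r1) ^+ (0 + j).+1)) ?lerDl//.
    by rewrite lerXn2r ?nnegrE ?pospart_ge0// pospart_eq; lra.
  rewrite (@le_trans _ _ (pospart (-1 * u x + r2) ^+ (0 + j).+1)) ?lerDr//.
  by rewrite lerXn2r ?nnegrE ?pospart_ge0// pospart_eq; lra.
have [MI PI] := periodicC_inv d0 Dd PD.
have PK := periodicC_mul P1 PI.
eexists; eexists; split; first exact: PK.
- move=> x; have X1 := exprn_ge0 (0 + j).+1 (pospart_ge0 (u x - r1)).
  have X2 := exprn_ge0 (0 + j).+1 (pospart_ge0 (-1 * u x + r2)).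
  have D0 := lt_le_trans d0 (Dd x).
  by rewrite divr_ge0 ?(ltW D0)//= ler_pdivrMr// mul1r lerDl.
- by move=> x xr /=; rewrite pospart_eq0 ?expr0n ?mul0r// subr_le0.
- move=> x xr /=; rewrite (@pospart_eq0 (-1 * _ + _)); last by rewrite mulN1r addrC subr_le0.
  rewrite expr0n addr0 divff// expf_neq0// gt_eqF// lt_max subr_gt0.
  by rewrite (lt_le_trans r12 xr) orbT.
Qed.

End PeriodicSmoothness.

(** * Integration by parts over a period *)

Section FourierDecay.
Context {R : realType}.
Notation mu := (@lebesgue_measure R).
Implicit Types (q p : R -> R) (M : R).

Lemma sin_int_periodic (k : int) (x : R) : sin (k%:~R * (x + 2 * pi)) = sin (k%:~R * x).
Proof.
have nat_case (n : nat) (y : R) : sin (n%:R * (y + 2 * pi)) = sin (n%:R * y).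
  by rewrite mulrDr !mulr_natl (periodicn (@sinD2pi R)).
case: k => n; first exact: nat_case.
by rewrite NegzE mulrNz !mulNr !sinN; congr (- _); exact: nat_case.
Qed.

Lemma cos_int_periodic (k : int) (x : R) : cos (k%:~R * (x + 2 * pi)) = cos (k%:~R * x).
Proof.
have nat_case (n : nat) (y : R) : cos (n%:R * (y + 2 * pi)) = cos (n%:R * y).
  by rewrite mulrDr !mulr_natl (periodicn (@cosD2pi R)).
case: k => n; first exact: nat_case.
by rewrite NegzE mulrNz !mulNr !cosN; exact: nat_case.
Qed.

Lemma continuous_add_real (f g : R -> R) : continuous f -> continuous g ->
  continuous (fun x => f x + g x).
Proof. by move=> cf cg x; apply: continuousD; [exact: cf|exact: cg]. Qed.

Lemma integrable_period (f : R -> R) : continuous f ->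
  mu.-integrable `[0, 2 * pi] (EFin \o f).
Proof.
move=> cf; apply: continuous_compact_integrable; first exact: segment_compact.
exact: continuous_subspaceT.
Qed.

Lemma Rintegral_derivative_period (F f : R -> R) : continuous f ->
  (forall x : R, is_derive x (1 : R) F (f x)) -> F (2 * pi) = F 0 ->
  Rintegral mu `[0, 2 * pi] f = 0.
Proof.
move=> cf D F0; have cF := is_derive_continuous D.
rewrite /Rintegral (@continuous_FTC2 _ _ F)//=.
- by rewrite F0 subrr.
- by rewrite mulr_gt0// pi_gt0.
- exact: continuous_subspaceT.
- split.
  + by move=> x _; apply: ex_derive.
  + by apply: cvg_at_right_filter; exact: cF.
  + by apply: cvg_at_left_filter; exact: cF.
- by move=> x _; rewrite derive1E; apply: derive_val.
Qed.

Lemma norm_Rintegral_period M f : continuous f -> (forall x : R, `|f x| <= M) ->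
  `|Rintegral mu `[0, 2 * pi] f| <= 2 * pi * M.
Proof.
move=> cf fM; have int0 : mu.-integrable `[0, 2 * pi] (EFin \o f) by exact: integrable_period.
rewrite (le_trans (le_normr_Rintegral _ int0))//.
have -> : 2 * pi * M = Rintegral mu `[0, 2 * pi] (fun=> M).
  rewrite Rintegral_cst//= lebesgue_measure_itv/= lte_fin mulr_gt0 ?pi_gt0//=.
  by rewrite subr0 mulrC.
apply: le_Rintegral => //; first exact: integrable_norm.
by apply: integrable_period => x; exact: cst_continuous.
Qed.

Lemma continuous_mul_trig q (k : R) : continuous q ->
  continuous (fun x => q x * cos (k * x)) /\ continuous (fun x => q x * sin (k * x)).
Proof.
move=> cq; have ck : continuous (fun x : R => k * x) by exact: mulrl_continuous.
split=> x; apply: continuousM => //; try exact: cq; apply: continuous_comp.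
- exact: ck.
- exact: continuous_cos.
- exact: ck.
- exact: continuous_sin.
Qed.

(** Integration by parts [j] times, without boundary terms by periodicity. Each step swaps cosine
    and sine, so both are treated together. *)
Lemma fourier_decay j M q (k : int) : periodicC j M q ->
  `|k%:~R| ^+ j * `|Rintegral mu `[0, 2 * pi] (fun x => q x * cos (k%:~R * x))| <= 2 * pi * M /\
  `|k%:~R| ^+ j * `|Rintegral mu `[0, 2 * pi] (fun x => q x * sin (k%:~R * x))| <= 2 * pi * M.
Proof.
elim: j q => [|j IH] q Hq; have [cq pq qM] := periodicC_base Hq;
  have [cc cs] := continuous_mul_trig k%:~R cq.
  rewrite expr0 !mul1r; split; apply: norm_Rintegral_period => // x; rewrite normrM.
    by rewrite (le_trans _ (qM x))// ler_piMr// cos_max.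
  by rewrite (le_trans _ (qM x))// ler_piMr// sin_max.
have [_ [dq Hdq Dq]] := Hq; have [IH1 IH2] := IH _ Hdq.
have [cdq _ _] := periodicC_base Hdq.
have [dcc dcs] := continuous_mul_trig k%:~R cdq.
have kc : continuous (fun x : R => k%:~R * (q x * cos (k%:~R * x))).
  move=> x; apply: (@continuous_comp _ _ _ (fun x => q x * cos (k%:~R * x)) (fun y => k%:~R * y)).
    exact: cc.
  exact: mulrl_continuous.
have ks : continuous (fun x : R => - k%:~R * (q x * sin (k%:~R * x))).
  move=> x; apply: (@continuous_comp _ _ _ (fun x => q x * sin (k%:~R * x)) (fun y => - k%:~R * y)).
    exact: cs.
  exact: mulrl_continuous.
have E1 : k%:~R * Rintegral mu `[0, 2 * pi] (fun x => q x * cos (k%:~R * x)) =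
    - Rintegral mu `[0, 2 * pi] (fun x => dq x * sin (k%:~R * x)).
  apply/eqP; rewrite -addr_eq0 -RintegralZl//; last exact: integrable_period.
  rewrite -RintegralD//; try exact: integrable_period.
  apply/eqP; apply: (@Rintegral_derivative_period (fun x => q x * sin (k%:~R * x))).
  - exact: continuous_add_real kc dcs.
  - move=> x; have := Dq x => ?; apply: is_derive_eq.
    by rewrite /GRing.scale/=; ring.
  - by have := sin_int_periodic k 0; have := pq 0; rewrite !add0r => -> ->.
have E2 : k%:~R * Rintegral mu `[0, 2 * pi] (fun x => q x * sin (k%:~R * x)) =
    Rintegral mu `[0, 2 * pi] (fun x => dq x * cos (k%:~R * x)).
  apply/eqP; rewrite -subr_eq0 -opprB oppr_eq0 addrC -mulNr -RintegralZl//; last exact: integrable_period.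
  rewrite -RintegralD//; try exact: integrable_period.
  apply/eqP; apply: (@Rintegral_derivative_period (fun x => q x * cos (k%:~R * x))).
  - exact: continuous_add_real ks dcc.
  - move=> x; have := Dq x => ?; apply: is_derive_eq.
    by rewrite /GRing.scale/=; ring.
  - by have := cos_int_periodic k 0; have := pq 0; rewrite !add0r => -> ->.
by split; rewrite exprSr -mulrA -normrM ?E1 ?E2 ?normrN.
Qed.

(** Each derivative in the angle brings out at most one factor of [s]. The constant precedes [x1]
    and [x2] so that the bound can later be integrated over the support of a packet. *)
Lemma periodicC_phase j : exists2 C : R, 0 <= C & forall s x1 x2 : R, `|x1| <= 1 -> `|x2| <= 1 ->
  periodicC j (C * (1 + `|s|) ^+ j) (fun x => cos (s * (x1 * cos x + x2 * sin x))) /\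
  periodicC j (C * (1 + `|s|) ^+ j) (fun x => sin (s * (x1 * cos x + x2 * sin x))).
Proof.
have cos0 i : periodicC i 1 (@cos R).
  have [H _] := periodicC_cos_sin i (0 : R).
  by rewrite (_ : cos = fun x => cos (x - 0))//; apply/funext => x; rewrite subr0.
have sin0 i : periodicC i 1 (@sin R).
  have [_ [H _]] := periodicC_cos_sin i (0 : R).
  by rewrite (_ : sin = fun x => sin (x - 0))//; apply/funext => x; rewrite subr0.
have Lper i (y1 y2 : R) : `|y1| <= 1 -> `|y2| <= 1 ->
    periodicC i (2 ^+ i * 2) (fun x => y1 * cos x + y2 * sin x).
  move=> Y1 Y2; rewrite (_ : 2 ^+ i * 2 = 2 ^+ i * (1 * 1) + 2 ^+ i * (1 * 1)); last by ring.
  by apply: periodicC_add; apply: periodicC_mul => //; apply: periodicC_le (periodicC_cst i _).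
have base (s x1 x2 : R) : [/\ (forall M, 1 <= M -> periodicC 0 M (fun x => cos (s * (x1 * cos x + x2 * sin x)))),
    (forall M, 1 <= M -> periodicC 0 M (fun x => sin (s * (x1 * cos x + x2 * sin x)))) &
    forall x : R, is_derive x (1 : R) (fun x => s * (x1 * cos x + x2 * sin x)) (s * (x2 * cos x + - x1 * sin x))].
  have D : forall x : R, is_derive x (1 : R) (fun x => s * (x1 * cos x + x2 * sin x)) (s * (x2 * cos x + - x1 * sin x)).
    by move=> x; apply: is_derive_eq; rewrite /GRing.scale/=; ring.
  have cL := is_derive_continuous D.
  have pL (x : R) : s * (x1 * cos (x + 2 * pi) + x2 * sin (x + 2 * pi)) = s * (x1 * cos x + x2 * sin x).
    by rewrite mulr_natl cosD2pi sinD2pi.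
  split=> // M M1; split=> //; split=> x; rewrite ?pL//.
  - by apply: continuous_comp; [exact: cL|exact: continuous_cos].
  - by rewrite (le_trans (cos_max _)).
  - by apply: continuous_comp; [exact: cL|exact: continuous_sin].
  - by rewrite (le_trans (sin_max _)).
elim: j => [|j [C C0 IH]].
  exists 1 => // s x1 x2 _ _; have [b1 b2 _] := base s x1 x2.
  by rewrite expr0 mulr1; split; [exact: b1|exact: b2].
pose C' := 1 + 2 ^+ j * (C * (2 ^+ j * (2 ^+ j * 2))).
exists C' => [|s x1 x2 X1 X2]; first by rewrite addr_ge0 ?mulr_ge0 ?exprn_ge0.
have [b1 b2 D] := base s x1 x2; have [I1 I2] := IH s x1 x2 X1 X2.
have P1 : 1 <= 1 + `|s| by rewrite lerDl.
have C'1 : 1 <= C' * (1 + `|s|) ^+ j.+1.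
  by rewrite mulr_ege1// ?exprn_ege1// lerDl !mulr_ge0 ?exprn_ge0.
have HL : periodicC j (2 ^+ j * (`|s| * (2 ^+ j * 2))) (fun x => s * (x2 * cos x + - x1 * sin x)).
  by apply: periodicC_scale; apply: Lper => //; rewrite normrN.
have HL' : periodicC j (2 ^+ j * (`|s| * (2 ^+ j * 2))) (fun x => s * (- x2 * cos x + x1 * sin x)).
  by apply: periodicC_scale; apply: Lper => //; rewrite normrN.
have bnd : 2 ^+ j * (C * (1 + `|s|) ^+ j * (2 ^+ j * (`|s| * (2 ^+ j * 2)))) <= C' * (1 + `|s|) ^+ j.+1.
  rewrite [leLHS](_ : _ = 2 ^+ j * (C * (2 ^+ j * (2 ^+ j * 2))) * ((1 + `|s|) ^+ j * `|s|)); last by ring.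
  rewrite exprSr; apply: ler_pM; rewrite ?mulr_ge0 ?exprn_ge0 ?addr_ge0//.
    by rewrite lerDr.
  by rewrite ler_wpM2l ?exprn_ge0 ?addr_ge0// lerDr.
split.
- split; first by have [] := b1 _ C'1.
  exists (fun x => sin (s * (x1 * cos x + x2 * sin x)) * (s * (- x2 * cos x + x1 * sin x))).
    by apply: periodicC_le bnd _; exact: periodicC_mul.
  move=> x; have Dx := D x; have := is_derive1_comp (is_derive_cos _) Dx => Dc.
  by apply: (is_derive_eq Dc); ring.
- split; first by have [] := b2 _ C'1.
  exists (fun x => cos (s * (x1 * cos x + x2 * sin x)) * (s * (x2 * cos x + - x1 * sin x))).
    by apply: periodicC_le bnd _; exact: periodicC_mul.
  by move=> x; have Dx := D x; exact: (is_derive1_comp (is_derive_sin _) Dx).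
Qed.

(** The trade behind the decay in the angular frequency: [j] powers of [k] are gained for [j] powers
    of [s]. The complex integral splits into four real ones, whence the factor 4. *)
Lemma kernel_decay j M kap : periodicC j M kap -> exists C : R, forall (k : int) (s x1 x2 : R),
  `|x1| <= 1 -> `|x2| <= 1 ->
  `|k%:~R| ^+ j * cabs (cintegral mu `[0, 2 * pi] (fun x => (kap x)%:C%C *
     expi (- (k%:~R * x)) * expi (- (s * (x1 * cos x + x2 * sin x))))) <= C * (1 + `|s|) ^+ j.
Proof.
move=> Hk; have [C0 C00 HC] := periodicC_phase j.
have M0 := periodicC_ge0 Hk.
exists (4 * (2 * pi * (2 ^+ j * (M * C0)))) => k s x1 x2 X1 X2.
have [Hc Hs] := HC s x1 x2 X1 X2.
have := periodicC_mul Hk Hc; set Mq := 2 ^+ j * _ => Kc.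
have := periodicC_mul Hk Hs; rewrite -/Mq => Ks.
have [A1 A2] := fourier_decay k Kc; have [A3 A4] := fourier_decay k Ks.
have [cKc _ _] := periodicC_base Kc; have [cKs _ _] := periodicC_base Ks.
have [T1 T2] := continuous_mul_trig k%:~R cKc; have [T3 T4] := continuous_mul_trig k%:~R cKs.
set I := cintegral _ _ _.
set a1 := Rintegral _ _ _ in A1; set a2 := Rintegral _ _ _ in A2.
set a3 := Rintegral _ _ _ in A3; set a4 := Rintegral _ _ _ in A4.
have RI : complex.Re I = a1 - a4.
  rewrite /a1 /a4 -RintegralB//; try exact: integrable_period.
  apply: eq_Rintegral => x _; rewrite /expi !(complex_ReM, complex_ImM)/= !cosN !sinN; ring.
have II : complex.Im I = - (a2 + a3).
  rewrite /a2 /a3 -RintegralD//; try exact: integrable_period.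
  rewrite -mulN1r -RintegralZl//; last first.
    by apply: integrable_period; exact: continuous_add_real T2 T3.
  apply: eq_Rintegral => x _; rewrite /expi !(complex_ReM, complex_ImM)/= !cosN !sinN; ring.
rewrite (@le_trans _ _ (`|k%:~R| ^+ j * (`|a1| + `|a4| + `|a2| + `|a3|)))//.
  rewrite ler_wpM2l ?exprn_ge0// (le_trans (cabs_le_ReIm _))// RI II normrN.
  by have := ler_normB a1 a4; have := ler_normD a2 a3; lra.
rewrite [leRHS](_ : _ = 4 * (2 * pi * Mq)); last by rewrite /Mq; ring.
move: (2 * pi * Mq) A1 A2 A3 A4 => B A1 A2 A3 A4; lra.
Qed.

End FourierDecay.

(** * Wave packets *)

Section ModulatedSplines.
Context {R : realType}.
Notation mu := (@lebesgue_measure R).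

Definition modulated (c : R) (b : R -> R) (t : R) : R[i] := (b t)%:C%C * expi (c * t).

Lemma cintegrable_modulated c p w beta b : spline p w beta b -> cintegrable mu (modulated c b).
Proof.
move=> sb; apply: cintegrable_expi; last exact: measurable_funM.
exact: cintegrable_real (spline_integrable sb).
Qed.

Lemma fourier_modulated c p w beta b : spline p w beta b -> forall xi : R,
  cintegral mu setT (fun t => modulated c b t * expi (- (t * xi))) =
  (beta (xi - c))%:C%C * expi (- (p * (xi - c))).
Proof.
move=> [_ _ _ FT] xi; rewrite -FT.
have P (t : R) : modulated c b t * expi (- (t * xi)) = (b t)%:C%C * expi (- (t * (xi - c))).
  by rewrite /modulated -mulrA -expiD; congr (_ * expi _); ring.
by apply: eq_cintegral => t _; exact: P.
Qed.

Lemma modulated_out c p w beta b t : spline p w beta b -> w < `|t - p| -> modulated c b t = 0.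
Proof. by move=> [_ _ b0 _] tw; rewrite /modulated b0// mul0r. Qed.

End ModulatedSplines.

Section PlaneIntegrability.
Context {R : realType}.
Notation mu := (@lebesgue_measure R).

Lemma smooth_bounded (f : R * R -> R[i]) (r : R) : smooth f ->
  exists B, forall p : R * R, `|p| <= r -> cabs (f p) <= B.
Proof.
move=> /(_ [::])[cr ci _].
have bnd (g : R * R -> R) : continuous g -> exists B, forall p : R * R, `|p| <= r -> `|g p| <= B.
  move=> cg; have K : compact (`[- r, r] `*` `[- r, r] : set (R * R)).
    by apply: compact_setX; exact: segment_compact.
  have /compact_bounded[M [_ HM]] : compact (g @` (`[- r, r] `*` `[- r, r])).
    by apply: continuous_compact => //; exact: continuous_subspaceT.
  exists (M + 1) => p pr; apply: HM; first by rewrite ltrDl.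
  exists p => //; move: pr; rewrite prod_normE/= ge_max => /andP[p1 p2].
  by split; rewrite /= in_itv/= -ler_norml.
have [B1 H1] := bnd _ cr; have [B2 H2] := bnd _ ci.
exists (B1 + B2) => p pr; rewrite (le_trans (cabs_le_ReIm _))// lerD ?H1 ?H2//.
Qed.

Lemma schwartz_cintegrable (h : R * R -> R[i]) : schwartz h -> cintegrable (mu \x mu)%E h.
Proof.
move=> [sh rh]; have [B HB] := rh 4%N.
have iB : (mu \x mu)%E.-integrable setT (EFin \o (fun p : R * R =>
    B * ((1 + (p.1 - 0) ^+ 2)^-1 * (1 + (p.2 - 0) ^+ 2)^-1))).
  have := integrableZl measurableT B (integrable_tensor (integrable_cauchy 0) (integrable_cauchy 0)).
  by apply: eq_integrable.
apply: (le_cintegrable _ iB).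
- exact: smooth_cmeasurable.
- move=> p; have := HB [::] p (leq0n _); rewrite !subr0 /= => H.
  have c0 (x : R) : 0 < 1 + x ^+ 2 by rewrite ltr_pwDl// sqr_ge0.
  rewrite -invfM ler_pdivlMr ?mulr_gt0// (le_trans _ H)// mulrC ler_wpM2r ?cabs_ge0//.
  have le_sq (x : R) : `|x| <= `|p| -> 1 + x ^+ 2 <= (1 + `|p|) ^+ 2.
    move=> xp; rewrite -(real_normK (num_real x)).
    by have := normr_ge0 x; move: `|x| `|p| xp => *; nra.
  (* Decay of order 4 is used: two powers of 1 + |p| for the Cauchy density of each coordinate. *)
  rewrite (_ : 4 = 2 + 2)%N// exprD; apply: ler_pM; [exact: ltW|exact: ltW| |].
    by apply: le_sq; rewrite prod_normE/= le_max lexx.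
  by apply: le_sq; rewrite prod_normE/= le_max lexx orbT.
Qed.

End PlaneIntegrability.

Section Wave.
Context {R : realType}.
Notation mu := (@lebesgue_measure R).
Variables (lam c1 c2 p1 p2 w : R) (beta b1 b2 : R -> R).
Hypotheses (sb1 : spline p1 w beta b1) (sb2 : spline p2 w beta b2).

Definition wave (x : R * R) : R[i] :=
  lam%:C%C * (modulated c1 b1 x.1 * modulated c2 b2 x.2).

Definition wave_hat (xi : R * R) : R[i] := lam%:C%C *
  (((beta (xi.1 - c1))%:C%C * expi (- (p1 * (xi.1 - c1)))) *
   ((beta (xi.2 - c2))%:C%C * expi (- (p2 * (xi.2 - c2))))).

Definition wave_distribution (psi : R * R -> R[i]) : R[i] :=
  cintegral (mu \x mu)%E setT (fun x => wave x * psi x).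

Lemma wave_out x : w < `|x.1 - p1| \/ w < `|x.2 - p2| -> wave x = 0.
Proof.
by rewrite /wave; case=> [/(modulated_out c1 sb1)|/(modulated_out c2 sb2)] ->;
  rewrite ?mul0r ?mulr0.
Qed.

Lemma cintegrable_wave : cintegrable (mu \x mu)%E wave.
Proof.
apply: cintegrableZl.
have := @cintegrable_kernel _ _ _ _ _ _ _ _ _ (cintegrable_modulated c1 sb1)
  (cintegrable_modulated c2 sb2) (fun=> 1) 1 (cmeasurable_cst _ _).
under eq_fun do rewrite mulr1; apply => z.
by rewrite cabs_real normr1.
Qed.

Lemma fourier_wave (xi : R * R) :
  cintegral (mu \x mu)%E setT (fun x => wave x * expi (- (xi.1 * x.1 + xi.2 * x.2))) =
  wave_hat xi.
Proof.
have m1 := measurable_mulN xi.1; have m2 := measurable_mulN xi.2.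
have i1 := cintegrable_expi (cintegrable_modulated c1 sb1) m1.
have i2 := cintegrable_expi (cintegrable_modulated c2 sb2) m2.
have E := cintegral_tensor i1 i2.
rewrite (fourier_modulated c1 sb1) (fourier_modulated c2 sb2) in E.
rewrite /wave_hat -E -cintegralZl; last first.
  have := @cintegrable_kernel _ _ _ _ _ _ _ _ _ i1 i2 (fun=> 1) 1 (cmeasurable_cst _ _).
  by under eq_fun do rewrite mulr1; apply => z; rewrite cabs_real normr1.
have P (x : R * R) : wave x * expi (- (xi.1 * x.1 + xi.2 * x.2)) =
    lam%:C%C * (modulated c1 b1 x.1 * expi (- (x.1 * xi.1)) * (modulated c2 b2 x.2 * expi (- (x.2 * xi.2)))).
  rewrite /wave -mulrA; congr (_ * _); rewrite [RHS]mulrACA -expiD; congr (_ * expi _).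
  by ring.
by apply: eq_cintegral => x _; exact: P.
Qed.

Lemma wave_radius (x : R * R) : wave x != 0 -> `|x.1 - p1| <= w /\ `|x.2 - p2| <= w.
Proof.
move=> wx; split; rewrite leNgt; apply: contra wx => H; rewrite wave_out//.
  by left.
by right.
Qed.

Lemma wave_radius_norm (x : R * R) : wave x != 0 -> `|x| <= Num.max `|p1| `|p2| + w.
Proof.
move=> /wave_radius[x1 x2]; rewrite prod_normE/= ge_max; apply/andP; split.
  rewrite -(subrK p1 x.1) (le_trans (ler_normD _ _))// addrC lerD//.
  by rewrite le_max lexx.
rewrite -(subrK p2 x.2) (le_trans (ler_normD _ _))// addrC lerD//.
by rewrite le_max lexx orbT.
Qed.

Lemma integrable_cabs_wave (B : R) :
  (mu \x mu)%E.-integrable setT (EFin \o (fun x : R * R => B * cabs (wave x))).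
Proof.
have := integrableZl measurableT B (integrable_cabs cintegrable_wave).
by apply: eq_integrable.
Qed.

Lemma cabs_wave_le (f : R * R -> R[i]) (B : R) :
  (forall p : R * R, `|p| <= Num.max `|p1| `|p2| + w -> cabs (f p) <= B) ->
  forall x, cabs (wave x * f x) <= B * cabs (wave x).
Proof.
move=> fB x; rewrite cabsM mulrC; have [->|wx] := eqVneq (wave x) 0.
  by rewrite cabs0 !mulr0.
by rewrite ler_wpM2r ?cabs_ge0// fB// wave_radius_norm.
Qed.

Lemma cintegrable_wave_smooth f : smooth f -> cintegrable (mu \x mu)%E (fun x => wave x * f x).
Proof.
move=> sf; have [B HB] := smooth_bounded (Num.max `|p1| `|p2| + w) sf.
apply: (le_cintegrable _ (integrable_cabs_wave B)).
- apply: cmeasurableM; last exact: smooth_cmeasurable.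
  exact: cintegrable_cmeasurable cintegrable_wave.
- exact: cabs_wave_le.
Qed.

Lemma wave_compactly_supported : compactly_supported_distribution wave_distribution.
Proof.
split.
  move=> a f g sf sg; rewrite /wave_distribution.
  have iaf := cintegrableZl a (cintegrable_wave_smooth sf).
  rewrite -(cintegralZl a (cintegrable_wave_smooth sf)).
  rewrite -(cintegralD iaf (cintegrable_wave_smooth sg)).
  have P (x : R * R) : wave x * (a * f x + g x) = a * (wave x * f x) + wave x * g x.
    by rewrite mulrDr mulrCA.
  by apply: eq_cintegral => x _; exact: P.
exists (Num.max `|p1| `|p2| + w), (2 * Rintegral (mu \x mu)%E setT (cabs \o wave)), 0%N.
move=> f B sf fB.
have {}fB : forall p : R * R, `|p| <= Num.max `|p1| `|p2| + w -> cabs (f p) <= B.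
  by move=> p pr; exact: (fB [::]).
rewrite (le_trans (cabs_cintegral_le (cintegrable_wave_smooth sf) (integrable_cabs_wave B) (cabs_wave_le fB)))//.
rewrite RintegralZl//; last exact: (integrable_cabs cintegrable_wave).
by rewrite mulrCA mulrC -mulrA.
Qed.

Lemma closed_unit_ball : closed (@unit_ball R).
Proof.
rewrite (_ : unit_ball = (fun x : R * R => x.1 ^+ 2 + x.2 ^+ 2) @^-1` [set y | y <= 1])//.
suff C : continuous (fun x : R * R => x.1 ^+ 2 + x.2 ^+ 2).
  by apply: closed_comp; [move=> x _; exact: C|exact: closed_le].
move=> x; apply: (@continuousD _ _ _ (fun x : R * R => x.1 ^+ 2) (fun x : R * R => x.2 ^+ 2)).
  apply: (@continuous_comp _ _ _ fst (fun t : R => t ^+ 2)); first exact: cvg_fst.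
  exact: exprn_continuous.
apply: (@continuous_comp _ _ _ snd (fun t : R => t ^+ 2)); first exact: cvg_snd.
exact: exprn_continuous.
Qed.

Lemma wave_dsupport : (forall x : R * R, `|x.1 - p1| <= w -> `|x.2 - p2| <= w -> unit_ball x) ->
  dsupport wave_distribution `<=` unit_ball.
Proof.
move=> ball x xs; apply: contrapT => xb.
have oU : open (~` (@unit_ball R)) by apply: closed_openC; exact: closed_unit_ball.
have [f [sf cf fU] /negP] := xs _ oU xb; apply; apply/eqP.
have P (y : R * R) : wave y * f y = 0.
  have [->|/wave_radius[y1 y2]] := eqVneq (wave y) 0; first by rewrite mul0r.
  have [->|fy] := eqVneq (f y) 0; first by rewrite mulr0.
  by exfalso; apply: (fU y); [exact: subset_closure|exact: ball].
by rewrite /wave_distribution -(cintegral_zero (mu \x mu)%E setT); apply: eq_cintegral => y _; exact: P.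
Qed.

Hypothesis mbeta : measurable_fun setT beta.

Lemma cmeasurable_wave_hat : cmeasurable wave_hat.
Proof.
apply: cmeasurableM; first exact: cmeasurable_cst.
have m (c p : R) : cmeasurable (fun t : R => (beta (t - c))%:C%C * expi (- (p * (t - c)))).
  have mc : measurable_fun setT (fun t : R => t - c) by exact: measurable_funB.
  apply: cmeasurableM; first by apply: cmeasurable_real; exact: (measurableT_comp mbeta mc).
  by apply: cmeasurable_expi; apply: measurableT_comp => //; exact: measurable_funM.
apply: cmeasurableM.
  exact: (cmeasurable_comp measurable_fst (m c1 p1)).
exact: (cmeasurable_comp measurable_snd (m c2 p2)).
Qed.

(** Fubini with the exponential as bounded kernel on R^2 x R^2 moves the transform from the test
    function to the packet. *)
Lemma wave_has_fourier2 : has_fourier2 wave_distribution wave_hat.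
Proof.
split; first exact: cmeasurable_wave_hat.
move=> h sh.
pose K (z : (R * R) * (R * R)) : R[i] := expi (- (z.2.1 * z.1.1 + z.2.2 * z.1.2)).
have mK : cmeasurable K.
  apply: cmeasurable_expi; apply: measurableT_comp => //.
  apply: measurable_funD; apply: measurable_funM.
  - exact: (measurableT_comp measurable_fst measurable_snd).
  - exact: (measurableT_comp measurable_fst measurable_fst).
  - exact: (measurableT_comp measurable_snd measurable_snd).
  - exact: (measurableT_comp measurable_snd measurable_fst).
have KB z : cabs (K z) <= 1 by rewrite cabs_expi.
have := @cintegral_kernel_swap _ _ _ _ _ (prod_measure mu mu) (prod_measure mu mu)
  _ _ cintegrable_wave (schwartz_cintegrable sh) K 1 mK KB.
rewrite /wave_distribution /fourier2 => E.
transitivity (cintegral (mu \x mu)%E setT (fun y => h y * wave_hat y)).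
  rewrite [LHS]E.
  have P (y : R * R) : h y * cintegral (mu \x mu)%E setT (fun x => wave x * K (x, y)) = h y * wave_hat y.
    by rewrite -fourier_wave.
  by apply: eq_cintegral => y _; exact: P.
have P (y : R * R) : h y * wave_hat y = wave_hat y * h y by exact: mulrC.
by apply: eq_cintegral => y _; exact: P.
Qed.

End Wave.

(** * Sobolev norms of wave packets *)

Section HalfPower.
Context {R : realType}.

Lemma half_powR_sqr (y : R) : 0 <= y -> (y ^+ 2) `^ 2^-1 = y.
Proof. by move=> y0; rewrite powR12_sqrt ?sqr_ge0// sqrtr_sqr ger0_norm. Qed.

Lemma half_poweR_le (X : \bar R) (y : R) : (0 <= X)%E -> 0 <= y ->
  (X <= (y ^+ 2)%:E)%E -> (X `^ 2^-1 <= y%:E)%E.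
Proof.
move=> X0 y0; case: X X0 => [x| |]// x0.
rewrite lee_fin in x0; rewrite poweR_EFin !lee_fin => xy.
rewrite -[leRHS](half_powR_sqr y0); apply: ge0_ler_powR => //.
by rewrite nnegrE sqr_ge0.
Qed.

Lemma half_poweR_ge (X : \bar R) (y : R) : (0 <= X)%E -> 0 <= y ->
  ((y ^+ 2)%:E <= X)%E -> (y%:E <= X `^ 2^-1)%E.
Proof.
move=> X0 y0; case: X X0 => [x| |]// x0; last first.
  by move=> _; rewrite poweRyr ?leey// invr_neq0.
rewrite lee_fin in x0; rewrite poweR_EFin !lee_fin => xy.
rewrite -[leLHS](half_powR_sqr y0); apply: ge0_ler_powR => //.
by rewrite nnegrE sqr_ge0.
Qed.

End HalfPower.

Section WeightedBounds.
Context {R : realType}.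
Notation mu := (@lebesgue_measure R).

(** The right-hand side is an extended real, so measurability is enough: when the integral of the
    real or imaginary part is infinite, [fine] makes it 0. The lower Sobolev bound needs this for an
    arbitrary representative [g]. *)
Lemma cabs_cintegral_ereal d (T : measurableType d) (m : {measure set T -> \bar R})
    (f : T -> R[i]) : cmeasurable f ->
  ((cabs (cintegral m setT f))%:E <= 2%:E * \int[m]_x (cabs (f x))%:E)%E.
Proof.
move=> mf; have [rf jf] := mf; have mcf := measurable_cabs mf.
have aux (g : T -> R) : measurable_fun setT g -> (forall x, `|g x| <= cabs (f x)) ->
    (`|Rintegral m setT g|%:E <= \int[m]_x (cabs (f x))%:E)%E.
  move=> mg gf; apply: (@le_trans _ _ (`|\int[m]_x (g x)%:E|)%E).
    rewrite /Rintegral; case: (\int[m]_x (g x)%:E)%E => [r| |] //=.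
      by rewrite normr0 leey.
    by rewrite normr0 leey.
  apply: (le_trans (le_abse_integral _ measurableT _)); first exact/measurable_EFinP.
  apply: ge0_le_integral => //.
  - by apply: measurableT_comp => //; exact/measurable_EFinP.
  - exact/measurable_EFinP.
  - by move=> x _; rewrite /= lee_fin.
rewrite (@le_trans _ _ (`|complex.Re (cintegral m setT f)| + `|complex.Im (cintegral m setT f)|)%:E)//.
  by rewrite lee_fin cabs_le_ReIm.
rewrite EFinD mule_natl mule2n; apply: leeD; apply: aux => // x.
  exact: Re_le_cabs.
exact: Im_le_cabs.
Qed.

Lemma measurable_weight (s : R) :
  measurable_fun setT (fun xi : R * R => (1 + xi.1 ^+ 2 + xi.2 ^+ 2) `^ s).
Proof.
apply: (measurableT_comp (measurable_powR s)).
apply: measurable_funD; first apply: measurable_funD => //.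
  by apply: measurable_funX; exact: measurable_fst.
by apply: measurable_funX; exact: measurable_snd.
Qed.

(** Of the S + 1 powers of the offset weight, [peetre] consumes S, and the last one leaves a product
    Cauchy density of integral pi^2. *)
Lemma weighted_integral_le (s : R) (S : nat) (c1 c2 E : R) (g : R * R -> R) :
  `|s| <= S%:R -> measurable_fun setT g -> (forall xi, 0 <= g xi) ->
  (forall xi : R * R, g xi * ((1 + (xi.1 - c1) ^+ 2) * (1 + (xi.2 - c2) ^+ 2)) ^+ S.+1 <= E) ->
  (\int[mu \x mu]_xi ((1 + xi.1 ^+ 2 + xi.2 ^+ 2) `^ s * g xi)%:E <=
   (2 ^+ S * E * pi ^+ 2 * (1 + c1 ^+ 2 + c2 ^+ 2) `^ s)%:E)%E.
Proof.
move=> sS mg g0 gE; set B := (1 + c1 ^+ 2 + c2 ^+ 2) `^ s.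
have B0 : 0 <= B by exact: powR_ge0.
have E0 : 0 <= E.
  apply: le_trans (gE (0, 0)); apply: mulr_ge0 => //; apply: exprn_ge0.
  by apply: mulr_ge0; apply: addr_ge0 => //; exact: sqr_ge0.
pose D := 2 ^+ S * E * B.
have h2 : 0 <= (2 : R) ^+ S by exact: exprn_ge0.
have D0 : 0 <= D by exact: (mulr_ge0 (mulr_ge0 h2 E0) B0).
have mc (z1 z2 : R) : measurable_fun setT (fun z : R * R => (1 + (z.1 - z1) ^+ 2)^-1 * (1 + (z.2 - z2) ^+ 2)^-1).
  apply: measurable_funM.
    exact: (measurableT_comp (measurable_cauchy z1) measurable_fst).
  exact: (measurableT_comp (measurable_cauchy z2) measurable_snd).
have pos (x : R) : 0 < 1 + x ^+ 2 by rewrite ltr_pwDl// sqr_ge0.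
have P (xi : R * R) : (1 + xi.1 ^+ 2 + xi.2 ^+ 2) `^ s * g xi <=
    D * ((1 + (xi.1 - c1) ^+ 2)^-1 * (1 + (xi.2 - c2) ^+ 2)^-1).
  rewrite -invfM ler_pdivlMr ?mulr_gt0//.
  have H := peetre xi.1 xi.2 c1 c2 sS.
  have := gE xi; move: H; set Q := (1 + (xi.1 - c1) ^+ 2) * (1 + (xi.2 - c2) ^+ 2).
  have Q0 : 0 < Q by rewrite mulr_gt0.
  rewrite -/B => H1 H2; rewrite (@le_trans _ _ ((2 * Q) ^+ S * B * g xi * Q))//.
    by rewrite ler_wpM2r ?(ltW Q0)// ler_wpM2r.
  rewrite [leLHS](_ : _ = 2 ^+ S * B * (g xi * Q ^+ S.+1)); last by rewrite exprMn exprS; ring.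
  by rewrite /D [leRHS]mulrAC; apply: ler_wpM2l => //; exact: mulr_ge0.
apply: (@le_trans _ _ (\int[mu \x mu]_xi
   (D * ((1 + (xi.1 - c1) ^+ 2)^-1 * (1 + (xi.2 - c2) ^+ 2)^-1))%:E)%E).
  apply: ge0_le_integral => //.
  - by move=> xi _; rewrite lee_fin mulr_ge0// powR_ge0.
  - by apply/measurable_EFinP; apply: measurable_funM => //; exact: measurable_weight.
  - by apply/measurable_EFinP; apply: measurable_funM; [exact: measurable_cst|exact: mc].
  - by move=> xi _; rewrite lee_fin P.
under eq_integral do rewrite EFinM.
rewrite ge0_integralZl_EFin//; last 2 first.
- by move=> xi _; rewrite lee_fin mulr_ge0// invr_ge0 ltW.
- by apply/measurable_EFinP; exact: mc.
by rewrite integral_cauchy_plane -EFinM lee_fin /D mulrAC.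
Qed.

End WeightedBounds.

Section WaveNorms.
Context {R : realType}.
Notation mu := (@lebesgue_measure R).

Lemma cabs_wave_hat (lam c1 c2 p1 p2 : R) (beta : R -> R) xi : 0 <= lam ->
  (forall y, 0 <= beta y) ->
  cabs (wave_hat lam c1 c2 p1 p2 beta xi) = lam * (beta (xi.1 - c1) * beta (xi.2 - c2)).
Proof.
by move=> l0 b0; rewrite /wave_hat !cabsM !cabs_expi !cabs_real !ger0_norm ?mulr1.
Qed.

(** [C] precedes [n] and the centre: the decay away from the centre comes from the fixed boxes only.
    Squaring the transform yields 2 P powers of the offset weight, hence the condition relating [S]
    and [P]. *)
Lemma sobolev2_wave_le (s a : R) (S P : nat) : 0 < a -> `|s| <= S%:R -> (S.+1 <= 2 * P)%N ->
  exists2 C : R, 0 < C & forall (n : nat) (lam c1 c2 p1 p2 w : R) (b1 b2 : R -> R), 0 <= lam ->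
    spline p1 w (multiplier a P n) b1 -> spline p2 w (multiplier a P n) b2 ->
    (sobolev2 s (wave_distribution lam c1 c2 b1 b2) <=
      (C * (lam * (1 + c1 ^+ 2 + c2 ^+ 2) `^ (s / 2)))%:E)%E.
Proof.
move=> a0 sS SP; pose A : R := 1 + a ^- 2.
have A1 : 1 <= A by rewrite lerDl invr_ge0 sqr_ge0.
pose C2 : R := 2 ^+ S * (A ^+ (2 * P) * A ^+ (2 * P)) * pi ^+ 2.
have A0 : 0 < A by exact: lt_le_trans A1.
have C20 : 0 < C2 by rewrite !mulr_gt0 ?exprn_gt0 ?pi_gt0.
exists (Num.sqrt C2) => [|n lam c1 c2 p1 p2 w b1 b2 l0 sb1 sb2]; first by rewrite sqrtr_gt0.
have bet0 y := multiplier_ge0 a P n y.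
have mbet := measurable_multiplier a P n.
have hf := wave_has_fourier2 lam c1 c2 sb1 sb2 mbet.
set W := wave_hat _ _ _ _ _ _ in hf.
apply: (@le_trans _ _ ((\int[mu \x mu]_(xi in setT)
           ((1 + xi.1 ^+ 2 + xi.2 ^+ 2) `^ s * cabs (W xi) ^+ 2)%:E) `^ 2^-1)%E).
  by apply: ereal_inf_lbound; exists W.
apply: half_poweR_le.
- by apply: integral_ge0 => xi _; rewrite lee_fin mulr_ge0 ?powR_ge0 ?sqr_ge0.
- by rewrite mulr_ge0 ?sqrtr_ge0// mulr_ge0// powR_ge0.
apply: (le_trans (@weighted_integral_le _ s S c1 c2
   (lam ^+ 2 * (A ^+ (2 * P) * A ^+ (2 * P))) _ sS _ _ _)).
- by apply: measurable_funX; apply: measurable_cabs; exact: (hf.1).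
- by move=> xi; exact: sqr_ge0.
- move=> xi; rewrite cabs_wave_hat// exprMn -mulrA ler_wpM2l ?sqr_ge0//.
  have aux (y : R) : multiplier a P n y ^+ 2 * (1 + y ^+ 2) ^+ S.+1 <= A ^+ (2 * P).
    have y1 : 1 <= 1 + y ^+ 2 by rewrite lerDl sqr_ge0.
    rewrite (@le_trans _ _ (multiplier a P n y ^+ 2 * (1 + y ^+ 2) ^+ (2 * P)))//.
      by rewrite ler_wpM2l ?sqr_ge0// ler_weXn2l.
    rewrite mulnC !exprM -exprMn; apply: lerXn2r; rewrite ?nnegrE.
    + by rewrite mulr_ge0// exprn_ge0// (le_trans _ y1).
    + by rewrite exprn_ge0// (le_trans _ A1).
    + exact: multiplier_decay.
  have pos (y : R) : 0 <= (1 + y ^+ 2) ^+ S.+1 by rewrite exprn_ge0// addr_ge0// sqr_ge0.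
  move: (aux (xi.1 - c1)) (aux (xi.2 - c2)) (bet0 (xi.1 - c1)) (bet0 (xi.2 - c2)).
  move: (multiplier a P n (xi.1 - c1)) (multiplier a P n (xi.2 - c2)) => u v au av u0 v0.
  by rewrite !exprMn mulrACA; apply: ler_pM => //; rewrite mulr_ge0 ?sqr_ge0.
- rewrite lee_fin !exprMn sqr_sqrtr ?(ltW C20)//.
  rewrite [X in _ <= _ * (_ * X)](_ : _ = (1 + c1 ^+ 2 + c2 ^+ 2) `^ s).
    by rewrite /C2 le_eqVlt; apply/orP; left; apply/eqP; ring.
  by rewrite -[LHS]powR_mulrn ?powR_ge0// -powRrM divfK.
Qed.

(** The phase is opposite to the one in [wave_hat], so that pairing the two leaves a positive
    integral. *)
Definition gauss_packet (c p t : R) : R[i] :=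
  expi (p * (t - c)) * (expR (- (t - c) ^+ 2))%:C%C.

Definition test_packet (c1 c2 p1 p2 : R) (xi : R * R) : R[i] :=
  gauss_packet c1 p1 xi.1 * gauss_packet c2 p2 xi.2.

Lemma test_packet_schwartz c1 c2 p1 p2 : schwartz (test_packet c1 c2 p1 p2).
Proof.
apply: (@gauss_complex_schwartz _ c1 c2 p1 p2).
have Re_packet c p : gauss_class c p (fun t => complex.Re (gauss_packet c p t)).
  rewrite (_ : (fun t => _) = fun x => expR (- (x - c) ^+ 2) * cos (p * (x - c))).
    exact: gauss_cos.
  by apply/funext => t; rewrite complex_ReM/=; ring.
have Im_packet c p : gauss_class c p (fun t => complex.Im (gauss_packet c p t)).
  rewrite (_ : (fun t => _) = fun x => expR (- (x - c) ^+ 2) * sin (p * (x - c))).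
    exact: gauss_sin.
  by apply/funext => t; rewrite complex_ImM/=; ring.
split.
  have := gauss_add2 (gauss_tensor (Re_packet c1 p1) (Re_packet c2 p2))
    (gauss_tensor (gauss_scale (-1) (Im_packet c1 p1)) (Im_packet c2 p2)).
  rewrite (_ : (fun q => complex.Re (test_packet _ _ _ _ q)) = fun q => complex.Re (gauss_packet c1 p1 q.1) * complex.Re (gauss_packet c2 p2 q.2)
    + -1 * complex.Im (gauss_packet c1 p1 q.1) * complex.Im (gauss_packet c2 p2 q.2))//.
  by apply/funext => q; rewrite complex_ReM; ring.
have := gauss_add2 (gauss_tensor (Re_packet c1 p1) (Im_packet c2 p2))
  (gauss_tensor (Im_packet c1 p1) (Re_packet c2 p2)).
rewrite (_ : (fun q => complex.Im (test_packet _ _ _ _ q)) = fun q => complex.Re (gauss_packet c1 p1 q.1) * complex.Im (gauss_packet c2 p2 q.2)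
  + complex.Im (gauss_packet c1 p1 q.1) * complex.Re (gauss_packet c2 p2 q.2))//.
Qed.

Lemma gauss_le_cauchy (t : R) : expR (- t ^+ 2) <= (1 + t ^+ 2)^-1.
Proof.
by rewrite expRN lef_pV2 ?posrE ?expR_gt0 ?expR_ge1Dx// ltr_pwDl// sqr_ge0.
Qed.

Lemma integrable_multiplier_gauss a P n (c : R) :
  mu.-integrable setT (EFin \o (fun t : R => multiplier a P n (t - c) * expR (- (t - c) ^+ 2))).
Proof.
have mc : measurable_fun setT (fun t : R => t - c) by exact: measurable_funB.
apply: (le_integrable _ _ _ (integrable_cauchy c)) => //.
  apply/measurable_EFinP; apply: measurable_funM.
    exact: (measurableT_comp (measurable_multiplier a P n) mc).
  apply: measurableT_comp => //; apply: measurableT_comp => //.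
  exact: measurable_funX.
have Q (t : R) : `|multiplier a P n (t - c) * expR (- (t - c) ^+ 2)| <= `|(1 + (t - c) ^+ 2)^-1|.
  rewrite ger0_norm; last exact: (mulr_ge0 (multiplier_ge0 _ _ _ _) (expR_ge0 _)).
  rewrite ger0_norm; last by rewrite invr_ge0 addr_ge0// sqr_ge0.
  apply: le_trans (gauss_le_cauchy (t - c)).
  rewrite -[leRHS]mul1r; apply: ler_wpM2r; first exact: expR_ge0.
  exact: multiplier_le1.
by move=> t _; rewrite lee_fin; exact: Q.
Qed.

(** Only the interval [[c, c + 1]] is kept: there both factors have lower bounds independent of
    [n]. *)
Lemma Rintegral_multiplier_gauss_ge a P n (c : R) : 0 < a <= 2^-1 -> (0 < n)%N ->
  (7 / 8) ^+ (2 * P) / 2 * expR (- 1) <=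
  Rintegral mu setT (fun t : R => multiplier a P n (t - c) * expR (- (t - c) ^+ 2)).
Proof.
move=> a0 n0; set K := (7 / 8) ^+ (2 * P) / 2 * expR (- 1).
have -> : K = Rintegral mu setT (fun t => K * \1_`[c, c + 1]%classic t).
  have -> : (fun t : R => K * \1_`[c, c + 1]%classic t) = (cst K \_ `[c, c + 1]%classic).
    by apply/funext => t; rewrite patchE indicE; case: (t \in _); rewrite ?mulr1 ?mulr0.
  rewrite -Rintegral_mkcond Rintegral_cst//= lebesgue_measure_itv/= lte_fin ltrDl ltr01/=.
  by rewrite addrAC subrr add0r mulr1.
apply: le_Rintegral => //.
- exact: integrable_indic_cc.
- exact: integrable_multiplier_gauss.
have K0 : 0 <= (7 / 8 : R) ^+ (2 * P) / 2 by rewrite divr_ge0// exprn_ge0// divr_ge0.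
have Q (t : R) : K * \1_`[c, c + 1]%classic t <= multiplier a P n (t - c) * expR (- (t - c) ^+ 2).
  rewrite indicE; case: (boolP (t \in _)) => [|_]; last first.
    by rewrite mulr0 mulr_ge0 ?multiplier_ge0 ?expR_ge0.
  rewrite inE/= in_itv/= mulr1 => /andP[t0 t1].
  apply: ler_pM; rewrite ?expR_ge0//.
    by apply: multiplier_lower => //; apply/andP; split; lra.
  by rewrite ler_expR lerN2; nra.
by move=> t _; exact: Q.
Qed.

Lemma cintegral_wave_test (lam c1 c2 p1 p2 a : R) (P n : nat) :
  cintegral (mu \x mu)%E setT (fun xi => wave_hat lam c1 c2 p1 p2 (multiplier a P n) xi *
    test_packet c1 c2 p1 p2 xi) =
  (lam * (Rintegral mu setT (fun t : R => multiplier a P n (t - c1) * expR (- (t - c1) ^+ 2)) *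
          Rintegral mu setT (fun t : R => multiplier a P n (t - c2) * expR (- (t - c2) ^+ 2))))%:C%C.
Proof.
have i1 := cintegrable_real (integrable_multiplier_gauss a P n c1).
have i2 := cintegrable_real (integrable_multiplier_gauss a P n c2).
have E := cintegral_tensor i1 i2.
set I1 := Rintegral _ _ _ in E *; set I2 := Rintegral _ _ _ in E *.
have -> : (lam * (I1 * I2))%:C%C = lam%:C%C * (I1%:C%C * I2%:C%C) by rewrite !rmorphM.
rewrite /I1 /I2 -!cintegral_real -E -cintegralZl; last first.
  have := @cintegrable_kernel _ _ _ _ _ _ _ _ _ i1 i2 (fun=> 1) 1 (cmeasurable_cst _ _).
  by under eq_fun do rewrite mulr1; apply => z; rewrite cabs_real normr1.
have Q (xi : R * R) : wave_hat lam c1 c2 p1 p2 (multiplier a P n) xi * test_packet c1 c2 p1 p2 xi =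
   lam%:C%C * ((multiplier a P n (xi.1 - c1) * expR (- (xi.1 - c1) ^+ 2))%:C%C *
               (multiplier a P n (xi.2 - c2) * expR (- (xi.2 - c2) ^+ 2))%:C%C).
  rewrite /wave_hat /test_packet /gauss_packet -mulrA; congr (_ * _).
  have e1 (p y : R) : expi (- (p * y)) * expi (p * y) = 1 by rewrite -expiD addNr expi0.
  rewrite !rmorphM/=; move: (e1 p1 (xi.1 - c1)) (e1 p2 (xi.2 - c2)).
  move: (expi (- (p1 * _))) (expi (- (p2 * _))) (expi (p1 * _)) (expi (p2 * _)) => x1 x2 x3 x4 h1 h2.
  rewrite -[RHS]mul1r -[1 in RHS]mul1r -{1}h1 -h2; ring.
by apply: eq_cintegral => xi _; exact: Q.
Qed.

Lemma cabs_test_packet c1 c2 p1 p2 (xi : R * R) :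
  cabs (test_packet c1 c2 p1 p2 xi) = expR (- (xi.1 - c1) ^+ 2) * expR (- (xi.2 - c2) ^+ 2).
Proof.
by rewrite /test_packet /gauss_packet !cabsM !cabs_expi !cabs_real !mul1r !ger0_norm ?expR_ge0.
Qed.

Lemma gauss_sqr_decay (m : nat) (y : R) :
  expR (- y ^+ 2) ^+ 2 * (1 + y ^+ 2) ^+ m.+1 <= m.+1%:R ^+ m.+1.
Proof.
(* This is the (m+1)-st power of 1 + y^2 <= (m + 1) (1 + y^2 / (m + 1)) <= (m + 1) e^(y^2 / (m +
   1)). *)
have e2 : (1 + y ^+ 2) ^+ m.+1 <= m.+1%:R ^+ m.+1 * expR (y ^+ 2).
  have -> : expR (y ^+ 2) = expR (y ^+ 2 / m.+1%:R) ^+ m.+1.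
    by rewrite -expRM_natl mulrC divfK.
  rewrite -exprMn; apply: lerXn2r; rewrite ?nnegrE.
  - by rewrite addr_ge0// sqr_ge0.
  - by rewrite mulr_ge0// expR_ge0.
  apply: (@le_trans _ _ (m.+1%:R * (1 + y ^+ 2 / m.+1%:R))).
    by rewrite mulrDr mulr1 mulrC divfK// lerD2r ler1n.
  by rewrite ler_wpM2l// expR_ge1Dx.
have e1 : expR (- y ^+ 2) * expR (y ^+ 2) = 1 by rewrite -expRD addNr expR0.
have e0 := expR_ge0 (- y ^+ 2).
have e3 : expR (- y ^+ 2) <= 1 by rewrite -expR0 ler_expR lerNl oppr0 sqr_ge0.
apply: (@le_trans _ _ (expR (- y ^+ 2) ^+ 2 * (m.+1%:R ^+ m.+1 * expR (y ^+ 2)))).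
  by apply: ler_wpM2l => //; exact: sqr_ge0.
move: e0 e1 e3; move: (expR (- y ^+ 2)) (expR (y ^+ 2)) (exprn_ge0 m.+1 (ler0n R m.+1)).
move: (m.+1%:R ^+ m.+1) => z u v z0 u0 e1 u1.
rewrite (_ : u ^+ 2 * (z * v) = z * (u * v) * u); last by ring.
by rewrite e1 mulr1 ler_piMr.
Qed.

(* The norm is an infimum over all functions representing the Fourier transform;
   pairing any of them with a Gaussian packet of the same phase gives at least a
   multiple of [lam], and the weighted Cauchy-Schwarz inequality concludes. *)
Lemma sobolev2_wave_ge (s a : R) (S P : nat) : 0 < a <= 2^-1 -> `|s| <= S%:R ->
  exists2 c : R, 0 < c & forall (n : nat) (lam c1 c2 p1 p2 w : R) (b1 b2 : R -> R),
    0 < lam -> (0 < n)%N ->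
    spline p1 w (multiplier a P n) b1 -> spline p2 w (multiplier a P n) b2 ->
    ((c * (lam * (1 + c1 ^+ 2 + c2 ^+ 2) `^ (s / 2)))%:E <=
      sobolev2 s (wave_distribution lam c1 c2 b1 b2))%E.
Proof.
move=> a0 sS; pose k : R := (7 / 8) ^+ (2 * P) / 2 * expR (- 1).
have k0 : 0 < k by rewrite mulr_gt0 ?expR_gt0// divr_gt0// exprn_gt0// divr_gt0.
pose M : R := S.+1%:R ^+ S.+1; have M0 : 0 < M by exact: exprn_gt0.
pose D : R := 2 ^+ S * (M * M) * pi ^+ 2.
have D0 : 0 < D by rewrite !mulr_gt0 ?exprn_gt0 ?pi_gt0.
exists (k ^+ 2 / (2 * Num.sqrt D)) => [|n lam c1 c2 p1 p2 w b1 b2 l0 n0 sb1 sb2].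
  by rewrite divr_gt0 ?exprn_gt0// mulr_gt0// sqrtr_gt0.
have mbet := measurable_multiplier a P n.
have hf := wave_has_fourier2 lam c1 c2 sb1 sb2 mbet.
apply: le_ereal_inf_tmp => _ [g [mg hg] ->].
pose h := test_packet c1 c2 p1 p2.
have sh : schwartz h by exact: test_packet_schwartz.
have mh : cmeasurable h by exact: (smooth_cmeasurable sh.1).
set B := 1 + c1 ^+ 2 + c2 ^+ 2.
have B0 : 0 < B by rewrite ltr_pwDl ?sqr_ge0// ltr_pwDl ?sqr_ge0.
set X := (\int[mu \x mu]_(xi in setT) _)%E.
have X0 : (0 <= X)%E.
  by apply: integral_ge0 => xi _; rewrite lee_fin mulr_ge0 ?powR_ge0 ?sqr_ge0.
have low : lam * k ^+ 2 <= cabs (cintegral (mu \x mu)%E setT (fun xi => g xi * h xi)).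
  (* Both [g] and [wave_hat] pair with [h] to the value of the distribution at the transform of [h],
     so the pairing can be computed with [wave_hat]. *)
  rewrite -hg// hf.2// cintegral_wave_test cabs_real.
  have G c := Rintegral_multiplier_gauss_ge P c a0 n0.
  rewrite ger0_norm; last first.
    by rewrite mulr_ge0 ?(ltW l0)// mulr_ge0// (le_trans _ (G _))// ltW.
  by rewrite ler_wpM2l ?(ltW l0)// expr2; apply: ler_pM; rewrite ?(ltW k0)//; exact: G.
pose Y : R := D * B `^ (- s).
have Y0 : 0 < Y by rewrite mulr_gt0// powR_gt0.
have hY : (\int[mu \x mu]_xi ((1 + xi.1 ^+ 2 + xi.2 ^+ 2) `^ (- s) * cabs (h xi) ^+ 2)%:E <= Y%:E)%E.
  apply: (@weighted_integral_le _ (- s) S c1 c2 (M * M)).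
  - by rewrite normrN.
  - by apply: measurable_funX; exact: measurable_cabs.
  - by move=> xi; exact: sqr_ge0.
  - move=> xi; rewrite cabs_test_packet !exprMn mulrACA.
    have pos (y : R) : 0 <= expR (- y ^+ 2) ^+ 2 * (1 + y ^+ 2) ^+ S.+1.
      by rewrite mulr_ge0 ?sqr_ge0// exprn_ge0// addr_ge0// sqr_ge0.
    by apply: ler_pM => //; exact: gauss_sqr_decay.
(* With this weight in 2 u v <= t z u^2 + v^2 / (t z), the term [t^-1 * Y] is half of
   [lam * k ^+ 2]; the other half bounds [t * X] from below. *)
pose t : R := 2 * Y / (lam * k ^+ 2).
have lk0 : 0 < lam * k ^+ 2 by rewrite mulr_gt0// exprn_gt0.
have t0 : 0 < t by rewrite divr_gt0// mulr_gt0.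
have mw (r : R) (f : R * R -> R[i]) : cmeasurable f -> measurable_fun setT
    (fun xi : R * R => ((1 + xi.1 ^+ 2 + xi.2 ^+ 2) `^ r * cabs (f xi) ^+ 2)%:E).
  move=> mf; apply/measurable_EFinP; apply: measurable_funM; first exact: measurable_weight.
  by apply: measurable_funX; exact: measurable_cabs.
have w0 (r : R) (f : R * R -> R[i]) (xi : R * R) :
    0 <= (1 + xi.1 ^+ 2 + xi.2 ^+ 2) `^ r * cabs (f xi) ^+ 2.
  by rewrite mulr_ge0 ?powR_ge0 ?sqr_ge0.
have up : (2%:E * \int[mu \x mu]_x (cabs (g x * h x))%:E <= t%:E * X + t^-1%:E * Y%:E)%E.
  apply: (@le_trans _ _ (t%:E * X + t^-1%:E *
     (\int[mu \x mu]_xi ((1 + xi.1 ^+ 2 + xi.2 ^+ 2) `^ (- s) * cabs (h xi) ^+ 2)%:E))%E); last first.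
    by apply: leeD => //; apply: lee_wpmul2l => //; rewrite lee_fin invr_ge0 ltW.
  rewrite /X -!ge0_integralZl_EFin//; do ?[exact: mw | by rewrite ?invr_ge0 ltW
    | by move=> xi _; rewrite lee_fin]; last 2 first.
  - by move=> xi _; rewrite lee_fin cabs_ge0.
  - by apply/measurable_EFinP; apply: measurable_cabs; apply: cmeasurableM.
  rewrite -ge0_integralD//; last 4 first.
  - by move=> xi _; rewrite -EFinM lee_fin mulr_ge0// ltW.
  - by apply: measurable_funeM; exact: mw.
  - by move=> xi _; rewrite -EFinM lee_fin mulr_ge0// invr_ge0 ltW.
  - by apply: measurable_funeM; exact: mw.
  apply: ge0_le_integral => //.
  - by move=> xi _; rewrite -EFinM lee_fin mulr_ge0// cabs_ge0.
  - by apply: measurable_funeM; apply/measurable_EFinP; apply: measurable_cabs; exact: cmeasurableM.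
  - by apply: emeasurable_funD; apply: measurable_funeM; exact: mw.
  have Q (xi : R * R) : 2 * cabs (g xi * h xi) <=
      t * ((1 + xi.1 ^+ 2 + xi.2 ^+ 2) `^ s * cabs (g xi) ^+ 2) +
      t^-1 * ((1 + xi.1 ^+ 2 + xi.2 ^+ 2) `^ (- s) * cabs (h xi) ^+ 2).
    have z0 : 0 < 1 + xi.1 ^+ 2 + xi.2 ^+ 2 by rewrite ltr_pwDl ?sqr_ge0// ltr_pwDl ?sqr_ge0.
    rewrite cabsM powRN; have := powR_gt0 s z0.
    move: (_ `^ s) (cabs (g xi)) (cabs (h xi)) => z u v z_gt0.
    rewrite -subr_ge0 (_ : _ - _ = t^-1 * z^-1 * (t * z * u - v) ^+ 2); last first.
      by field; rewrite ?gt_eqF.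
    by rewrite mulr_ge0 ?sqr_ge0// mulr_ge0// invr_ge0 ltW.
  by move=> xi _; rewrite -!EFinM -EFinD lee_fin Q.
have main : ((lam * k ^+ 2)%:E <= t%:E * X + t^-1%:E * Y%:E)%E.
  apply: le_trans up; apply: le_trans (cabs_cintegral_ereal _ _); first by rewrite lee_fin.
  exact: cmeasurableM.
have y0 : 0 <= k ^+ 2 / (2 * Num.sqrt D) * (lam * B `^ (s / 2)).
  by rewrite mulr_ge0 ?divr_ge0 ?sqr_ge0 ?mulr_ge0 ?sqrtr_ge0 ?powR_ge0 ?(ltW l0).
apply: half_poweR_ge => //.
have Bs : (B `^ (s / 2)) ^+ 2 = B `^ s.
  by rewrite -[LHS]powR_mulrn ?powR_ge0// -powRrM divfK.
have -> : (k ^+ 2 / (2 * Num.sqrt D) * (lam * B `^ (s / 2))) ^+ 2 =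
    (k ^+ 2) ^+ 2 / (2 ^+ 2 * D) * (lam ^+ 2 * B `^ s).
  rewrite -Bs -[D in RHS](sqr_sqrtr (ltW D0)); have : 0 < Num.sqrt D by rewrite sqrtr_gt0.
  move: (Num.sqrt D) => q q0; move: (B `^ _) (k) => z k'.
  by field; rewrite gt_eqF.
move: main; move: X X0 {up} => [x| |]// x0 main; last by rewrite leey.
move: main; rewrite -!EFinM -EFinD !lee_fin -subr_ge0.
have -> : t * x + t^-1 * Y - lam * k ^+ 2 =
  t * (x - (k ^+ 2) ^+ 2 / (2 ^+ 2 * D) * (lam ^+ 2 * B `^ s)).
  rewrite /t /Y powRN; have := powR_gt0 s B0; move: (B `^ s) => z z0.
  by field; rewrite ?gt_eqF.
by rewrite pmulr_rge0// subr_ge0.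
Qed.

End WaveNorms.

(** * The cut-off Radon transform *)

Lemma cintegral_kernel_iterated {R : realType} d1 d2 (T1 : measurableType d1)
    (T2 : measurableType d2) (m1 : {sigma_finite_measure set T1 -> \bar R})
    (m2 : {sigma_finite_measure set T2 -> \bar R}) (a : T1 -> R[i]) (b : T2 -> R[i])
    (K : T1 * T2 -> R[i]) (B : R) : cintegrable m1 a -> cintegrable m2 b ->
  cmeasurable K -> (forall z, cabs (K z) <= B) ->
  cintegral (m1 \x m2)%E setT (fun z => a z.1 * b z.2 * K z) =
  cintegral m1 setT (fun x => a x * cintegral m2 setT (fun y => b y * K (x, y))).
Proof.
move=> ia ib mK KB; rewrite -cintegral_fubini; last exact: cintegrable_kernel KB.
apply: eq_cintegral => x _; rewrite -cintegralZl.
  by apply: eq_cintegral => y _; rewrite mulrA.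
apply: (@cintegrableMr _ _ _ _ b (fun y => K (x, y)) B ib) => [|y]; last exact: KB.
by apply: (cmeasurable_comp (h := fun y => (x, y))) => //; exact: measurable_pair1.
Qed.

Lemma continuous_cmeasurable1 {R : realType} (h : R -> R[i]) :
  continuous (fun x => complex.Re (h x)) -> continuous (fun x => complex.Im (h x)) ->
  cmeasurable h.
Proof. by move=> c1 c2; split; apply: continuous_measurable_fun. Qed.

Lemma schwartz1_cintegrable {R : realType} (h : R -> R[i]) : schwartz1 h ->
  cintegrable (@lebesgue_measure R) h.
Proof.
move=> [dh bh]; have [B hB] := bh 0%N 2%N.
have ig : (@lebesgue_measure R).-integrable setT (EFin \o (fun x : R => B * (1 + (x - 0) ^+ 2)^-1)).
  exact: (integrableZl measurableT B (integrable_cauchy (0 : R))).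
have Q (x : R) : 1 + x ^+ 2 <= (1 + `|x|) ^+ 2.
  by rewrite -(real_normK (num_real x)); have := normr_ge0 x; nra.
apply: (le_cintegrable _ ig).
- apply: continuous_cmeasurable1 => x.
    exact: (differentiable_continuous (iffLR (derivable1_diffP _ _) (dh 0%N x).1)).
  exact: (differentiable_continuous (iffLR (derivable1_diffP _ _) (dh 0%N x).2)).
- move=> x; rewrite subr0 ler_pdivlMr ?ltr_pwDl ?sqr_ge0// mulrC.
  by apply: le_trans (hB x); rewrite ler_wpM2r ?cabs_ge0//; exact: Q.
Qed.

Section CutTransform.
Context {R : realType}.
Notation mu := (@lebesgue_measure R).
Variables (lam c1 c2 p1 p2 w : R) (beta b1 b2 : R -> R).
Hypotheses (sb1 : spline p1 w beta b1) (sb2 : spline p2 w beta b2).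
Variable (kap : R -> R).
Hypotheses (ckap : continuous kap) (kap01 : forall x, 0 <= kap x <= 1).

Let wv := wave lam c1 c2 b1 b2.
Let iwv : cintegrable (mu \x mu)%E wv := cintegrable_wave lam c1 c2 sb1 sb2.

(** The formal transpose of f -> kap R f: the cutoff is moved onto the test function, in keeping
    with the definition of the Radon transform by duality. *)
Definition cut_transpose (psi : R * R -> R[i]) (x : R * R) : R[i] :=
  cintegral mu `[0, 2 * pi]%classic (fun phi =>
    (kap phi)%:C%C * psi (phi, x.1 * cos phi + x.2 * sin phi)).

Definition cut_radon (psi : R * R -> R[i]) : R[i] :=
  wave_distribution lam c1 c2 b1 b2 (cut_transpose psi).

(** The range of the angle is folded into the density, so that the exchange of integrals takes place
    over the whole line. *)
Definition angle_weight (phi : R) : R[i] := (\1_(`[0, 2 * pi]%classic) phi)%:C%C * (kap phi)%:C%C.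

Lemma cabs_angle_weight phi :
  cabs (angle_weight phi) = \1_(`[0, 2 * pi]%classic) phi * kap phi.
Proof.
rewrite /angle_weight cabsM !cabs_real ger0_norm// ger0_norm//.
by have /andP[] := kap01 phi.
Qed.

Lemma cintegrable_angle_weight : cintegrable mu angle_weight.
Proof.
apply: (le_cintegrable _ (integrable_indic_cc 0 (2 * pi) 1)).
- apply: cmeasurableM; apply: cmeasurable_real; first exact: measurable_indic.
  exact: continuous_measurable_fun.
- move=> x; rewrite cabs_angle_weight mul1r ler_piMr//.
  by have /andP[] := kap01 x.
Qed.

Lemma cut_transposeE psi x : cut_transpose psi x =
  cintegral mu setT (fun phi => angle_weight phi * psi (phi, x.1 * cos phi + x.2 * sin phi)).
Proof.
by rewrite /cut_transpose cintegral_mkcond; apply: eq_cintegral => phi _; rewrite mulrA.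
Qed.

Lemma measurable_projection :
  measurable_fun setT (fun z : (R * R) * R => z.1.1 * cos z.2 + z.1.2 * sin z.2).
Proof.
have mc : measurable_fun setT (fun z : (R * R) * R => cos z.2).
  apply: (measurableT_comp _ measurable_snd).
  by apply: continuous_measurable_fun; exact: continuous_cos.
have ms : measurable_fun setT (fun z : (R * R) * R => sin z.2).
  apply: (measurableT_comp _ measurable_snd).
  by apply: continuous_measurable_fun; exact: continuous_sin.
apply: measurable_funD; apply: measurable_funM => //.
  exact: (measurableT_comp measurable_fst measurable_fst).
exact: (measurableT_comp measurable_snd measurable_fst).
Qed.

Lemma cmeasurable_projection (psi : R * R -> R[i]) : cmeasurable psi ->
  cmeasurable (fun z : (R * R) * R => psi (z.2, z.1.1 * cos z.2 + z.1.2 * sin z.2)).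
Proof.
apply: (cmeasurable_comp (h := fun z : (R * R) * R => (z.2, z.1.1 * cos z.2 + z.1.2 * sin z.2))).
by apply: measurable_fun_pair; [exact: measurable_snd|exact: measurable_projection].
Qed.

Lemma cut_radon_joint psi (B : R) : cmeasurable psi -> (forall p, cabs (psi p) <= B) ->
  cut_radon psi = cintegral (prod_measure mu mu \x mu)%E setT
    (fun z => wv z.1 * angle_weight z.2 * psi (z.2, z.1.1 * cos z.2 + z.1.2 * sin z.2)).
Proof.
move=> mpsi psiB.
have E := @cintegral_kernel_iterated _ _ _ _ _ (prod_measure mu mu) mu wv angle_weight
  (fun z => psi (z.2, z.1.1 * cos z.2 + z.1.2 * sin z.2)) B iwv cintegrable_angle_weight
  (cmeasurable_projection mpsi) (fun z => psiB _).
  have P (x : R * R) : wave lam c1 c2 b1 b2 x * cut_transpose psi x = wv x * cintegral mu setT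
    (fun phi => angle_weight phi * psi (phi, x.1 * cos phi + x.2 * sin phi)).
    by rewrite cut_transposeE.
apply: etrans (esym E).
by apply: eq_cintegral => x _; exact: P.
Qed.

Lemma cintegrable_cut_joint psi (B : R) : cmeasurable psi -> (forall p, cabs (psi p) <= B) ->
  cintegrable (prod_measure mu mu \x mu)%E
    (fun z => wv z.1 * angle_weight z.2 * psi (z.2, z.1.1 * cos z.2 + z.1.2 * sin z.2)).
Proof.
move=> mpsi psiB.
apply: (@cintegrable_kernel _ _ _ _ _ (prod_measure mu mu) mu _ _ iwv cintegrable_angle_weight
  (fun z => psi (z.2, z.1.1 * cos z.2 + z.1.2 * sin z.2)) B) => //.
exact: cmeasurable_projection.
Qed.

Lemma cylinder_schwartz_bounded (f : R * R -> R[i]) : cylinder_schwartz f ->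
  cmeasurable f /\ exists B, forall p, cabs (f p) <= B.
Proof.
move=> [sf _ rf]; split; first exact: smooth_cmeasurable.
have [B fB] := rf 0%N; exists B => p.
by have := fB [::] p erefl; rewrite expr0 mul1r.
Qed.

Lemma cut_radon_tempered : cylinder_tempered cut_radon.
Proof.
split.
  move=> a f g /cylinder_schwartz_bounded[mf [F fF]] /cylinder_schwartz_bounded[mg [G gG]].
  have mafg : cmeasurable (fun p => a * f p + g p).
    by apply: cmeasurableD => //; apply: cmeasurableM => //; exact: cmeasurable_cst.
  rewrite (cut_radon_joint (B := cabs a * F + G) mafg); last first.
    by move=> p; rewrite (le_trans (cabsD _ _))// lerD// cabsM ler_wpM2l// cabs_ge0.
  rewrite (cut_radon_joint mf fF) (cut_radon_joint mg gG).
  have I := cintegrable_cut_joint mf fF; have J := cintegrable_cut_joint mg gG.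
  rewrite -(cintegralZl a I) -(cintegralD (cintegrableZl a I) J).
  by apply: eq_cintegral => z _; rewrite mulrDr mulrCA.
pose A (z : (R * R) * R) := cabs (wv z.1 * angle_weight z.2).
have iA : (prod_measure mu mu \x mu)%E.-integrable setT (EFin \o A).
  have := @cintegrable_kernel _ _ _ _ _ (prod_measure mu mu) mu _ _ iwv cintegrable_angle_weight
    (fun=> 1) 1 (cmeasurable_cst _ _).
  move=> /(_ _)/integrable_cabs; rewrite /A.
  by under eq_fun do rewrite mulr1; apply => z; rewrite cabs_real normr1.
exists (2 * Rintegral (prod_measure mu mu \x mu)%E setT A), 0%N => f B cf fB.
have [mf _] := cylinder_schwartz_bounded cf.
have {}fB p : cabs (f p) <= B by have := fB [::] p erefl; rewrite expr0 mul1r.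
rewrite (cut_radon_joint mf fB).
have H (z : (R * R) * R) : cabs (wv z.1 * angle_weight z.2 *
    f (z.2, z.1.1 * cos z.2 + z.1.2 * sin z.2)) <= B * A z.
  by rewrite cabsM mulrC ler_wpM2r// cabs_ge0.
apply: le_trans (cabs_cintegral_le (cintegrable_cut_joint mf fB) (integrableZl measurableT B iA) H) _.
by rewrite RintegralZl// mulrCA mulrC.
Qed.

Definition cut_kernel (k : int) (s : R) (z : (R * R) * R) : R[i] :=
  expi (- (k%:~R * z.2)) * expi (- (s * (z.1.1 * cos z.2 + z.1.2 * sin z.2))).

(** Taken as a joint integral over position and angle because both orders of integration are
    exploited, each for one of the two bounds. *)
Definition cut_hat (k : int) (s : R) : R[i] := cintegral (prod_measure mu mu \x mu)%E setT
  (fun z => wv z.1 * angle_weight z.2 * cut_kernel k s z).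

Lemma cmeasurable_phase (k : int) :
  cmeasurable (fun z : (R * R) * R => expi (- (k%:~R * z.2))).
Proof.
apply: cmeasurable_expi; apply: measurableT_comp => //; apply: measurable_funM => //.
Qed.

Lemma cmeasurable_cut_kernel (k : int) (s : R) : cmeasurable (cut_kernel k s).
Proof.
apply: cmeasurableM; first exact: cmeasurable_phase.
apply: cmeasurable_expi; apply: measurableT_comp => //; apply: measurable_funM => //.
exact: measurable_projection.
Qed.

Lemma cabs_cut_kernel k s z : cabs (cut_kernel k s z) <= 1.
Proof. by rewrite cabsM !cabs_expi mulr1. Qed.

(* Integrating over the angle first exposes the decay in [k] ... *)
Lemma cut_hat_space k s : cut_hat k s =
  cintegral (mu \x mu)%E setT (fun x => wv x * cintegral mu `[0, 2 * pi]%classic (fun phi =>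
    (kap phi)%:C%C * expi (- (k%:~R * phi)) * expi (- (s * (x.1 * cos phi + x.2 * sin phi))))).
Proof.
rewrite /cut_hat (@cintegral_kernel_iterated _ _ _ _ _ (prod_measure mu mu) mu wv angle_weight
  (cut_kernel k s) 1 iwv cintegrable_angle_weight (cmeasurable_cut_kernel k s) (cabs_cut_kernel k s)).
have P (x : R * R) : wv x * cintegral mu setT (fun phi => angle_weight phi * cut_kernel k s (x, phi)) =
    wv x * cintegral mu `[0, 2 * pi]%classic (fun phi =>
    (kap phi)%:C%C * expi (- (k%:~R * phi)) * expi (- (s * (x.1 * cos phi + x.2 * sin phi)))).
  congr (_ * _); rewrite [RHS]cintegral_mkcond; apply: eq_cintegral => phi _.
  by rewrite /angle_weight /cut_kernel/= !mulrA.
by apply: eq_cintegral => x _; exact: P.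
Qed.

(* ... and integrating over the plane first is the Fourier slice theorem. *)
Lemma cut_hat_angle k s : cut_hat k s = cintegral mu setT (fun phi =>
  angle_weight phi * (expi (- (k%:~R * phi)) *
    wave_hat lam c1 c2 p1 p2 beta (s * cos phi, s * sin phi))).
Proof.
rewrite /cut_hat (@cintegral_kernel_iterated _ _ _ _ _ (prod_measure mu mu) mu wv angle_weight
  (cut_kernel k s) 1 iwv cintegrable_angle_weight (cmeasurable_cut_kernel k s) (cabs_cut_kernel k s)).
rewrite (@cintegral_kernel_swap _ _ _ _ _ (prod_measure mu mu) mu wv angle_weight iwv
  cintegrable_angle_weight (cut_kernel k s) 1 (cmeasurable_cut_kernel k s) (cabs_cut_kernel k s)).
have P (phi : R) : angle_weight phi * cintegral (mu \x mu)%E setT (fun x => wv x * cut_kernel k s (x, phi)) =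
    angle_weight phi * (expi (- (k%:~R * phi)) *
    wave_hat lam c1 c2 p1 p2 beta (s * cos phi, s * sin phi)).
  congr (_ * _); rewrite -(fourier_wave lam c1 c2 sb1 sb2) -cintegralZl; last first.
    apply: (cintegrableMr (B := 1) iwv) => [|x]; last by rewrite cabs_expi.
    apply: cmeasurable_expi; apply: measurableT_comp => //.
    by apply: measurable_funD; apply: measurable_funM => //.
  have Q (x : R * R) : wv x * cut_kernel k s (x, phi) = expi (- (k%:~R * phi)) *
     (wave lam c1 c2 b1 b2 x * expi (- (s * cos phi * x.1 + s * sin phi * x.2))).
    rewrite /cut_kernel/= mulrCA; congr (_ * (_ * expi (- _))); ring.
  by apply: eq_cintegral => x _; exact: Q.
by apply: eq_cintegral => phi _; exact: P.
Qed.

(** The phase in [k] joins the density in position and angle, and the only coupling left with the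
    radial frequency is the bounded exponential kernel. *)
Lemma cut_radon_has_fourier : cylinder_has_fourier cut_radon cut_hat.
Proof.
move=> k; split.
  apply: (@cmeasurable_cintegral_param _ _ _ _ _ (prod_measure (prod_measure mu mu) mu)
    (fun y : R * ((R * R) * R) => wv y.2.1 * angle_weight y.2.2 * cut_kernel k y.1 y.2)).
  apply: cmeasurableM; first apply: cmeasurableM.
  - exact: (cmeasurable_comp (measurableT_comp measurable_fst measurable_snd)
      (cintegrable_cmeasurable iwv)).
  - exact: (cmeasurable_comp (measurableT_comp measurable_snd measurable_snd)
      (cintegrable_cmeasurable cintegrable_angle_weight)).
  apply: cmeasurableM.
    exact: (cmeasurable_comp measurable_snd (cmeasurable_phase k)).
  apply: cmeasurable_expi; apply: measurableT_comp => //; apply: measurable_funM.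
    exact: measurable_fst.
  exact: (measurableT_comp measurable_projection measurable_snd).
move=> h sh; have ih := schwartz1_cintegrable sh.
have mK : cmeasurable (fun y : R * R => expi (- (y.2 * y.1))).
  apply: cmeasurable_expi; apply: measurableT_comp => //; apply: measurable_funM.
    exact: measurable_snd.
  exact: measurable_fst.
have mF : cmeasurable (fourier1 h).
  apply: (@cmeasurable_cintegral_param _ _ _ _ _ mu
    (fun y : R * R => h y.2 * expi (- (y.2 * y.1)))).
  apply: cmeasurableM => //.
  exact: (cmeasurable_comp measurable_snd (cintegrable_cmeasurable ih)).
have FB s : cabs (fourier1 h s) <= 2 * Rintegral mu setT (fun s => cabs (h s)).
  apply: cabs_cintegral_le; last by move=> x; rewrite cabsM cabs_expi mulr1.
    apply: (cintegrableMr (B := 1) ih) => [|x]; last by rewrite cabs_expi.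
    by apply: cmeasurable_expi; apply: measurableT_comp => //; apply: measurable_funM.
  exact: integrable_cabs.
set BF := 2 * _ in FB.
rewrite (cut_radon_joint (B := BF)); last first.
- by move=> p; rewrite cabsM cabs_expi mul1r.
- apply: cmeasurableM.
    apply: cmeasurable_expi; apply: measurableT_comp => //; apply: measurable_funM => //.
  exact: (cmeasurable_comp measurable_snd mF).
pose A (z : (R * R) * R) := wv z.1 * angle_weight z.2 * expi (- (k%:~R * z.2)).
have iA : cintegrable (prod_measure (prod_measure mu mu) mu) A.
  apply: (@cintegrable_kernel _ _ _ _ _ (prod_measure mu mu) mu _ _ iwv cintegrable_angle_weight
    (fun z => expi (- (k%:~R * z.2))) 1); last by move=> z; rewrite cabs_expi.
  exact: cmeasurable_phase.
pose K (y : ((R * R) * R) * R) : R[i] :=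
  expi (- (y.2 * (y.1.1.1 * cos y.1.2 + y.1.1.2 * sin y.1.2))).
have := @cintegral_kernel_swap _ _ _ _ _ (prod_measure (prod_measure mu mu) mu) mu A h iA ih K 1.
move=> /(_ _ _) E.
transitivity (cintegral (prod_measure (prod_measure mu mu) mu) setT
    (fun x => A x * cintegral mu setT (fun y => h y * K (x, y)))).
  by apply: eq_cintegral => z _; rewrite /A -!mulrA.
rewrite E.
- apply: eq_cintegral => s _; rewrite mulrC; congr (_ * _).
  by apply: eq_cintegral => z _; rewrite /A -!mulrA.
- apply: cmeasurable_expi; apply: measurableT_comp => //; apply: measurable_funM.
    exact: measurable_snd.
  exact: (measurableT_comp measurable_projection measurable_fst).
- by move=> y; rewrite cabs_expi.
Qed.

End CutTransform.

Section CutBounds.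
Context {R : realType}.
Notation mu := (@lebesgue_measure R).

Lemma esum_le_scale (D : R) (a : int -> \bar R) : 0 < D ->
  (forall k, 0 <= a k <= (D * (1 + k%:~R ^+ 2)^-1)%:E)%E ->
  (\esum_(k in [set: int]) a k <= (D * 8)%:E)%E.
Proof.
move=> D0 aD; pose b k := ((D^-1)%:E * a k)%E.
have b0 k : (0 <= b k)%E.
  by rewrite mule_ge0 ?lee_fin ?invr_ge0 ?(ltW D0)//; have /andP[] := aD k.
have Eb k : a k = (D%:E * b k)%E by rewrite muleA -EFinM divff ?gt_eqF// mul1e.
have b8 : (\esum_(k in [set: int]) b k <= 8%:E)%E.
  apply: esum_cauchy_int => k; rewrite b0/= /b.
  apply: (@le_trans _ _ ((D^-1)%:E * (D * (1 + k%:~R ^+ 2)^-1)%:E)%E).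
    by apply: lee_wpmul2l; [rewrite lee_fin invr_ge0 ltW|have /andP[] := aD k].
  by rewrite -EFinM lee_fin mulrA mulVf ?gt_eqF// mul1r.
apply: ge_ereal_sup => _ [F /= Fs <-].
rewrite (eq_fsbigr (fun k => D%:E * b k)%E) => [|k _]; last exact: Eb.
rewrite -ge0_mule_fsumr// EFinM; apply: lee_wpmul2l; first by rewrite lee_fin ltW.
by apply: le_trans b8; apply: esum_ge; exists F.
Qed.

Lemma powR_le_exp (b s : R) (S : nat) : 1 <= b -> `|s| <= S%:R -> b `^ s <= b ^+ S.
Proof.
move=> b1 sS; rewrite -powR_mulrn ?(le_trans _ b1)//.
by apply: ler_powR => //; exact: le_trans (ler_norm s) sS.
Qed.

(** The Sobolev weight is at most the S-th power of (1 + k^2) (1 + t^2). The one remaining power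
    makes the integral in [t] at most pi and the sum over [k] at most 8, up to D^2. *)
Lemma cylinder_sobolev_le (s D : R) (S : nat) v g : `|s| <= S%:R -> 0 < D ->
  cylinder_has_fourier v g ->
  (forall k t, cabs (g k t) ^+ 2 * ((1 + k%:~R ^+ 2) * (1 + t ^+ 2)) ^+ S.+1 <= D ^+ 2) ->
  (cylinder_sobolev s v <= (D * Num.sqrt (pi * 8))%:E)%E.
Proof.
move=> sS D0 hg gD.
apply: (@le_trans _ _ ((\esum_(k in [set: int])
           \int[mu]_(sigma in setT)
             ((1 + k%:~R ^+ 2 + sigma ^+ 2) `^ s * cabs (g k sigma) ^+ 2)%:E)
         `^ 2^-1)%E).
  by apply: ereal_inf_lbound; exists g.
have pos (x : R) : 1 <= 1 + x ^+ 2 by rewrite lerDl sqr_ge0.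
have pos' (x : R) : 0 < 1 + x ^+ 2 by exact: lt_le_trans (pos x).
have nn k t : 0 <= (1 + k%:~R ^+ 2 + t ^+ 2) `^ s * cabs (g k t) ^+ 2.
  by rewrite mulr_ge0 ?powR_ge0 ?sqr_ge0.
have i0 k : (0 <= \int[mu]_sigma
    ((1 + k%:~R ^+ 2 + sigma ^+ 2) `^ s * cabs (g k sigma) ^+ 2)%:E)%E.
  by apply: integral_ge0 => t _; rewrite lee_fin nn.
apply: half_poweR_le.
- by apply: esum_ge0 => k _; exact: i0.
- by rewrite mulr_ge0 ?sqrtr_ge0 ?(ltW D0).
rewrite exprMn sqr_sqrtr ?mulr_ge0 ?pi_ge0// mulrA.
apply: esum_le_scale => [|k]; first by rewrite mulr_gt0 ?exprn_gt0 ?pi_gt0.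
rewrite i0/=; set q := (1 + k%:~R ^+ 2)^-1.
have q0 : 0 < q by rewrite invr_gt0.
have P (t : R) : (1 + k%:~R ^+ 2 + t ^+ 2) `^ s * cabs (g k t) ^+ 2 <=
    D ^+ 2 * q * (1 + (t - 0) ^+ 2)^-1.
  have w1 : (1 + k%:~R ^+ 2 + t ^+ 2) `^ s <= ((1 + k%:~R ^+ 2) * (1 + t ^+ 2)) ^+ S.
    have h1 : 1 <= 1 + k%:~R ^+ 2 + t ^+ 2 by rewrite -addrA lerDl addr_ge0 ?sqr_ge0.
    apply: le_trans (powR_le_exp h1 sS) _; apply: lerXn2r; rewrite ?nnegrE.
    + exact: le_trans h1.
    + by rewrite mulr_ge0 ?(ltW (pos' _)).
    + by rewrite mulrDr mulr1 lerD2l mulrDl mul1r lerDl mulr_ge0 ?sqr_ge0.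
  rewrite subr0 -mulrA -invfM ler_pdivlMr ?mulr_gt0//.
  apply: le_trans (gD k t).
  move: w1 (gD k t); set Q := (1 + _) * (1 + _) => w1 _.
  have Q0 : 0 < Q by rewrite mulr_gt0.
  have -> : cabs (g k t) ^+ 2 * Q ^+ S.+1 = cabs (g k t) ^+ 2 * Q ^+ S * Q.
    by rewrite -[RHS]mulrA -exprSr.
  apply: ler_wpM2r; first exact: ltW.
  by rewrite mulrC; apply: ler_wpM2l => //; exact: sqr_ge0.
have mg : measurable_fun setT (fun t : R => (1 + k%:~R ^+ 2 + t ^+ 2) `^ s * cabs (g k t) ^+ 2).
  apply: measurable_funM; last by apply: measurable_funX; apply: measurable_cabs; exact: (hg k).1.
  apply: (measurableT_comp (measurable_powR s)).
  by apply: measurable_funD => //; exact: measurable_funX.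
apply: (@le_trans _ _ (\int[mu]_t (D ^+ 2 * q * (1 + (t - 0) ^+ 2)^-1)%:E)%E).
  apply: ge0_le_integral => //.
  - by move=> t _; rewrite lee_fin nn.
  - exact/measurable_EFinP.
  - apply/measurable_EFinP; apply: measurable_funM => //; exact: measurable_cauchy.
  - by move=> t _; rewrite lee_fin P.
under eq_integral do rewrite EFinM.
rewrite ge0_integralZl_EFin//; last 3 first.
- by move=> t _; rewrite lee_fin invr_ge0 (ltW (pos' _)).
- by apply/measurable_EFinP; exact: measurable_cauchy.
- by rewrite mulr_ge0 ?sqr_ge0 ?(ltW q0).
by rewrite integral_cauchy -EFinM lee_fin mulrAC.
Qed.

(* The cross products of the frequency offset with the directions of [phi0] and
   [phi] are [s * sin (phi - phi0)] and [N * sin (phi - phi0)], so one coordinate of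
   the offset has size at least [r * (N + `|s|) / 4]. *)
Lemma wave_hat_small (a r phi0 phi s lam p1 p2 N : R) (P n : nat) :
  0 < a <= 2^-1 -> 0 < r <= 1 -> 0 <= lam -> (0 < n)%N -> r ^+ 2 <= sin (phi - phi0) ^+ 2 ->
  N = 4 * expR 1 / (a * r) * n%:R ->
  cabs (wave_hat lam (N * cos phi0) (N * sin phi0) p1 p2 (multiplier a P n) (s * cos phi, s * sin phi))
    * (1 + s ^+ 2) ^+ P <= lam * ((a * r / 4) ^- (2 * P) * expR (- n%:R) ^+ 2).
Proof.
move=> /andP[a0 a1] /andP[r0 r1] l0 n0 sr NK.
have n1 : 1 <= n%:R :> R by rewrite ler1n.
have e2 : 2 <= expR 1 :> R by have := @expR_ge1Dx R 1; rewrite -natr1.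
have ar0 : 0 < a * r by exact: mulr_gt0.
(* The factor 4 e / (a r) in [N] is chosen for this identity: it gives a E >= e n for the offset
   size [E], as [multiplier_small] requires. *)
have NE : a * r / 4 * N = expR 1 * n%:R by rewrite NK; field; rewrite !gt_eqF.
have N0 : 0 < N by rewrite NK !mulr_gt0 ?invr_gt0 ?expR_gt0// (lt_le_trans _ n1).
have N1 : 1 <= N.
  have h : 2 <= expR 1 * n%:R :> R by rewrite (le_trans e2)// ler_peMr// expR_ge0.
  have h2 : a * r <= 1 by nra.
  by rewrite -NE in h; nra.
pose E := r * (N + `|s|) / 4.
have E0 : 0 < E by rewrite divr_gt0// mulr_gt0// ltr_pwDl.
have aE : expR 1 * n%:R <= a * E.
  rewrite -NE /E [leRHS](_ : _ = a * r / 4 * (N + `|s|)); last by ring.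
  by rewrite ler_pM2l ?divr_gt0// lerDl.
rewrite cabs_wave_hat//; last by move=> y; exact: multiplier_ge0.
set y1 := _ - _; set y2 := _ - _.
have rs : r <= `|sin (phi - phi0)|.
  by rewrite -(ger0_norm (ltW r0)) -ler_sqr ?nnegrE ?normr_ge0// !real_normK ?num_real.
have cross (u v x1 x2 : R) : `|u| <= 1 -> `|v| <= 1 -> `|u * x1 + v * x2| <= `|x1| + `|x2|.
  move=> u1 v1; rewrite (le_trans (ler_normD _ _))// !normrM.
  by rewrite lerD// ler_piMl.
have big : 2 * E <= `|y1| + `|y2|.
  have X1 : r * `|s| <= `|y1| + `|y2|.
    have -> : r * `|s| = `|s| * r by rewrite mulrC.
    apply: (@le_trans _ _ (`|s| * `|sin (phi - phi0)|)); first by rewrite ler_wpM2l.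
    rewrite -normrM [X in `|X|](_ : _ = - sin phi0 * y1 + cos phi0 * y2); last first.
      by rewrite sinB /y1 /y2/=; ring.
    by apply: cross; rewrite ?normrN ler_norml ?cos_geN1 ?cos_le1 ?sin_geN1 ?sin_le1.
  have X2 : r * N <= `|y1| + `|y2|.
    rewrite mulrC; apply: (@le_trans _ _ (N * `|sin (phi - phi0)|)); first by rewrite ler_pM2l.
    rewrite -{1}(ger0_norm (ltW N0)) -normrM.
    rewrite [X in `|X|](_ : _ = - sin phi * y1 + cos phi * y2); last first.
      by rewrite sinB /y1 /y2/=; ring.
    by apply: cross; rewrite ?normrN ler_norml ?cos_geN1 ?cos_le1 ?sin_geN1 ?sin_le1.
  by rewrite /E; move: X1 X2; rewrite mulrDr; lra.
have sm (y : R) : E <= `|y| ->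
    multiplier a P n y <= (a * E) ^- (2 * P) * expR (- n%:R) ^+ 2.
  by move=> yE; exact: multiplier_small.
have m0 y := multiplier_ge0 a P n y; have m1 y := multiplier_le1 a P n y.
have prod : multiplier a P n y1 * multiplier a P n y2 <= (a * E) ^- (2 * P) * expR (- n%:R) ^+ 2.
  (* Since |y1| + |y2| >= 2 E, one coordinate is at least [E] and makes its factor small; the other
     factor is at most 1. *)
  have [h|h] := leP E `|y1|.
    by apply: le_trans (sm _ h); rewrite ler_piMr.
  by apply: le_trans (sm y2 _); [rewrite ler_piMl|lra].
rewrite -mulrA ler_wpM2l//.
apply: (@le_trans _ _ ((a * E) ^- (2 * P) * expR (- n%:R) ^+ 2 * (1 + s ^+ 2) ^+ P)).
  by rewrite ler_wpM2r// exprn_ge0// addr_ge0// sqr_ge0.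
rewrite mulrAC ler_wpM2r ?sqr_ge0// /E.
rewrite (_ : a * _ = (a * r / 4) * (N + `|s|)); last by ring.
have : 0 <= a * r / 4 by rewrite divr_ge0// ltW.
move: (a * r / 4) => u u0.
have -> : (u * (N + `|s|)) ^- (2 * P) = u ^- (2 * P) * (N + `|s|) ^- (2 * P).
  by rewrite exprMn invfM.
(* The factor (N + |s|)^(-2P) retained from the fixed boxes absorbs the weight, as 1 + s^2 <= (N +
   |s|)^2 for N >= 1. *)
rewrite -mulrA ler_piMr//; first by rewrite invr_ge0 exprn_ge0.
rewrite mulrC ler_pdivrMr ?mul1r; last by rewrite exprn_gt0// ltr_pwDl.
rewrite exprM; apply: lerXn2r; rewrite ?nnegrE ?sqr_ge0//.
  by rewrite addr_ge0// sqr_ge0.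
by rewrite -(real_normK (num_real s)); have := normr_ge0 s; nra.
Qed.

End CutBounds.

Section CutHatBounds.
Context {R : realType}.
Notation mu := (@lebesgue_measure R).
Variables (lam c1 c2 p1 p2 w : R) (beta b1 b2 : R -> R).
Hypotheses (l0 : 0 <= lam) (sb1 : spline p1 w beta b1) (sb2 : spline p2 w beta b2).
Variable (kap : R -> R).
Hypotheses (ckap : continuous kap) (kap01 : forall x, 0 <= kap x <= 1).

(** The splines are non-negative and [beta 0] is their total mass, so the modulus of the packet is
    [lam] times a probability density. *)
Lemma Rintegral_cabs_wave : beta 0 = 1 ->
  Rintegral (mu \x mu)%E setT (fun x : R * R => cabs (wave lam c1 c2 b1 b2 x)) = lam.
Proof.
move=> beta0.
have P (x : R * R) : (cabs (wave lam c1 c2 b1 b2 x))%:C%C =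
    lam%:C%C * ((b1 x.1)%:C%C * (b2 x.2)%:C%C).
  have [_ [B1 hB1] _ _] := sb1; have [_ [B2 hB2] _ _] := sb2.
  have /andP[b10 _] := hB1 x.1; have /andP[b20 _] := hB2 x.2.
  by rewrite /wave /modulated !cabsM !cabs_expi !cabs_real !mulr1 !ger0_norm// !rmorphM.
have one (c : R) (b : R -> R) : spline c w beta b -> cintegral mu setT (fun t => (b t)%:C%C) = 1.
  move=> sb; have [_ _ _ /(_ 0)] := sb; rewrite beta0 mulr0 oppr0 expi0 mul1r => <-.
  have Q (t : R) : (b t)%:C%C = (b t)%:C%C * expi (- (t * 0)) by rewrite mulr0 oppr0 expi0 mulr1.
  by apply: eq_cintegral => t _; exact: Q.
have i1 := cintegrable_real (spline_integrable sb1).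
have i2 := cintegrable_real (spline_integrable sb2).
suff : (Rintegral (mu \x mu)%E setT (fun x : R * R => cabs (wave lam c1 c2 b1 b2 x)))%:C%C = lam%:C%C.
  by case.
rewrite -cintegral_real.
transitivity (cintegral (mu \x mu)%E setT (fun x : R * R => lam%:C%C * ((b1 x.1)%:C%C * (b2 x.2)%:C%C))).
  by apply: eq_cintegral => x _; exact: P.
rewrite cintegralZl; last first.
  have := @cintegrable_kernel _ _ _ _ _ _ _ _ _ i1 i2 (fun=> 1) 1 (cmeasurable_cst _ _).
  by under eq_fun do rewrite mulr1; apply => z; rewrite cabs_real normr1.
by rewrite (cintegral_tensor i1 i2) (one _ _ sb1) (one _ _ sb2) !mulr1.
Qed.

(** Read off the slice form, where only angles with [kap phi != 0] count; 4 pi is the length 2 pi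
    times the 2 lost by treating real and imaginary parts separately. *)
Lemma cut_hat_le (k : int) (s E : R) : measurable_fun setT beta -> 0 <= E ->
  (forall phi, kap phi != 0 ->
     cabs (wave_hat lam c1 c2 p1 p2 beta (s * cos phi, s * sin phi)) <= E) ->
  cabs (cut_hat lam c1 c2 b1 b2 kap k s) <= 4 * pi * E.
Proof.
move=> mbeta E0 hE; rewrite (cut_hat_angle _ _ _ sb1 sb2 ckap kap01) -lee_fin.
have mf : cmeasurable (fun phi : R => angle_weight kap phi * (expi (- (k%:~R * phi)) *
    wave_hat lam c1 c2 p1 p2 beta (s * cos phi, s * sin phi))).
  apply: cmeasurableM; first exact: (cintegrable_cmeasurable (cintegrable_angle_weight ckap kap01)).
  apply: cmeasurableM.
    by apply: cmeasurable_expi; apply: measurableT_comp => //; exact: measurable_funM.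
  apply: (cmeasurable_comp _ (cmeasurable_wave_hat lam c1 c2 p1 p2 mbeta)).
  apply: measurable_fun_pair; apply: measurable_funM => //; apply: continuous_measurable_fun.
    exact: continuous_cos.
  exact: continuous_sin.
apply: (le_trans (@cabs_cintegral_ereal _ _ _ mu _ mf)).
have I : (\int[mu]_phi (E * \1_(`[0, 2 * pi]%classic) phi)%:E = (E * (2 * pi))%:E)%E.
  under eq_integral do rewrite EFinM.
  rewrite ge0_integralZl_EFin//; last by apply/measurable_EFinP; exact: measurable_indic.
  rewrite (integral_indic mu measurableT (measurable_itv `[0, 2 * pi])) setIT/= lebesgue_measure_itv/= lte_fin mulr_gt0 ?pi_gt0//.
  by rewrite -EFinD subr0 EFinM.
have -> : (4 * pi * E)%:E = (2%:E * (E * (2 * pi))%:E)%E.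
  by rewrite -EFinM; congr (_%:E); ring.
rewrite -I; apply: lee_wpmul2l => //; apply: ge0_le_integral => //.
- by move=> phi _; rewrite lee_fin cabs_ge0.
- by apply/measurable_EFinP; exact: measurable_cabs.
- by apply/measurable_EFinP; apply: measurable_funM => //; exact: measurable_indic.
have P (phi : R) : cabs (angle_weight kap phi * (expi (- (k%:~R * phi)) *
    wave_hat lam c1 c2 p1 p2 beta (s * cos phi, s * sin phi))) <= E * \1_(`[0, 2 * pi]%classic) phi.
  rewrite (cabsM (angle_weight kap phi)) cabs_angle_weight// (cabsM (expi _)) cabs_expi mul1r.
  have [->|k0] := eqVneq (kap phi) 0; first by rewrite mulr0 mul0r mulr_ge0.
  rewrite -mulrA mulrC ler_wpM2r//.
  have /andP[k1 k2] := kap01 phi.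
  by rewrite -[leRHS]mul1r; apply: ler_pM => //; [exact: cabs_ge0|exact: hE].
by move=> phi _; rewrite lee_fin; exact: P.
Qed.

(** Read off the spatial form: the packet lives in the unit square, where the bound on the angular
    integral is uniform, and its L^1 norm is [lam]. *)
Lemma cut_hat_decay (j : nat) (C : R) : beta 0 = 1 -> `|p1| + w <= 1 -> `|p2| + w <= 1 ->
  (forall (k : int) (s x1 x2 : R), `|x1| <= 1 -> `|x2| <= 1 ->
    `|k%:~R| ^+ j * cabs (cintegral mu `[0, 2 * pi] (fun x => (kap x)%:C%C *
     expi (- (k%:~R * x)) * expi (- (s * (x1 * cos x + x2 * sin x))))) <= C * (1 + `|s|) ^+ j) ->
  forall (k : int) (s : R),
    `|k%:~R| ^+ j * cabs (cut_hat lam c1 c2 b1 b2 kap k s) <= 2 * C * lam * (1 + `|s|) ^+ j.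
Proof.
move=> beta0 w1 w2 hC k s; rewrite (cut_hat_space _ _ _ sb1 sb2 ckap kap01).
have := fun x1 x2 => hC k s x1 x2; have : 0 <= `|k%:~R : R| ^+ j by exact: exprn_ge0.
move: (`|k%:~R| ^+ j) => c c0 {}hC.
set I := fun x : R * R => cintegral mu `[0, 2 * pi]%classic (fun phi =>
    (kap phi)%:C%C * expi (- (k%:~R * phi)) * expi (- (s * (x.1 * cos phi + x.2 * sin phi)))).
have iw := cintegrable_wave lam c1 c2 sb1 sb2.
have ia := cintegrable_angle_weight ckap kap01.
have IE (x : R * R) : I x = cintegral mu setT (fun phi => angle_weight kap phi * cut_kernel k s (x, phi)).
  rewrite /I cintegral_mkcond; apply: eq_cintegral => phi _.
  by rewrite /angle_weight /cut_kernel/= !mulrA.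
have mI : cmeasurable I.
  rewrite (funext IE).
  apply: (@cmeasurable_cintegral_param _ _ _ _ _ mu
    (fun z : (R * R) * R => angle_weight kap z.2 * cut_kernel k s z)).
  apply: cmeasurableM; last exact: cmeasurable_cut_kernel.
  exact: (cmeasurable_comp measurable_snd (cintegrable_cmeasurable ia)).
have bI (x : R * R) : cabs (I x) <= 2 * Rintegral mu setT (fun phi => cabs (angle_weight kap phi)).
  rewrite IE; apply: cabs_cintegral_le (integrable_cabs ia) _.
    apply: (cintegrableMr ia) => [|phi]; last exact: cabs_cut_kernel.
    exact: (cmeasurable_comp (measurable_pair1 x) (cmeasurable_cut_kernel k s)).
  by move=> phi; rewrite cabsM ler_piMr ?cabs_ge0 ?cabs_cut_kernel.
have K (x : R * R) : cabs (c%:C%C * (wave lam c1 c2 b1 b2 x * I x)) <=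
    C * (1 + `|s|) ^+ j * cabs (wave lam c1 c2 b1 b2 x).
  rewrite (cabsM c%:C%C) (cabsM (wave lam c1 c2 b1 b2 x)) cabs_real ger0_norm// mulrCA mulrC.
  have [->|wx] := eqVneq (wave lam c1 c2 b1 b2 x) 0; first by rewrite cabs0 !mulr0.
  apply: ler_wpM2r; first exact: cabs_ge0.
  have [x1 x2] := wave_radius sb1 sb2 wx.
  have h1 := ler_normD (x.1 - p1) p1; have h2 := ler_normD (x.2 - p2) p2.
  by rewrite !subrK in h1 h2; apply: hC; lra.
have iG : cintegrable (mu \x mu)%E (fun x => wave lam c1 c2 b1 b2 x * I x).
  exact: cintegrableMr iw mI bI.
have := cabs_cintegral_le (cintegrableZl c%:C%C iG)
  (integrable_cabs_wave lam c1 c2 sb1 sb2 (C * (1 + `|s|) ^+ j)) K.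
rewrite RintegralZl//; last exact: (integrable_cabs iw).
rewrite (Rintegral_cabs_wave beta0) cintegralZl// cabsM cabs_real (ger0_norm c0) => H.
rewrite (_ : 2 * C * lam * (1 + `|s|) ^+ j = 2 * (C * (1 + `|s|) ^+ j * lam)) //; ring.
Qed.

End CutHatBounds.

Section CutRadonNorm.
Context {R : realType}.

Lemma powD1_le (x : R) (i : nat) : 0 <= x -> (1 + x) ^+ i <= 2 ^+ i * (1 + x ^+ i).
Proof.
move=> x0; have [x1|x1] := leP x 1.
  apply: (@le_trans _ _ (2 ^+ i)); first by apply: lerXn2r; rewrite ?nnegrE; lra.
  by rewrite ler_peMr ?exprn_ge0// lerDl exprn_ge0.
apply: (@le_trans _ _ ((2 * x) ^+ i)); first by apply: lerXn2r; rewrite ?nnegrE; lra.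
by rewrite exprMn ler_wpM2l ?exprn_ge0// lerDr.
Qed.

(** The orders are matched so that, with i = S + 1, the product of the two bounds on the transform G
    controls G^2 ((1 + k^2) (1 + t^2))^i, as [cylinder_sobolev_le] requires. *)
Lemma cut_radon_sobolev_le (a r phi0 s M : R) (S : nat) (kap : R -> R) :
  0 < a <= 2^-1 -> 0 < r <= 1 -> `|s| <= S%:R ->
  periodicC (2 * S.+1) M kap -> (forall x, 0 <= kap x <= 1) ->
  (forall x, sin (x - phi0) ^+ 2 <= r ^+ 2 -> kap x = 0) ->
  exists2 D : R, 0 < D & forall (n : nat) (lam p1 p2 w N : R) (b1 b2 : R -> R),
    (0 < n)%N -> 0 < lam -> `|p1| + w <= 1 -> `|p2| + w <= 1 ->
    N = 4 * expR 1 / (a * r) * n%:R ->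
    spline p1 w (multiplier a (2 * S.+1) n) b1 -> spline p2 w (multiplier a (2 * S.+1) n) b2 ->
    (cylinder_sobolev s (cut_radon lam (N * cos phi0) (N * sin phi0) b1 b2 kap) <=
      (D * lam * expR (- n%:R))%:E)%E.
Proof.
move=> a01 r01 sS pk kap01 kap_out; have [ck _ _] := periodicC_base pk.
have pk0 : periodicC 0 M kap by split=> //; exact: periodicC_base pk.
have [C hC] := kernel_decay pk; have [C0 hC0] := kernel_decay pk0.
set i := S.+1 in pk hC *.
pose U : R := (a * r / 4) ^- (2 * (2 * i)).
(* Collects the constants of the decay in [k]. The signs of [C0] and [C] are unknown, hence the
   absolute values, and the [+ 1] makes [W] positive. *)
pose W : R := 2 ^+ i * (2 * (`|C0| + 1) + 2 * `|C| * 2 ^+ i).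
have /andP[a0 a1] := a01; have /andP[r0 r1] := r01.
have U0 : 0 < U by rewrite invr_gt0 exprn_gt0// divr_gt0// mulr_gt0.
have W0 : 0 < W.
  rewrite mulr_gt0 ?exprn_gt0// ltr_pwDl ?mulr_gt0 ?mulr_ge0 ?exprn_ge0//.
pose D2 : R := 4 * pi * U * W.
have D20 : 0 < D2 by rewrite !mulr_gt0 ?pi_gt0.
exists (Num.sqrt D2 * Num.sqrt (pi * 8)) => [|n lam p1 p2 w N b1 b2 n0 l0 w1 w2 NE sb1 sb2].
  by rewrite mulr_gt0 ?sqrtr_gt0// mulr_gt0// pi_gt0.
set c1 := N * _; set c2 := N * _.
have hF := cut_radon_has_fourier lam c1 c2 sb1 sb2 ck kap01.
set D := Num.sqrt D2 * lam * expR (- n%:R).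
have D0 : 0 < D by rewrite !mulr_gt0 ?sqrtr_gt0 ?expR_gt0.
have -> : Num.sqrt D2 * Num.sqrt (pi * 8) * lam * expR (- n%:R) = D * Num.sqrt (pi * 8).
  by rewrite /D; ring.
apply: (cylinder_sobolev_le sS D0 hF) => k t.
set G := cabs _; have G0 : 0 <= G by exact: cabs_ge0.
have t1 : 1 <= 1 + t ^+ 2 by rewrite lerDl sqr_ge0.
have t0 : 0 < 1 + t ^+ 2 by exact: lt_le_trans t1.
have A : G * (1 + t ^+ 2) ^+ (2 * i) <= 4 * pi * (lam * (U * expR (- n%:R) ^+ 2)).
  have Tp : 0 < (1 + t ^+ 2) ^+ (2 * i) by exact: exprn_gt0.
  rewrite -ler_pdivlMr// -[leRHS]mulrA.
  apply: (cut_hat_le sb1 sb2 ck kap01 k).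
  - exact: measurable_multiplier.
  - by rewrite divr_ge0 ?(ltW Tp)// mulr_ge0 ?(ltW l0)// mulr_ge0 ?sqr_ge0// ltW.
  - move=> phi kp; rewrite ler_pdivlMr//.
    have sr : r ^+ 2 <= sin (phi - phi0) ^+ 2.
      by rewrite leNgt; apply/negP => /ltW/kap_out k0; rewrite k0 eqxx in kp.
    by apply: wave_hat_small => //; exact: ltW.
have Bj : `|k%:~R| ^+ (2 * i) * G <= 2 * C * lam * (1 + `|t|) ^+ (2 * i).
  by apply: (cut_hat_decay _ _ (ltW l0) sb1 sb2 ck kap01 (multiplier0 _ _ _) w1 w2 hC).
have B0 : G <= 2 * C0 * lam.
  have := cut_hat_decay c1 c2 (ltW l0) sb1 sb2 ck kap01 (multiplier0 _ _ _) w1 w2 hC0 k t.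
  by rewrite !expr0 mul1r mulr1.
have k2 : `|k%:~R| ^+ (2 * i) = (k%:~R ^+ 2) ^+ i :> R.
  by rewrite exprM real_normK ?num_real.
have T2 : (1 + `|t|) ^+ (2 * i) <= 2 ^+ i * (1 + t ^+ 2) ^+ i.
  rewrite exprM -exprMn; apply: lerXn2r; rewrite ?nnegrE ?sqr_ge0//.
    by rewrite mulr_ge0// ltW.
  rewrite -(real_normK (num_real t)); have := sqr_ge0 (1 - `|t|); nra.
(* The decay bounds of orders 0 and 2i are combined through (1 + k^2)^i <= 2^i (1 + k^(2i)), which
   covers k = 0 as well. *)
have B : (1 + k%:~R ^+ 2) ^+ i * G <= W * lam * (1 + t ^+ 2) ^+ i.
  apply: (@le_trans _ _ (2 ^+ i * (1 + (k%:~R ^+ 2) ^+ i) * G)).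
    by rewrite ler_wpM2r// powD1_le// sqr_ge0.
  have T1 : 1 <= (1 + t ^+ 2) ^+ i by exact: exprn_ege1.
  rewrite /W -[leLHS]mulrA -[leRHS]mulrA -[leRHS]mulrA; apply: ler_wpM2l; first exact: exprn_ge0.
  rewrite mulrDl mul1r [leRHS]mulrDl; apply: lerD.
    apply: (le_trans B0); apply: (@le_trans _ _ (2 * (`|C0| + 1) * lam)).
      by rewrite ler_wpM2r ?(ltW l0)// ler_wpM2l// (le_trans (ler_norm C0))// lerDl.
    have C1 : 0 <= 2 * (`|C0| + 1) by rewrite mulr_ge0// addr_ge0.
    rewrite (ler_wpM2l C1)//.
    by rewrite ler_peMr// ltW.
  rewrite -k2; apply: (le_trans Bj).
  have -> : 2 * `|C| * 2 ^+ i * (lam * (1 + t ^+ 2) ^+ i) =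
      2 * `|C| * lam * (2 ^+ i * (1 + t ^+ 2) ^+ i) by ring.
  apply: (@le_trans _ _ (2 * `|C| * lam * (1 + `|t|) ^+ (2 * i))).
    rewrite ler_wpM2r ?exprn_ge0 ?addr_ge0// ler_wpM2r ?(ltW l0)// ler_wpM2l//.
    exact: ler_norm.
  by rewrite ler_wpM2l// !mulr_ge0// ltW.
rewrite exprMn; move: A B; rewrite mulnC exprM.
have Tp : 0 < (1 + t ^+ 2) ^+ i by exact: exprn_gt0.
have Kp : 0 <= (1 + k%:~R ^+ 2 : R) ^+ i by rewrite exprn_ge0// addr_ge0// sqr_ge0.
move: ((1 + t ^+ 2) ^+ i) ((1 + k%:~R ^+ 2) ^+ i) Tp Kp => T K T_gt0 K_ge0 A B.
(* The geometric mean. Of the two powers of [T] in the smallness bound, one pays for the growth in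
   the decay bound and the other remains as weight. *)
have : (G * T ^+ 2) * (K * G) <= 4 * pi * (lam * (U * expR (- n%:R) ^+ 2)) * (W * lam * T).
  by apply: ler_pM => //; rewrite mulr_ge0// sqr_ge0.
rewrite [leLHS](_ : _ = G ^+ 2 * (K * T) * T); last by ring.
have D2E : D ^+ 2 = D2 * lam ^+ 2 * expR (- n%:R) ^+ 2.
  by rewrite /D !exprMn sqr_sqrtr// ltW.
rewrite [leRHS](_ : _ = D ^+ 2 * T) ?ler_pM2r//.
by rewrite D2E /D2; ring.
Qed.

End CutRadonNorm.

(** * Instability *)

Section SmallSine.
Context {R : realType}.

Lemma sinDnpi (x : R) (n : nat) : `|sin (x + n%:R * pi)| = `|sin x|.
Proof.
elim: n => [|n IH]; first by rewrite mul0r addr0.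
by rewrite -natr1 mulrDl mul1r addrA sinDpi normrN.
Qed.

(** After reduction of |x| modulo pi, monotonicity of sine on [-pi/2, pi/2] applies to the remainder
    y or to pi - y. *)
Lemma small_sin_near (r0 x : R) : 0 < r0 < pi / 2 -> `|sin x| < sin r0 ->
  exists n : nat, `|x - n%:R * pi| < r0 \/ `|x + n%:R * pi| < r0.
Proof.
move=> /andP[r00 r01]; have p0 : 0 < pi :> R by exact: pi_gt0.
wlog x0 : x / 0 <= x => [H|].
  have [x0|x0] := leP 0 x; first exact: H.
  rewrite -normrN -sinN => /(H (- x))[|n Hn]; first by rewrite oppr_ge0 ltW.
  exists n; rewrite -(normrN (x - _)) -(normrN (x + _)) !opprD opprK.
  by case: Hn => h; [right|left].
move=> sx; pose n := Num.truncn (x / pi); pose y := x - n%:R * pi.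
have xy : x = y + n%:R * pi by rewrite /y subrK.
have /andP[n1 n2] : n%:R <= x / pi < n.+1%:R.
  by apply: Num.Theory.truncn_itv; rewrite divr_ge0// ltW.
have y0 : 0 <= y by rewrite subr_ge0 -ler_pdivlMr.
have y1 : y < pi by rewrite ltr_pdivrMr// -natr1 mulrDl mul1r in n2; rewrite /y; lra.
move: sx; rewrite xy sinDnpi => sy.
have mono (z : R) : 0 <= z <= pi / 2 -> sin z < sin r0 -> z < r0.
  move=> /andP[z0 z1]; rewrite ltr_sin//; rewrite in_itv/=; apply/andP; split; lra.
have [yp|yp] := leP y (pi / 2).
  exists n; left; rewrite addrK ger0_norm//; apply: mono; first by rewrite y0.
  exact: le_lt_trans (ler_norm _) sy.
exists n.+1; left; rewrite -natr1 mulrDl mul1r opprD addrA addrK distrC ger0_norm; last lra.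
apply: mono; first by apply/andP; split; lra.
by apply: le_lt_trans (ler_norm _) _; rewrite addrC sinDpi sinN opprK.
Qed.

End SmallSine.

(** * Lines that meet the packet and belong to Lam *)

Section Gap.
Context {R : realType}.
Variables (Lam : set (R * R)).
Hypothesis Lam_sym : antipode @` Lam = Lam.

Lemma antipode_mem (phi s : R) : Lam (phi + pi, - s) <-> Lam (phi, s).
Proof.
split => [h|h]; last by rewrite -Lam_sym; exists (phi, s).
by rewrite -Lam_sym in h; case: h => -[p t] /= Lpt [/addIr <- /oppr_inj <-].
Qed.

(** Turning by pi flips the sign of x . theta, so the antipodal symmetry identifies the two
    descriptions of one line through x: membership depends on the angle modulo pi only. *)
Lemma line_mem (x1 x2 phi : R) (n : nat) :
  Lam (phi + n%:R * pi, x1 * cos (phi + n%:R * pi) + x2 * sin (phi + n%:R * pi)) <->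
  Lam (phi, x1 * cos phi + x2 * sin phi).
Proof.
elim: n => [|n IH]; first by rewrite mul0r addr0.
rewrite -IH -(antipode_mem (phi + n%:R * pi)) -natr1 mulrDl mul1r addrA sinDpi cosDpi.
by rewrite !mulrN -opprD.
Qed.

Lemma closure_gap (phi0 s0 : R) : ~ closure Lam (phi0, s0) ->
  exists2 rho : R, 0 < rho &
    forall phi s : R, `|phi - phi0| < rho -> `|s - s0| < rho -> ~ Lam (phi, s).
Proof.
move=> nc; have oc : open (~` closure Lam) by apply: closed_openC; exact: closed_closure.
have /nbhs_ballP[e /= e0 he] := open_nbhs_nbhs (conj oc nc).
exists e => // phi s h1 h2 L; apply: (he (phi, s)); last exact: subset_closure.
by split; rewrite /ball/= distrC.
Qed.

Lemma line_far (phi0 s0 rho r0 w x1 x2 phi : R) : `|s0| < 1 -> 0 < rho <= 1 ->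
  (forall phi s : R, `|phi - phi0| < rho -> `|s - s0| < rho -> ~ Lam (phi, s)) ->
  0 < r0 < pi / 2 -> r0 <= rho / 2 -> w <= rho / 8 ->
  `|x1 - s0 * cos phi0| <= w -> `|x2 - s0 * sin phi0| <= w ->
  Lam (phi, x1 * cos phi + x2 * sin phi) -> sin r0 ^+ 2 <= sin (phi - phi0) ^+ 2.
Proof.
move=> s01 /andP[rho0 rho1] gap r0p r0r wr X1 X2 L.
have /andP[r00 r01] := r0p.
have sr0 : 0 < sin r0 by apply: sin_gt0_pihalf.
rewrite -(real_normK (num_real (sin (phi - phi0)))) leNgt; apply/negP.
rewrite ltr_sqr ?nnegrE ?normr_ge0 ?(ltW sr0)// => /(small_sin_near r0p)[n near].
(* A shift by a multiple of pi brings the angle next to [phi0] while the line stays in [Lam]; what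
   follows places that line in the gap. *)
have [beta [b1 Lb]] : exists beta, `|beta - phi0| < r0 /\ Lam (beta, x1 * cos beta + x2 * sin beta).
  case: near => h; [exists (phi - n%:R * pi)|exists (phi + n%:R * pi)]; split.
  - by rewrite addrAC.
  - by apply/(line_mem _ _ _ n); rewrite subrK.
  - by rewrite addrAC.
  - exact/line_mem.
apply: (gap _ _ _ _ Lb); first by apply: lt_le_trans b1 _; lra.
(* The first term is at most (rho/2)^2 / 2 <= rho/8 since |s0| < 1, and each of the other two at
   most w <= rho/8; the total 3 rho/8 is below [rho]. *)
have -> : x1 * cos beta + x2 * sin beta - s0 =
    s0 * (cos (beta - phi0) - 1) + ((x1 - s0 * cos phi0) * cos beta + (x2 - s0 * sin phi0) * sin beta).
  by rewrite cosB; ring.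
have c0 := cos_ge_sqr (beta - phi0); have c1 := cos_le1 (beta - phi0).
have b2 : (beta - phi0) ^+ 2 <= rho / 4.
  rewrite -(real_normK (num_real (beta - phi0))); have := normr_ge0 (beta - phi0).
  move: `|_| b1 => z; nra.
have h1 : `|s0 * (cos (beta - phi0) - 1)| <= rho / 8.
  rewrite normrM; apply: (@le_trans _ _ (1 * `|cos (beta - phi0) - 1|)).
    by rewrite ler_wpM2r// ltW.
  by rewrite mul1r distrC ger0_norm; lra.
have tr (u v : R) : `|u| <= w -> `|v| <= 1 -> `|u * v| <= w.
  by move=> u1 v1; rewrite normrM (le_trans _ u1)// ler_piMr.
have h2 : `|(x1 - s0 * cos phi0) * cos beta| <= w.
  by apply: tr => //; rewrite ler_norml cos_geN1 cos_le1.
have h3 : `|(x2 - s0 * sin phi0) * sin beta| <= w.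
  by apply: tr => //; rewrite ler_norml sin_geN1 sin_le1.
have h4 := ler_normD (s0 * (cos (beta - phi0) - 1))
  ((x1 - s0 * cos phi0) * cos beta + (x2 - s0 * sin phi0) * sin beta).
have h5 := ler_normD ((x1 - s0 * cos phi0) * cos beta) ((x2 - s0 * sin phi0) * sin beta).
apply: le_lt_trans h4 _; lra.
Qed.

Lemma ball_of_box (phi0 s0 w x1 x2 : R) : `|s0| + 2 * w <= 1 ->
  `|x1 - s0 * cos phi0| <= w -> `|x2 - s0 * sin phi0| <= w -> unit_ball (x1, x2).
Proof.
move=> sw X1 X2; rewrite /unit_ball/=.
set e1 := x1 - _ in X1; set e2 := x2 - _ in X2.
have w0 : 0 <= w by exact: le_trans X1.
have -> : x1 ^+ 2 + x2 ^+ 2 = s0 ^+ 2 * (cos phi0 ^+ 2 + sin phi0 ^+ 2)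
    + 2 * s0 * (e1 * cos phi0 + e2 * sin phi0) + e1 ^+ 2 + e2 ^+ 2 by rewrite /e1 /e2; ring.
rewrite cos2Dsin2 mulr1 -(real_normK (num_real s0)).
have tr (u v : R) : `|u| <= w -> `|v| <= 1 -> `|u * v| <= w.
  by move=> u1 v1; rewrite normrM (le_trans _ u1)// ler_piMr.
have h2 : `|e1 * cos phi0| <= w by apply: tr => //; rewrite ler_norml cos_geN1 cos_le1.
have h3 : `|e2 * sin phi0| <= w by apply: tr => //; rewrite ler_norml sin_geN1 sin_le1.
have h5 := le_trans (ler_normD (e1 * cos phi0) (e2 * sin phi0)) (lerD h2 h3).
have h6 : 2 * s0 * (e1 * cos phi0 + e2 * sin phi0) <= 2 * `|s0| * (w + w).
  rewrite -!mulrA ler_pM2l// (le_trans (ler_norm _))// normrM ler_wpM2l//.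
have q (e : R) : `|e| <= w -> e ^+ 2 <= w ^+ 2.
  by move=> ew; rewrite -(real_normK (num_real e)) lerXn2r ?nnegrE.
have q1 := q _ X1; have q2 := q _ X2; have s1 := normr_ge0 s0.
by nra.
Qed.

End Gap.

Section Instability.
Context {R : realType}.

(** This makes the cut-off transform an admissible extension in the quotient norm: wherever both the
    packet and the test function are nonzero, the cutoff equals 1. *)
Lemma cut_radon_restriction (Lam : set (R * R)) (lam c1 c2 p1 p2 w : R) (beta b1 b2 kap : R -> R)
    (psi : R * R -> R[i]) : spline p1 w beta b1 -> spline p2 w beta b2 ->
  (forall x1 x2 phi : R, `|x1 - p1| <= w -> `|x2 - p2| <= w ->
     Lam (phi, x1 * cos phi + x2 * sin phi) -> kap phi = 1) ->
  cylinder_test_function Lam psi ->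
  cut_radon lam c1 c2 b1 b2 kap psi = radon_distribution (wave_distribution lam c1 c2 b1 b2) psi.
Proof.
move=> sb1 sb2 far [_ _ supp _].
have P (x : R * R) : wave lam c1 c2 b1 b2 x * cut_transpose kap psi x =
    wave lam c1 c2 b1 b2 x * radon_transpose psi x.
  have [->|wx] := eqVneq (wave lam c1 c2 b1 b2 x) 0; first by rewrite !mul0r.
  have [x1 x2] := wave_radius sb1 sb2 wx.
  congr (_ * _); apply: eq_cintegral => phi _.
  have [->|pn] := eqVneq (psi (phi, x.1 * cos phi + x.2 * sin phi)) 0; first by rewrite mulr0.
  rewrite (far x.1 x.2) ?mul1r//.
  by apply: supp; exact: subset_closure.
by apply: eq_cintegral => x _; exact: P.
Qed.

Lemma sqr_frequency_le (K : R) (n : nat) : 1 <= K -> (0 < n)%N ->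
  1 + (K * n%:R) ^+ 2 <= 2 * K ^+ 2 * n%:R ^+ 2.
Proof.
move=> K1 n0; have n1 : 1 <= n%:R :> R by rewrite ler1n.
have : 1 <= K * n%:R by rewrite mulr_ege1.
by rewrite -mulrA -exprMn; move: (K * _) => z z1; nra.
Qed.

Lemma frequency_factor_ge1 (a r : R) : 0 < a <= 2^-1 -> 0 < r <= 1 ->
  1 <= 4 * expR 1 / (a * r).
Proof.
move=> /andP[a0 a1] /andP[r0 r1].
have e2 : 2 <= expR 1 :> R by have := @expR_ge1Dx R 1; rewrite -natr1.
have ar1 : a * r <= 1 by apply: mulr_ile1; lra.
by rewrite ler_pdivlMr ?mulr_gt0//; lra.
Qed.

Lemma packet_geometry (Lam : set (R * R)) (j : nat) :
  antipode @` Lam = Lam -> (strip `\` closure Lam) !=set0 ->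
  exists phi0 s0 r w M : R, exists kap : R -> R,
    [/\ 0 < r <= 1, 0 < w, `|s0| + 2 * w <= 1 &
      [/\ periodicC j M kap, forall x, 0 <= kap x <= 1,
        forall x, sin (x - phi0) ^+ 2 <= r ^+ 2 -> kap x = 0 &
        forall x1 x2 phi : R, `|x1 - s0 * cos phi0| <= w -> `|x2 - s0 * sin phi0| <= w ->
          Lam (phi, x1 * cos phi + x2 * sin phi) -> kap phi = 1]].
Proof.
move=> Lam_sym [[phi0 s0] [/= /andP[s0l s0r] nc]]; rewrite /= in s0l s0r.
have s01 : `|s0| < 1 by rewrite ltr_norml s0l.
have [rho' rho'0 gap'] := closure_gap nc.
pose rho := Num.min rho' 1.
have rho01 : 0 < rho <= 1 by rewrite lt_min rho'0 ltr01/= ge_min lexx orbT.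
have gap : forall phi s : R, `|phi - phi0| < rho -> `|s - s0| < rho -> ~ Lam (phi, s).
  by move=> phi s; rewrite !lt_min => /andP[h1 _] /andP[h2 _]; exact: gap'.
have /andP[rho0 rho1] := rho01.
pose r0 := rho / 2.
have r0p : 0 < r0 < pi / 2.
  by have := @pi_ge2 R; rewrite /r0 => p2; apply/andP; split; lra.
have sr0 : 0 < sin r0 by apply: sin_gt0_pihalf.
(* Strictly below [sin r0], which leaves room for the transition of the cutoff from 0 to 1. *)
pose r := sin r0 / 2.
have r01 : 0 < r <= 1.
  by have := sin_le1 r0; rewrite /r => h; apply/andP; split; lra.
have [kap [M [pk kap01 kap_out kap_in]]] :
    exists k M, [/\ periodicC j M k, forall x, 0 <= k x <= 1,
      forall x, sin (x - phi0) ^+ 2 <= r ^+ 2 -> k x = 0 &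
      forall x, sin r0 ^+ 2 <= sin (x - phi0) ^+ 2 -> k x = 1].
  apply: exists_cutoff; apply/andP; split; first by rewrite exprn_gt0//; have /andP[] := r01.
  by rewrite /r; nra.
(* The first bound keeps the lines through the packet close to [s0], the second keeps the packet in
   the unit ball. *)
pose w := Num.min (rho / 8) ((1 - `|s0|) / 2).
have w0 : 0 < w by rewrite lt_min; apply/andP; split; lra.
have wa : w <= rho / 8 by rewrite ge_min lexx.
have wb : w <= (1 - `|s0|) / 2 by rewrite ge_min lexx orbT.
exists phi0, s0, r, w, M, kap; split=> //; first by move: wb; rewrite ler_pdivlMr//; lra.
split=> // x1 x2 phi h1 h2 L; apply: kap_in.
exact: (line_far Lam_sym s01 rho01 gap r0p (lexx _) wa h1 h2 L).
Qed.

Lemma unstable_packets (Lam : set (R * R)) (s1 s2 delta : R) :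
  antipode @` Lam = Lam -> (strip `\` closure Lam) !=set0 -> 0 < delta ->
  exists c D : R, exists q : nat, [/\ 0 < c, 0 < D & forall n : nat, (0 < n)%N ->
    exists u : (R * R -> R[i]) -> R[i],
      [/\ compactly_supported_distribution u, dsupport u `<=` unit_ball,
          (sobolev2 (s1 + delta) u <= 1)%E,
          ((c * n%:R `^ (- delta))%:E <= sobolev2 s1 u)%E &
          (restriction_sobolev s2 Lam (radon_distribution u) <=
             (D * n%:R ^+ q * expR (- n%:R))%:E)%E]].
Proof.
move=> Lam_sym Lam_miss delta0.
have [S [S1 Sd S2]] : exists S : nat, [/\ `|s1| <= S%:R, `|s1 + delta| <= S%:R & `|s2| <= S%:R].
  exists (Num.truncn (`|s1| + `|s1 + delta| + `|s2|)).+1.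
  have : 0 <= `|s1| + `|s1 + delta| + `|s2| by rewrite !addr_ge0.
  move=> /Num.Theory.truncn_itv/andP[_ /ltW]; move: (_.+1%:R) => z.
  by have := normr_ge0 s1; have := normr_ge0 (s1 + delta); have := normr_ge0 s2; split; lra.
have [phi0 [s0 [r [w [M [kap [r01 w0 sw [pk kap01 kap_out far]]]]]]]] :=
  packet_geometry (2 * S.+1) Lam_sym Lam_miss.
have [ck _ _] := periodicC_base pk.
pose P := (2 * S.+1)%N.
have [a a01 aw] : exists2 a : R, 0 < a <= 2^-1 & a *+ (2 * P + 2) = w.
  have m0 : 2 <= (2 * P + 2)%:R :> R by rewrite ler_nat leq_addl.
  exists (w / (2 * P + 2)%:R); last by rewrite -[LHS]mulr_natr divfK// gt_eqF// (lt_le_trans _ m0).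
  move: ((2 * P + 2)%:R) m0 => m m0; have mp : 0 < m by lra.
  rewrite divr_gt0//= ler_pdivrMr//; have := normr_ge0 s0; lra.
have p1w : `|s0 * cos phi0| + w <= 1.
  apply: (@le_trans _ _ (`|s0| + w)); last by lra.
  by rewrite lerD2r normrM ler_piMr// ler_norml cos_geN1 cos_le1.
have p2w : `|s0 * sin phi0| + w <= 1.
  apply: (@le_trans _ _ (`|s0| + w)); last by lra.
  by rewrite lerD2r normrM ler_piMr// ler_norml sin_geN1 sin_le1.
have SP : (S.+1 <= 2 * P)%N by rewrite /P mulnA leq_pmull.
have /andP[a0 _] := a01.
have [C C0 hC] := sobolev2_wave_le a0 Sd SP.
have [c c0 hc] := sobolev2_wave_ge P a01 S1.
have [D D0 hD] := cut_radon_sobolev_le a01 r01 S2 pk kap01 kap_out.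
pose K := 4 * expR 1 / (a * r).
have K1 : 1 <= K := frequency_factor_ge1 a01 r01.
pose Q := 2 * K ^+ 2; have Q0 : 0 < Q by rewrite mulr_gt0// exprn_gt0// (lt_le_trans _ K1).
exists (c / C * Q `^ (- delta / 2)), (D / C * Q ^+ S), (2 * S)%N; split.
- by rewrite mulr_gt0 ?divr_gt0 ?powR_gt0.
- by rewrite mulr_gt0 ?divr_gt0 ?exprn_gt0.
move=> n n0; have n1 : 1 <= n%:R :> R by rewrite ler1n.
have np : 0 < n%:R :> R by exact: lt_le_trans n1.
have P0 : (0 < P)%N by [].
have [b1 sb1] := exists_multiplier_spline (s0 * cos phi0) a0 P0 n0.
have [b2 sb2] := exists_multiplier_spline (s0 * sin phi0) a0 P0 n0.
rewrite aw in sb1 sb2.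
pose N := K * n%:R; pose B := 1 + (N * cos phi0) ^+ 2 + (N * sin phi0) ^+ 2.
have BE : B = 1 + N ^+ 2.
  by rewrite /B !exprMn -addrA -mulrDr cos2Dsin2 mulr1.
have B1 : 1 <= B by rewrite BE lerDl sqr_ge0.
have Bp : 0 < B by exact: lt_le_trans B1.
have BQ : B <= Q * n%:R ^+ 2 by rewrite BE; exact: sqr_frequency_le.
(* Normalises the upper bound for the H^(s1 + delta) norm to exactly 1. The lower bound for the H^s1
   norm then becomes c / C times B^(- delta / 2), and B <= Q n^2 turns it into n^(- delta). *)
pose lam := (C * B `^ ((s1 + delta) / 2))^-1.
have lam0 : 0 < lam by rewrite invr_gt0 mulr_gt0// powR_gt0.
exists (wave_distribution lam (N * cos phi0) (N * sin phi0) b1 b2); split.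
- exact: wave_compactly_supported sb1 sb2.
- apply: (wave_dsupport sb1 sb2) => -[x1 x2]/= h1 h2.
  by apply: (@ball_of_box _ phi0 s0 w).
- apply: (le_trans (hC n lam _ _ _ _ _ _ _ (ltW lam0) sb1 sb2)).
  rewrite -/B lee_fin /lam le_eqVlt; apply/orP; left; apply/eqP.
  have := powR_gt0 ((s1 + delta) / 2) Bp; move: (_ `^ _) => z z0.
  by field; rewrite !gt_eqF.
- apply: le_trans (hc n lam _ _ _ _ _ _ _ lam0 n0 sb1 sb2).
  rewrite -/B lee_fin; have -> : lam * B `^ (s1 / 2) = C^-1 * B `^ (- delta / 2).
    rewrite /lam invfM -mulrA -powRN -powRD; last by rewrite (gt_eqF Bp) implybT.
    by congr (_ * _ `^ _); field.
  rewrite -!mulrA ler_pM2l// ler_pM2l ?invr_gt0//.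
  have -> : n%:R `^ (- delta) = (n%:R ^+ 2) `^ (- delta / 2) :> R.
    by rewrite -powR_mulrn ?(ltW np)// -powRrM; congr (_ `^ _); field.
  rewrite -powRM ?(ltW Q0) ?sqr_ge0// mulNr !powRN lef_pV2 ?posrE ?powR_gt0//; last first.
    by rewrite mulr_gt0// exprn_gt0.
  apply: ge0_ler_powR => //; rewrite ?nnegrE ?(ltW Bp) ?divr_ge0 ?(ltW delta0)//.
  by rewrite mulr_ge0 ?(ltW Q0) ?sqr_ge0.
(* The quotient norm is an infimum over extensions, and [cut_radon] is one. The power of n in the
   final bound comes from [lam], at most B^S / C. *)
- apply: (@le_trans _ _ (cylinder_sobolev s2 (cut_radon lam (N * cos phi0) (N * sin phi0) b1 b2 kap))).
    apply: ereal_inf_lbound; exists (cut_radon lam (N * cos phi0) (N * sin phi0) b1 b2 kap).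
      split; first exact: (cut_radon_tempered _ _ _ sb1 sb2 ck kap01).
      by move=> f; exact: cut_radon_restriction sb1 sb2 far.
    exact: erefl.
  apply: (le_trans (hD n lam _ _ _ N _ _ n0 lam0 p1w p2w erefl sb1 sb2)).
  rewrite lee_fin ler_wpM2r ?expR_ge0//.
  rewrite (_ : D / C * Q ^+ S * n%:R ^+ (2 * S) = D * (C^-1 * (Q * n%:R ^+ 2) ^+ S)); last first.
    by rewrite [in LHS]exprM (exprMn S Q); move: (Q ^+ S) ((n%:R ^+ 2) ^+ S) => x y; ring.
  rewrite ler_pM2l// /lam invfM ler_pM2l ?invr_gt0// -powRN.
  apply: (@le_trans _ _ (B ^+ S)); last first.
    by apply: lerXn2r; rewrite ?nnegrE ?(ltW Bp)// mulr_ge0 ?(ltW Q0) ?sqr_ge0.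
  apply: powR_le_exp => //; rewrite normrN normrM.
  rewrite (le_trans _ Sd)// ler_piMr// ger0_norm//; lra.
Qed.

End Instability.

Unset Implicit Arguments.

Theorem proposition6p7 (R : realType) (Lam : set (R * R))
  (Lam_periodic : periodic_set Lam) (Lam_open : open Lam)
  (Lam_strip : Lam `<=` strip)
  (Lam_sym : antipode @` Lam = Lam)
  (Lam_miss : (strip `\` closure Lam) !=set0)
  (omega : \bar R -> \bar R) (omega_mod : modulus_of_continuity omega)
  (s1 s2 delta : R) (delta_gt0 : 0 < delta)
  (stability : forall f : (R * R -> R[i]) -> R[i],
     compactly_supported_distribution f -> dsupport f `<=` unit_ball ->
     (sobolev2 (s1 + delta) f <= 1)%E ->
     (sobolev2 s1 f
        <= omega (restriction_sobolev s2 Lam (radon_distribution f)))%E) :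
  forall m : R, 1 < m ->
    exists2 C : R, 0 < C &
      \forall t \near 0^'+,
        ((C * `|ln t| `^ (- (delta * (2 * m + 1) / 2)))%:E <= omega t%:E)%E.
Proof.
move=> m m1.
have [c [D [q [c0 D0 packets]]]] := unstable_packets s1 s2 Lam_sym Lam_miss delta_gt0.
have [_ omega_mono _ _] := omega_mod.
(* With z = 2 (q + 1), e^(n/2) is the (q+1)-st power of e^(n/z) >= n/z, which exceeds D n^q as soon
   as n >= D z^(q+1). *)
pose A : R := 1 + D * (2 * q.+1%:R) ^+ q.+1.
have A1 : 1 <= A.
  by rewrite lerDl mulr_ge0 ?(ltW D0)// exprn_ge0// mulr_ge0.
have decay (n : nat) : A <= n%:R -> D * n%:R ^+ q * expR (- n%:R) <= expR (- n%:R / 2).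
  move=> An; have n0 : 0 < n%:R :> R by lra.
  have -> : expR (- n%:R) = expR (- n%:R / 2) * expR (- n%:R / 2) :> R.
    by rewrite -expRD; congr expR; field.
  rewrite mulrA ler_piMl ?expR_ge0// mulNr expRN ler_pdivrMr ?expR_gt0// mul1r.
  have -> : expR (n%:R / 2) = expR (n%:R / (2 * q.+1%:R)) ^+ q.+1 :> R.
    rewrite -expRM_natl; congr expR; have : q.+1%:R != 0 :> R by [].
    by move: (q.+1%:R) => z z0; field.
  have z0 : 0 < 2 * q.+1%:R :> R by rewrite mulr_gt0.
  move: A1 An; rewrite /A; move: (2 * q.+1%:R : R) z0 => z z0 A1 An.
  apply: (@le_trans _ _ ((n%:R / z) ^+ q.+1)); last first.
    apply: lerXn2r; rewrite ?nnegrE ?expR_ge0 ?divr_ge0 ?(ltW z0)//.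
    by apply: le_trans (expR_ge1Dx _); rewrite lerDr.
  rewrite expr_div_n ler_pdivlMr ?exprn_gt0// [leLHS]mulrAC [leRHS]exprS.
  by apply: ler_wpM2r; [exact: exprn_ge0|lra].
have rate (n : nat) : A <= n%:R ->
    ((c * n%:R `^ (- delta))%:E <= omega (expR (- n%:R / 2))%:E)%E.
  move=> An; have n0 : (0 < n)%N by rewrite -(ltr_nat R); lra.
  have [u [cu du u1 ul uR]] := packets n n0.
  apply: (le_trans ul); apply: (le_trans (stability u cu du u1)).
  apply: omega_mono; last by apply: (le_trans uR); rewrite lee_fin decay.
  (* Monotonicity of [omega] is available on non-negative arguments only, so the quotient norm, an
     infimum of infima, must be seen to be non-negative. *)
  apply: le_ereal_inf_tmp => _ [v _ <-]; apply: le_ereal_inf_tmp => _ [g _ ->].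
  exact: poweR_ge0.
exists (c * 3 `^ (- delta)); first by rewrite mulr_gt0// powR_gt0.
near=> t.
have t0 : 0 < t by near: t; exact: nbhs_right_gt.
have tA : t < expR (- A) by near: t; apply: nbhs_right_lt; exact: expR_gt0.
set L := `|ln t|.
have tE : t = expR (- L).
  rewrite /L ler0_norm ?opprK ?lnK//.
  by rewrite -ln1 ler_ln ?posrE// (le_trans (ltW tA))// -expR0 ler_expR; lra.
have LA : A < L by move: tA; rewrite {1}tE ltr_expR ltrN2.
(* Then 2 L < n <= 3 L: the first inequality gives e^(-n/2) <= t, the second turns n^(- delta) into
   a multiple of L^(- delta). *)
pose n := (Num.truncn (2 * L)).+1.
have /andP[nl nr] : (Num.truncn (2 * L))%:R <= 2 * L < n%:R.
  by apply: Num.Theory.truncn_itv; lra.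
have n3 : n%:R <= 3 * L by rewrite /n -natr1; lra.
have L1 : 1 <= L by lra.
apply: (@le_trans _ _ (c * n%:R `^ (- delta))%:E).
  rewrite lee_fin -mulrA ler_pM2l//.
  apply: (@le_trans _ _ ((3 * L) `^ (- delta))); last first.
    have np : 0 < n%:R :> R by lra.
    have Lp : 0 < 3 * L by lra.
    rewrite !powRN lef_pV2 ?posrE ?powR_gt0//.
    by apply: ge0_ler_powR; rewrite ?nnegrE ?(ltW delta_gt0) ?(ltW np) ?(ltW Lp).
  rewrite powRM//; last lra.
  (* The rate obtained is L^(- delta); as L >= 1, the larger exponent of the claim only weakens
     it. *)
  rewrite ler_pM2l ?powR_gt0//; apply: ler_powR => //.
  by rewrite lerN2 -mulrA ler_peMr ?(ltW delta_gt0)//; lra.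
apply: le_trans (rate n _) _; first lra.
apply: omega_mono; first by rewrite lee_fin expR_ge0.
by rewrite lee_fin tE ler_expR; lra.
Unshelve. all: by end_near.
Qed.
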